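(* Let $R>0$, $B_R=B_R(0)\subset\mathbb{R}^2$ and $F:\mathbb{R}_+\times Y\to X$, $F(\alpha,h)=\operatorname{div}\big(\nabla h/\sqrt{1+|\nabla h|^2}\big)+\alpha h$. Let $\alpha\in C^\infty((-\eta,\eta);\mathbb{R})$, $\alpha(0)=\lambda_1$, and $y\in C^\infty((-\eta,\eta);R(A)\cap Y)$, $y(0)=y'(0)=0$, be the functions for which, modulo the action of $O(2)$, all solutions of $F(\alpha,h)=0$ in a neighborhood $\mathcal{U}$ of $(\lambda_1,0)$ in $\mathbb{R}_+\times Y$ are given by $\{(\alpha(s),su_1+y(s)):|s|<\eta\}\cup\{(\alpha,0):(\alpha,0)\in\mathcal{U}\}$. Then the bifurcation at $(\lambda_1,0)$ is of subcritical type, i.e. $s\alpha'(s)<0$ for $0<|s|<\delta$ and some $\delta>0$.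
   Context: $p>5$ is fixed. $X=\{h\in W_p^{1-1/p}(B_R):\int_{B_R}h\,dx'=0\}$ and $Y=\{h\in W_p^{3-1/p}(B_R)\cap X:\partial_\nu h=0\text{ on }\partial B_R\}$, where $\nu$ is the outer unit normal of $B_R$ and $W_p^s$ are Sobolev–Slobodeckii spaces. $\lambda_1>0$ is the first eigenvalue of the negative Neumann Laplacian $-\Delta_N$ in $X$, $A:=D_hF(\lambda_1,0)=\Delta_N+\lambda_1I:Y\to X$, and $R(A)$ is its range. The kernel of $A$ is two-dimensional, spanned by $u_1^*=J_1(j_{1,1}'r/R)\cos\varphi$ and $u_2^*=J_1(j_{1,1}'r/R)\sin\varphi$ in polar coordinates $(r,\varphi)$ ($J_1$ the Bessel function, $j_{1,1}'$ the first zero of $J_1'$), and $u_j:=u_j^*/\|u_j^*\|_{L_2(B_R)}$. The group $O(2)$ acts on functions on $B_R$ by $h\mapsto h(\mathcal{O}\,\cdot)$, $\mathcal{O}\in O(2)$. *)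

(* Defs.v *)
From HB Require Import structures.
From mathcomp Require Import all_boot all_order all_algebra.
From mathcomp Require Import all_classical all_reals all_analysis.

Set Implicit Arguments.
Unset Strict Implicit.
Unset Printing Implicit Defensive.

Import Order.TTheory GRing.Theory Num.Theory.
Import numFieldNormedType.Exports.

Local Open Scope classical_set_scope.
Local Open Scope ring_scope.

(** The type [R * R] carries the sup norm of the library; it is used here only
    as a topological and measurable space, and Euclidean lengths are written
    with [enorm]. *)
Definition enorm {R : realType} (x : R * R) : R :=
  Num.sqrt (x.1 ^+ 2 + x.2 ^+ 2).

Definition disk {R : realType} (rho : R) : set (R * R) :=
  [set x | enorm x < rho].

Definition closed_disk {R : realType} (rho : R) : set (R * R) :=
  [set x | enorm x <= rho].

Definition leb2 (R : realType) :
    {measure set (measurableTypeR R * measurableTypeR R)%type -> \bar R} :=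
  (@lebesgue_measure R \x @lebesgue_measure R)%E.

(** Elements of a function space over [Om] are represented by functions on the
    whole plane; only their values on [Om] matter, up to null sets. *)
Definition ae_eq_on {R : realType} (Om : set (R * R)) (f g : R * R -> R) : Prop :=
  ae_eq (leb2 R) Om f g.

(** * Classical partial derivatives and test functions *)

Definition pd1 {R : realType} (f : R * R -> R) : R * R -> R :=
  fun x => derive1 (fun t => f (t, x.2)) x.1.

Definition pd2 {R : realType} (f : R * R -> R) : R * R -> R :=
  fun x => derive1 (fun t => f (x.1, t)) x.2.

Definition pd {R : realType} (a b : nat) (f : R * R -> R) : R * R -> R :=
  iter a pd1 (iter b pd2 f).

Fixpoint Ck {R : realType} (k : nat) (f : R * R -> R) : Prop :=
  continuous f /\
  if k is k'.+1 then
    [/\ forall x : R * R, derivable (fun t => f (t, x.2)) x.1 1,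
        forall x : R * R, derivable (fun t => f (x.1, t)) x.2 1,
        Ck k' (pd1 f) & Ck k' (pd2 f)]
  else True.

Definition test_function {R : realType} (Om : set (R * R)) (phi : R * R -> R) :
    Prop :=
  (forall k, Ck k phi) /\
  (exists K : set (R * R),
      [/\ compact K, K `<=` Om & forall x, ~ K x -> phi x = 0]).

(** * Weak derivatives *)

Definition L1loc {R : realType} (Om : set (R * R)) (u : R * R -> R) : Prop :=
  measurable_fun (Om : set (measurableTypeR R * measurableTypeR R)) u /\
  (forall K : set (R * R), compact K -> K `<=` Om ->
     (leb2 R).-integrable K (EFin \o u)).

Definition is_wderiv {R : realType} (Om : set (R * R)) (a b : nat)
    (u g : R * R -> R) : Prop :=
  [/\ L1loc Om u, L1loc Om g &
      forall phi, test_function Om phi ->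
        \int[leb2 R]_(x in Om) (u x * pd a b phi x) =
        (-1) ^+ (a + b) * \int[leb2 R]_(x in Om) (g x * phi x)].

(** A weak derivative d_1^a d_2^b u, unique up to null sets when there is one
    (and 0 when there is none). *)
Definition wD {R : realType} (Om : set (R * R)) (a b : nat) (u : R * R -> R) :
    R * R -> R :=
  xget (cst 0) [set g | is_wderiv Om a b u g].

(** * Sobolev-Slobodeckii spaces *)

Definition Lp_norm {R : realType} (Om : set (R * R)) (p : R) (u : R * R -> R) :
    \bar R :=
  'N[leb2 R]_p%:E[EFin \o (u \_ Om)].

Definition slobodeckii {R : realType} (Om : set (R * R)) (sigma p : R)
    (u : R * R -> R) : \bar R :=
  poweR (\int[leb2 R]_(x in Om) \int[leb2 R]_(y in Om)
           (`|u x - u y| `^ p / enorm (x - y) `^ (2 + sigma * p))%:E)%E p^-1.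

(** The norm of W_p^(m + sigma)(Om), for 0 < sigma < 1. *)
Definition Wnorm {R : realType} (Om : set (R * R)) (m : nat) (sigma p : R)
    (u : R * R -> R) : \bar R :=
  (\sum_(a < m.+1) \sum_(b < m.+1 | (a + b <= m)%N) Lp_norm Om p (wD Om a b u)
   + \sum_(a < m.+1) slobodeckii Om sigma p (wD Om a (m - a) u))%E.

Definition Wspace {R : realType} (Om : set (R * R)) (m : nat) (sigma p : R) :
    set (R * R -> R) :=
  [set u | (forall a b, (a + b <= m)%N -> is_wderiv Om a b u (wD Om a b u)) /\
           (Wnorm Om m sigma p u < +oo)%E].

(** * The spaces X and Y *)

Definition Xspace {R : realType} (rho p : R) : set (R * R -> R) :=
  [set h | Wspace (disk rho) 0 (1 - p^-1) p h /\
           \int[leb2 R]_(x in disk rho) h x = 0].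

(** Since 3 - 1/p - 2/p > 2 for p > 3, the gradient of an element of
    W_p^(3 - 1/p) has a representative which is continuous up to the boundary,
    and the trace of the gradient is the restriction of that representative. *)
Definition neumann {R : realType} (rho : R) (h : R * R -> R) : Prop :=
  exists g1 g2 : R * R -> R,
    [/\ {within closed_disk rho, continuous g1},
        {within closed_disk rho, continuous g2},
        ae_eq_on (disk rho) (wD (disk rho) 1 0 h) g1,
        ae_eq_on (disk rho) (wD (disk rho) 0 1 h) g2 &
        forall x, enorm x = rho ->
          g1 x * (x.1 / rho) + g2 x * (x.2 / rho) = 0].

Definition Yspace {R : realType} (rho p : R) : set (R * R -> R) :=
  [set h | [/\ Wspace (disk rho) 2 (1 - p^-1) p h, Xspace rho p h &
               neumann rho h]].

Definition Ynorm {R : realType} (rho p : R) : (R * R -> R) -> \bar R :=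
  Wnorm (disk rho) 2 (1 - p^-1) p.

(** * The operators *)

Definition Fop {R : realType} (rho alpha : R) (h : R * R -> R) : R * R -> R :=
  let D := wD (disk rho) in
  let w := fun x => Num.sqrt (1 + enorm (D 1%N 0%N h x, D 0%N 1%N h x) ^+ 2) in
  fun x => D 1%N 0%N (fun z => D 1%N 0%N h z / w z) x
         + D 0%N 1%N (fun z => D 0%N 1%N h z / w z) x
         + alpha * h x.

Definition laplacian {R : realType} (rho : R) (h : R * R -> R) : R * R -> R :=
  fun x => wD (disk rho) 2 0 h x + wD (disk rho) 0 2 h x.

Definition neumann_eigenvalue {R : realType} (rho p lambda : R) : Prop :=
  exists h, [/\ Yspace rho p h, ~ ae_eq_on (disk rho) h (cst 0) &
    ae_eq_on (disk rho) (fun x => - laplacian rho h x) (fun x => lambda * h x)].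

Definition first_neumann_eigenvalue {R : realType} (rho p lambda : R) : Prop :=
  neumann_eigenvalue rho p lambda /\
  (forall mu, neumann_eigenvalue rho p mu -> lambda <= mu).

Definition Aop {R : realType} (rho lambda : R) (h : R * R -> R) : R * R -> R :=
  fun x => laplacian rho h x + lambda * h x.

Definition Arange {R : realType} (rho p lambda : R) : set (R * R -> R) :=
  [set f | exists2 h, Yspace rho p h & ae_eq_on (disk rho) f (Aop rho lambda h)].

(** * The eigenfunction u_1 *)

Definition besselJ1 {R : realType} (x : R) : R :=
  limn (series (fun k : nat =>
    (-1) ^+ k / (k`!%:R * (k.+1)`!%:R) * (x / 2) ^+ (2 * k + 1))).

Definition first_zero_besselJ1' {R : realType} (j : R) : Prop :=
  [/\ 0 < j, derive1 besselJ1 j = 0 &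
      forall x, 0 < x < j -> derive1 besselJ1 x != 0].

(** In polar coordinates [cos phi = x.1 / r]; at the origin both sides of the
    formula vanish because [besselJ1 0 = 0]. *)
Definition u1star {R : realType} (rho j : R) : R * R -> R :=
  fun x => besselJ1 (j * enorm x / rho) * (x.1 / enorm x).

Definition u1 {R : realType} (rho j : R) : R * R -> R :=
  fun x => u1star rho j x / fine (Lp_norm (disk rho) 2 (u1star rho j)).

(** * Smooth functions of one real parameter *)

Definition smooth_on {R : realType} (I : set R) (f : R -> R) : Prop :=
  forall n s, I s -> derivable (derive1n n f) s 1.

(** [v] is the derivative at [s] of the curve [c], for the norm [N]. *)
Definition curve_deriv {R : realType} (N : (R * R -> R) -> \bar R)
    (c : R -> R * R -> R) (s : R) (v : R * R -> R) : Prop :=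
  (fun t : R => N (fun x => t^-1 * (c (s + t) x - c s x) - v x)) @ 0^' --> 0%E.

Definition smooth_curve {R : realType} (Z : set (R * R -> R))
    (N : (R * R -> R) -> \bar R) (I : set R) (c : R -> R * R -> R) : Prop :=
  exists d : nat -> R -> R * R -> R,
    d 0%N = c /\
    (forall n s, I s -> Z (d n s) /\ curve_deriv N (d n) s (d n.+1 s)).

(** * The action of O(2) and neighbourhoods in R_+ x Y *)

Definition orthogonal2 {R : realType} (M : 'M[R]_2) : Prop := M *m M^T = 1%:M.

Definition mxapp {R : realType} (M : 'M[R]_2) (x : R * R) : R * R :=
  (M 0 0 * x.1 + M 0 1 * x.2, M 1 0 * x.1 + M 1 1 * x.2).

Definition nbhd_bif {R : realType} (rho p lambda : R)
    (U : set (R * (R * R -> R))) : Prop :=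
  (forall a h, U (a, h) -> 0 <= a /\ Yspace rho p h) /\
  (exists2 e : R, 0 < e &
     forall a h, 0 <= a -> Yspace rho p h -> `|a - lambda| < e ->
       (Ynorm rho p h < e%:E)%E -> U (a, h)).

(* Main.v *)
Require Import Defs.
From mathcomp Require Import all_boot all_order all_algebra.
From mathcomp Require Import all_classical all_reals all_analysis.
From mathcomp Require Import measurable_realfun ring lra.

Set Implicit Arguments.
Unset Strict Implicit.
Unset Printing Implicit Defensive.

Import Order.TTheory GRing.Theory Num.Theory.
Import numFieldNormedType.Exports.

Local Open Scope classical_set_scope.
Local Open Scope ring_scope.

(** The branch is compared with its tangent by integration, without any
    Lyapunov-Schmidt expansion. Write U for the mode u_1, m for its eigenvalue
    (j / rho)^2, and h_s = s u_1 + y(s) = s (U + z_s); the hypothesis on y'(0)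
    says that z_s tends to 0 in the norm of Y. Testing the equation
    div (grad h / sqrt (1 + |grad h|^2)) + alpha h = 0 for h = h_s with U, and the
    linear equation Delta U + m U = 0 with h_s, and subtracting, gives
      (m - alpha(s)) * integral of (U + z_s) U = s^2 * integral of
        |xi|^2 (xi . grad U) / (w (w + 1)),
    where xi = grad U + grad z_s and w = sqrt (1 + s^2 |xi|^2)
    ([bifurcation_identity]). For z_s = 0 the integrand on the right is
    |grad U|^4 / (w (w + 1)), and in general it is at least a positive multiple of
    |grad U|^4 minus a multiple of |grad z_s|^4 ([cubic_density_lower]), and at
    most a multiple of their sum ([cubic_density_upper]). Since
    p >= 4, the L^p smallness of grad z_s makes that error negligible
    ([Lp_norm_small]), so that m - C s^2 <= alpha(s) <= m - c s^2 near 0 with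
    c > 0 ([branch_quadratic_bounds]). Hence alpha has a strict quadratic maximum
    at 0, alpha''(0) < 0, and alpha'(s) has the sign of - s
    ([derive1_sign_of_quadratic_max]).

    Both integrations by parts have to be justified for weak derivatives and for
    test functions that do not vanish at the boundary. For the nonlinear equation
    the weak derivatives of the flux must first be shown to exist, the derivative
    [wD] being 0 otherwise: this is the chain rule [is_wderiv_chain], obtained on
    almost every line parallel to an axis, where a function with an integrable
    weak derivative is a primitive ([weak_lines]) and densities can be
    approximated by continuous functions ([chain_AC]). Interior test functions
    are then replaced by U with the cutoffs [chi n], whose gradients concentrate
    at the circle and are radial there; the Neumann conditions, satisfied by h_s
    in the trace sense and by U because J_1'(j) = 0, remove the boundary terms
    ([flux_weak_boundary], [green_helmholtz]).

    That U solves the Helmholtz equation follows from the power series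
    J_1(z) = (z / 2) B(z^2), for which Bessel's equation is a recursion on the
    coefficients ([besselB_ode], [eigfun_helmholtz]). *)

(** * Measurability and integration on the plane *)

(** The topology of the plane has a countable base of rational rectangles. *)
Lemma measurable_open_plane (R : realType) (U : set (R * R)) : open U ->
  measurable (U : set (measurableTypeR R * measurableTypeR R)).
Proof.
move=> oU.
pose box (q : (rat * rat) * (rat * rat)) : set (R * R) :=
  `]ratr q.1.1, ratr q.1.2[%classic `*` `]ratr q.2.1, ratr q.2.2[%classic.
pose V q := if `[< box q `<=` U >] then box q else set0.
have -> : U = \bigcup_q V q.
  apply/seteqP; split=> [x Ux|x [q _]]; last first.
    by rewrite /V; case: asboolP => // h /h.
  have [[A B] /= [nA nB] AB] := oU x Ux.
  move: nA nB => /nbhs_ballP[e1 /= e10 s1] /nbhs_ballP[e2 /= e20 s2].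
  have aux (t e : R) : 0 < e -> exists q1 q2 : rat,
      [/\ ratr q1 < t, t < ratr q2 & forall z : R, ratr q1 < z < ratr q2 -> `|t - z| < e].
    move=> e0.
    have /rat_in_itvoo[q1 /itvP h1] : t - e < t by rewrite ltrBlDr ltrDl.
    have /rat_in_itvoo[q2 /itvP h2] : t < t + e by rewrite ltrDl.
    exists q1, q2; split; rewrite ?h1 ?h2// => z /andP[z1 z2].
    rewrite ltr_distlC; apply/andP; split; first by apply: lt_trans z1; rewrite h1.
    by apply: (lt_trans z2); rewrite h2.
  have [q1 [q2 [h1 h2 h3]]] := aux x.1 e1 e10.
  have [r1 [r2 [g1 g2 g3]]] := aux x.2 e2 e20.
  exists ((q1, q2), (r1, r2)) => //; rewrite /V asboolT; last first.
    by move=> z [/= z1 z2]; apply: AB; split; [apply: s1|apply: s2];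
      rewrite /ball /=; [apply: h3|apply: g3]; move: z1 z2; rewrite !in_itv.
  by rewrite /box /=; split => /=; rewrite in_itv /= ?h1 ?h2 ?g1 ?g2.
apply: countable_bigcupT_measurable; first exact: countableP.
move=> q; rewrite /V; case: ifP => _; last exact: measurable0.
by apply: measurableX; exact: measurable_itv.
Qed.

Lemma continuous_measurable_plane (R : realType) (f : R * R -> R) :
  continuous f ->
  measurable_fun (setT : set (measurableTypeR R * measurableTypeR R)) f.
Proof.
move=> /continuousP cf; apply: (measurability _ (RGenOpens.measurableE R)).
move=> _ [_ [a [b ->] <-]]; rewrite setTI; apply: measurable_open_plane.
exact/cf/interval_open.
Qed.

(** Integrals are kept real-valued throughout, so that identities between them
    can be handled by ring reasoning. *)
Section Rintegral_tools.
Context d (T : measurableType d) (R : realType).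
Variable mu : {measure set T -> \bar R}.
Implicit Types (D : set T) (f g : T -> R).

Lemma RintD D f g : measurable D ->
  mu.-integrable D (EFin \o f) -> mu.-integrable D (EFin \o g) ->
  mu.-integrable D (EFin \o (fun x => f x + g x)).
Proof. by move=> mD i1 i2; have := integrableD mD i1 i2. Qed.

Lemma RintB D f g : measurable D ->
  mu.-integrable D (EFin \o f) -> mu.-integrable D (EFin \o g) ->
  mu.-integrable D (EFin \o (fun x => f x - g x)).
Proof. by move=> mD i1 i2; have := integrableB mD i1 i2. Qed.

Lemma RintZ D f k : measurable D ->
  mu.-integrable D (EFin \o f) ->
  mu.-integrable D (EFin \o (fun x => k * f x)).
Proof. by move=> mD i1; have := integrableZl mD k i1. Qed.

Lemma Rint_le D f g : measurable D -> measurable_fun D f ->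
  (forall x, D x -> `|f x| <= g x) -> mu.-integrable D (EFin \o g) ->
  mu.-integrable D (EFin \o f).
Proof.
move=> mD mf fg; apply: le_integrable => //; first exact/measurable_EFinP.
by move=> x Dx /=; rewrite lee_fin (le_trans (fg _ Dx))// ler_norm.
Qed.

Lemma Rint_measurable D f : mu.-integrable D (EFin \o f) -> measurable_fun D f.
Proof. by move=> /measurable_int/measurable_EFinP. Qed.

Lemma Rint_mul_bounded D f g C : measurable D ->
  mu.-integrable D (EFin \o f) -> measurable_fun D g ->
  (forall x, D x -> `|g x| <= C) ->
  mu.-integrable D (EFin \o (fun x => f x * g x)).
Proof.
move=> mD fi mg gC; apply: (@Rint_le _ _ (fun x => C * `|f x|)) => //.
- by apply: measurable_funM => //; exact: Rint_measurable fi.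
- by move=> x Dx; rewrite normrM mulrC ler_wpM2r// gC.
- by apply: RintZ => //; exact: (integrable_norm fi).
Qed.

Lemma Rint_norm D f : mu.-integrable D (EFin \o f) ->
  mu.-integrable D (EFin \o (fun x => `|f x|)).
Proof. exact: integrable_norm. Qed.

Lemma Rint_bounded D f C : measurable D -> (mu D < +oo)%E ->
  measurable_fun D f -> (forall x, D x -> `|f x| <= C) ->
  mu.-integrable D (EFin \o f).
Proof.
move=> mD Dfin mf fC; apply: measurable_bounded_integrable => //.
by exists C; split; rewrite ?num_real// => M CM x Dx; exact: (le_trans (fC x Dx) (ltW CM)).
Qed.

Lemma Rint_ae_eq D f g : measurable D -> measurable_fun D g ->
  ae_eq mu D f g -> mu.-integrable D (EFin \o f) ->
  mu.-integrable D (EFin \o g).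
Proof.
move=> mD mg fg fi; apply/integrableP; split; first exact/measurable_EFinP.
have /integrableP[mf] := fi; congr (_ < _)%E; apply: ae_eq_integral => //.
- exact: measurableT_comp.
- by apply: measurableT_comp => //; exact/measurable_EFinP.
- by apply: filterS fg => x h Dx /=; rewrite h.
Qed.

Lemma ae_eq_Rintegral D f g : measurable D -> measurable_fun D f ->
  measurable_fun D g -> ae_eq mu D f g ->
  \int[mu]_(x in D) f x = \int[mu]_(x in D) g x.
Proof.
move=> mD mf mg fg; rewrite /Rintegral; congr fine.
apply: ae_eq_integral => //; try exact/measurable_EFinP.
by apply: filterS fg => x h Dx /=; rewrite h.
Qed.

Lemma Rintegral_le_norm D f g : measurable D ->
  mu.-integrable D (EFin \o f) -> mu.-integrable D (EFin \o g) ->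
  (forall x, D x -> `|f x| <= g x) ->
  `|\int[mu]_(x in D) f x| <= \int[mu]_(x in D) g x.
Proof.
move=> mD fi gi fg; apply: (le_trans (le_normr_Rintegral mD fi)).
by apply: le_Rintegral => //; exact: integrable_norm.
Qed.

Lemma Rdominated_cvg D (f_ : nat -> T -> R) f g : measurable D ->
  (forall n, measurable_fun D (f_ n)) ->
  (forall x, D x -> f_ n x @[n --> \oo] --> f x) ->
  mu.-integrable D (EFin \o g) ->
  (forall n x, D x -> `|f_ n x| <= g x) ->
  mu.-integrable D (EFin \o f) /\
  \int[mu]_(x in D) f_ n x @[n --> \oo] --> \int[mu]_(x in D) f x.
Proof.
move=> mD mf cf gi fg.
have mF : measurable_fun D f by apply: (measurable_fun_cvg mf cf).
have m1 n : measurable_fun D (EFin \o f_ n) by exact/measurable_EFinP.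
have m2 : measurable_fun D (EFin \o f) by exact/measurable_EFinP.
have c1 : {ae mu, forall x, D x -> (EFin \o f_ n) x @[n --> \oo] --> (EFin \o f) x}.
  by apply: aeW => x Dx; apply: cvg_EFin; [exact: nearW|exact: cf].
have b1 : {ae mu, forall x n, D x -> (`|(EFin \o f_ n) x| <= (EFin \o g) x)%E}.
  by apply: aeW => x n Dx; rewrite /= lee_fin fg.
have [i _ c] := dominated_convergence mD m1 m2 c1 gi b1.
split=> //; apply: fine_cvg; move: c; congr (_ --> _).
by rewrite /Rintegral fineK//; exact: integrable_fin_num.
Qed.

Lemma Rintegral_ae0_le D f : measurable D -> mu.-integrable D (EFin \o f) ->
  (forall x, D x -> 0 <= f x) -> \int[mu]_(x in D) f x = 0 ->
  ae_eq mu D f (cst 0).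
Proof.
move=> mD fi f0 h.
have mf : measurable_fun D (EFin \o f) by have /integrableP[] := fi.
have : (\int[mu]_(x in D) `|(EFin \o f) x| = 0)%E.
  have fin : (\int[mu]_(x in D) (f x)%:E \is a fin_num)%E by exact: integrable_fin_num.
  move: h; rewrite /Rintegral => h.
  rewrite (eq_integral (EFin \o f)); last first.
    by move=> x; rewrite inE => Dx /=; rewrite ger0_norm// f0.
  by rewrite -(fineK fin) h.
move/(ae_eq_integral_abs mu mD mf) => H; apply: filterS H => x h' Dx.
by have [] := h' Dx.
Qed.

End Rintegral_tools.

Section ae_tools.
Context d (T : measurableType d) (R : realType).
Variable mu : {measure set T -> \bar R}.
Implicit Types (P Q S : T -> Prop).

Lemma ae_mono P Q : (forall x, P x -> Q x) ->
  {ae mu, forall x, P x} -> {ae mu, forall x, Q x}.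
Proof.
by move=> PQ; apply: filterS => x; exact: PQ.
Qed.

Lemma ae_mono2 P Q S : (forall x, P x -> Q x -> S x) ->
  {ae mu, forall x, P x} -> {ae mu, forall x, Q x} -> {ae mu, forall x, S x}.
Proof.
by move=> PQS; apply: filterS2 => x; exact: PQS.
Qed.

End ae_tools.

Section Rfubini.
Variable R : realType.
Notation mu := (@lebesgue_measure R).
Variable f : R * R -> R.
Hypothesis fi : (leb2 R).-integrable setT (EFin \o f).

Lemma Rint_slice :
  {ae mu, forall y, mu.-integrable setT (EFin \o (fun x => f (x, y)))}.
Proof. exact: (ae_integrable2 fi). Qed.

Let aeG : {ae mu, forall y, setT y -> (\int[mu]_x (f (x, y))%:E)%E =
  ((\int[mu]_x f (x, y)))%:E}.
Proof.
apply: filterS Rint_slice; first exact: (ae_filter_ringOfSetsType mu).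
move=> y h _; by rewrite /Rintegral fineK//; exact: integrable_fin_num.
Qed.

Let mG : measurable_fun (setT : set (measurableTypeR R))
  (fun y => \int[mu]_x f (x, y)).
Proof.
have := measurable_fubini_G fi; rewrite /fubini_G => m.
have -> : (fun y => \int[mu]_x f (x, y)) =
   (@fine R) \o (fun y => (\int[mu]_x (f (x, y))%:E)%E) by [].
exact: measurableT_comp.
Qed.

Lemma Rint_fubini :
  mu.-integrable setT (EFin \o (fun y => \int[mu]_x f (x, y))).
Proof.
apply/integrableP; split; first exact/measurable_EFinP.
have /integrableP[mf _] := fi.
have H := (integrable21ltyP mu mu mf).1 fi; apply: (le_lt_trans _ H).
apply: ae_ge0_le_integral => //.
- by apply: measurableT_comp => //; exact/measurable_EFinP.
- by move=> y _; exact: integral_ge0.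
- apply: (@measurable_fun_fubini_tonelli_G _ _ _ _ _ mu (abse \o (EFin \o f))) => //=.
  exact: measurableT_comp.
- apply: filterS aeG; first exact: (ae_filter_ringOfSetsType mu).
  move=> y h _ /=; rewrite (_ : `|\int[mu]_x f (x, y)|%:E =
      `|\int[mu]_x (f (x, y))%:E|%E); last by rewrite (h I).
  apply: le_abse_integral => //.
  exact: (measurableT_comp mf (pair2_measurable y)).
Qed.

Lemma Rfubini :
  \int[leb2 R]_z f z = \int[mu]_y (\int[mu]_x f (x, y)).
Proof.
rewrite /Rintegral; congr fine.
rewrite -(integral21_prod_meas1 fi) /fubini_G.
apply: ae_eq_integral => //.
- exact: (measurable_fubini_G fi).
- exact/measurable_EFinP.
Qed.

End Rfubini.

(** * Calculus of smooth functions on the plane *)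

Section Ck_calculus.
Variable R : realType.
Implicit Types (f g : R * R -> R) (h : R -> R).

Definition smooth f := forall k, Ck k f.

Lemma pd1P f x d : is_derive x.1 (1:R) (fun t => f (t, x.2)) d -> pd1 f x = d.
Proof. by move=> H; rewrite /pd1 derive1E derive_val. Qed.

Lemma pd2P f x d : is_derive x.2 (1:R) (fun t => f (x.1, t)) d -> pd2 f x = d.
Proof. by move=> H; rewrite /pd2 derive1E derive_val. Qed.

Definition D1 f := forall x : R * R, derivable (fun t => f (t, x.2)) x.1 1.
Definition D2 f := forall x : R * R, derivable (fun t => f (x.1, t)) x.2 1.

Lemma D1P f : D1 f -> forall x : R * R,
  is_derive x.1 (1 : R) (fun t => f (t, x.2)) (pd1 f x).
Proof. by move=> df x; rewrite /pd1 derive1E; apply/derivableP; exact: df. Qed.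

Lemma D2P f : D2 f -> forall x : R * R,
  is_derive x.2 (1 : R) (fun t => f (x.1, t)) (pd2 f x).
Proof. by move=> df x; rewrite /pd2 derive1E; apply/derivableP; exact: df. Qed.

Lemma CkS k f : Ck k.+1 f <-> [/\ continuous f, D1 f, D2 f, Ck k (pd1 f) & Ck k (pd2 f)].
Proof.
split=> [[c [d1 d2 c1 c2]]|[c d1 d2 c1 c2]]; first exact: (And5 c d1 d2 c1 c2).
exact: (conj c (And4 d1 d2 c1 c2)).
Qed.

Lemma Ck_cont k f : Ck k f -> continuous f.
Proof. by case: k => [|k] []. Qed.

Lemma CkW k f : Ck k.+1 f -> Ck k f.
Proof.
elim: k f => [|k IH] f /CkS[c d1 d2 c1 c2]; first by split.
by apply/CkS; split => //; exact: IH.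
Qed.

Lemma Ck_cst k (c : R) : Ck k (cst c).
Proof.
elim: k c => [|k IH] c; first by split => // x; exact: cvg_cst.
have e1 : pd1 (cst c) = cst 0.
  by apply/funext => x; rewrite /pd1 derive1E derive_cst.
have e2 : pd2 (cst c) = cst 0.
  by apply/funext => x; rewrite /pd2 derive1E derive_cst.
by apply/CkS; split; rewrite ?e1 ?e2//; move=> x; try exact: derivable_cst; exact: cvg_cst.
Qed.

Lemma Ck_fst k : Ck k (fst : R * R -> R).
Proof.
have e1 : pd1 (fst : R * R -> R) = cst 1.
  by apply/funext => x; apply: pd1P => /=; exact: is_derive_id.
have e2 : pd2 (fst : R * R -> R) = cst 0.
  by apply/funext => x; apply: pd2P => /=; exact: is_derive_cst.
case: k => [|k]; first by split => // x; exact: cvg_fst.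
apply/CkS; split; rewrite ?e1 ?e2; try exact: Ck_cst.
- by move=> x; exact: cvg_fst.
- by move=> x /=; exact: derivable_id.
- by move=> x /=; exact: derivable_cst.
Qed.

Lemma Ck_snd k : Ck k (snd : R * R -> R).
Proof.
have e1 : pd1 (snd : R * R -> R) = cst 0.
  by apply/funext => x; apply: pd1P => /=; exact: is_derive_cst.
have e2 : pd2 (snd : R * R -> R) = cst 1.
  by apply/funext => x; apply: pd2P => /=; exact: is_derive_id.
case: k => [|k]; first by split => // x; exact: cvg_snd.
apply/CkS; split; rewrite ?e1 ?e2; try exact: Ck_cst.
- by move=> x; exact: cvg_snd.
- by move=> x /=; exact: derivable_cst.
- by move=> x /=; exact: derivable_id.
Qed.

Lemma pd1D f g : D1 f -> D1 g -> pd1 (fun x => f x + g x) = (fun x => pd1 f x + pd1 g x).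
Proof.
move=> df dg; apply/funext => x; apply: pd1P.
by have h1 := D1P df x; have h2 := D1P dg x; exact: is_deriveD.
Qed.

Lemma pd2D f g : D2 f -> D2 g -> pd2 (fun x => f x + g x) = (fun x => pd2 f x + pd2 g x).
Proof.
move=> df dg; apply/funext => x; apply: pd2P.
by have h1 := D2P df x; have h2 := D2P dg x; exact: is_deriveD.
Qed.

Lemma pd1M f g : D1 f -> D1 g ->
  pd1 (fun x => f x * g x) = (fun x => f x * pd1 g x + g x * pd1 f x).
Proof.
move=> df dg; apply/funext => x; apply: pd1P.
have h1 := D1P df x; have h2 := D1P dg x.
have := @is_deriveM _ _ _ _ _ _ _ _ h1 h2.
by rewrite /GRing.scale /= -surjective_pairing.
Qed.

Lemma pd2M f g : D2 f -> D2 g ->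
  pd2 (fun x => f x * g x) = (fun x => f x * pd2 g x + g x * pd2 f x).
Proof.
move=> df dg; apply/funext => x; apply: pd2P.
have h1 := D2P df x; have h2 := D2P dg x.
have := @is_deriveM _ _ _ _ _ _ _ _ h1 h2.
by rewrite /GRing.scale /= -surjective_pairing.
Qed.

Lemma Ck_D1 k f : Ck k.+1 f -> D1 f. Proof. by move=> /CkS[]. Qed.
Lemma Ck_D2 k f : Ck k.+1 f -> D2 f. Proof. by move=> /CkS[]. Qed.

Lemma Ck_add k f g : Ck k f -> Ck k g -> Ck k (fun x => f x + g x).
Proof.
elim: k f g => [|k IH] f g.
  by move=> [cf _] [cg _]; split => // x; apply: cvgD; [exact: cf|exact: cg].
move=> /CkS[c d1 d2 c1 c2] /CkS[c' d1' d2' c1' c2']; apply/CkS; split.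
- by move=> x; apply: cvgD; [exact: c|exact: c'].
- by move=> x; apply: derivableD; [exact: d1|exact: d1'].
- by move=> x; apply: derivableD; [exact: d2|exact: d2'].
- by rewrite pd1D//; exact: IH.
- by rewrite pd2D//; exact: IH.
Qed.

Lemma Ck_mul k f g : Ck k f -> Ck k g -> Ck k (fun x => f x * g x).
Proof.
elim: k f g => [|k IH] f g.
  by move=> [cf _] [cg _]; split => // x; apply: cvgM; [exact: cf|exact: cg].
move=> Cf Cg; have [c d1 d2 c1 c2] := (iffLR (CkS _ _)) Cf.
have [c' d1' d2' c1' c2'] := (iffLR (CkS _ _)) Cg; apply/CkS; split.
- by move=> x; apply: cvgM; [exact: c|exact: c'].
- by move=> x; apply: derivableM; [exact: d1|exact: d1'].
- by move=> x; apply: derivableM; [exact: d2|exact: d2'].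
- by rewrite pd1M//; apply: Ck_add; apply: IH => //; exact: CkW.
- by rewrite pd2M//; apply: Ck_add; apply: IH => //; exact: CkW.
Qed.

Lemma Ck_scale k f (c : R) : Ck k f -> Ck k (fun x => c * f x).
Proof. by move=> h; apply: Ck_mul => //; exact: Ck_cst. Qed.

Lemma Ck_opp k f : Ck k f -> Ck k (fun x => - f x).
Proof.
move=> h; have := Ck_scale (-1) h; congr Ck.
by apply/funext => x; rewrite mulN1r.
Qed.

Lemma Ck_sub k f g : Ck k f -> Ck k g -> Ck k (fun x => f x - g x).
Proof. by move=> h1 h2; apply: Ck_add => //; exact: Ck_opp. Qed.

(** The regularity asked of an outer function in [Ck_comp]. *)
Fixpoint Ck1 (k : nat) h : Prop :=
  if k is k'.+1 then (forall t, derivable h t 1) /\ Ck1 k' (derive1 h)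
  else continuous h.

Lemma Ck1_cont k h : Ck1 k h -> continuous h.
Proof.
case: k => [//|k] [dh _] x.
by apply/differentiable_continuous/derivable1_diffP; exact: dh.
Qed.

Lemma pd1_comp h f : (forall t, derivable h t 1) -> D1 f ->
  pd1 (h \o f) = (fun x => derive1 h (f x) * pd1 f x).
Proof.
move=> dh df; apply/funext => x; apply: pd1P.
have h1 := D1P df x.
have h2 : is_derive (f (x.1, x.2)) (1:R) h (derive1 h (f x)).
  by rewrite -surjective_pairing derive1E; apply/derivableP; exact: dh.
have := @is_derive1_comp _ h (fun t => f (t, x.2)) _ _ _ h2 h1.
by rewrite /GRing.scale /=.
Qed.

Lemma pd2_comp h f : (forall t, derivable h t 1) -> D2 f ->
  pd2 (h \o f) = (fun x => derive1 h (f x) * pd2 f x).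
Proof.
move=> dh df; apply/funext => x; apply: pd2P.
have h1 := D2P df x.
have h2 : is_derive (f (x.1, x.2)) (1:R) h (derive1 h (f x)).
  by rewrite -surjective_pairing derive1E; apply/derivableP; exact: dh.
have := @is_derive1_comp _ h (fun t => f (x.1, t)) _ _ _ h2 h1.
by rewrite /GRing.scale /=.
Qed.

Lemma Ck_comp k h f : Ck1 k h -> Ck k f -> Ck k (h \o f).
Proof.
elim: k h f => [|k IH] h f.
  by move=> ch [cf _]; split => // x; apply: continuous_comp; [exact: cf|exact: ch].
move=> Ch Cf; have [dh Ch'] := Ch; have [c d1 d2 c1 c2] := (iffLR (CkS _ _)) Cf.
apply/CkS; split.
- by move=> x; apply: continuous_comp; [exact: c|exact: (Ck1_cont Ch)].
- move=> x; have h1 := D1P d1 x.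
  have h2 : is_derive (f (x.1, x.2)) (1:R) h (derive1 h (f x)).
    by rewrite -surjective_pairing derive1E; apply/derivableP; exact: dh.
  by have [] := @is_derive1_comp _ h (fun t => f (t, x.2)) _ _ _ h2 h1.
- move=> x; have h1 := D2P d2 x.
  have h2 : is_derive (f (x.1, x.2)) (1:R) h (derive1 h (f x)).
    by rewrite -surjective_pairing derive1E; apply/derivableP; exact: dh.
  by have [] := @is_derive1_comp _ h (fun t => f (x.1, t)) _ _ _ h2 h1.
- by rewrite pd1_comp//; apply: Ck_mul => //; apply: IH => //; exact: CkW.
- by rewrite pd2_comp//; apply: Ck_mul => //; apply: IH => //; exact: CkW.
Qed.

Lemma Ck1_add k h1 h2 : Ck1 k h1 -> Ck1 k h2 -> Ck1 k (fun t => h1 t + h2 t).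
Proof.
elim: k h1 h2 => [|k IH] h1 h2.
  by move=> c1 c2 x; apply: cvgD; [exact: c1|exact: c2].
move=> [d1 C1] [d2 C2]; split; first by move=> t; apply: derivableD.
have -> : derive1 (fun t => h1 t + h2 t) = (fun t => derive1 h1 t + derive1 h2 t).
  by apply/funext => t; rewrite !derive1E; apply: (@deriveD _ _ _ h1 h2).
exact: IH.
Qed.

Lemma Ck1_scale k c h1 : Ck1 k h1 -> Ck1 k (fun t => c * h1 t).
Proof.
elim: k h1 => [|k IH] h1.
  by move=> c1 x; apply: cvgM; [exact: cvg_cst|exact: c1].
move=> [d1 C1]; split; first by move=> t; apply: (@derivableZ _ _ _ h1 c).
have -> : derive1 (fun t => c * h1 t) = (fun t => c * derive1 h1 t).
  by apply/funext => t; rewrite !derive1E; apply: (@deriveZ _ _ _ h1 c).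
exact: IH.
Qed.

End Ck_calculus.

(** * Bump functions *)

Section bump.
Variable R : realType.
Implicit Types (t : R) (k : nat).

(** The classical flat function exp(-1/t) is [flat 0]; the powers of 1/t close
    the family under differentiation. *)
Definition flat k t : R := if 0 < t then t^-1 ^+ k * expR (- t^-1) else 0.

Lemma flat_ge0 k t : 0 <= flat k t.
Proof.
by rewrite /flat; case: ifPn => // t0; rewrite mulr_ge0 ?expR_ge0// exprn_ge0// invr_ge0 ltW.
Qed.

Lemma flat_le0 k t : t <= 0 -> flat k t = 0.
Proof. by rewrite /flat leNgt; case: ifP. Qed.

Lemma flat_gt0 k t : 0 < t -> 0 < flat k t.
Proof. by move=> t0; rewrite /flat t0 mulr_gt0 ?expR_gt0// exprn_gt0// invr_gt0. Qed.

Lemma flat_mulS k t : t * flat k.+1 t = flat k t.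
Proof.
rewrite /flat; case: ifPn => [t0|_]; last by rewrite mulr0.
by rewrite exprS !mulrA divff ?mul1r// gt_eqF.
Qed.

(** The exponential series at [1/t] dominates its term of degree [k.+1]. *)
Lemma flat_le k t : flat k.+1 t <= (k.+1)`!%:R.
Proof.
rewrite /flat; case: ifPn => t0 //.
have u0 : 0 <= t^-1 by rewrite invr_ge0 ltW.
have := expR_ge1Dxn k u0; rewrite expRN => h.
rewrite ler_pdivrMr ?expR_gt0// mulrC -ler_pdivrMr ?ltr0n ?fact_gt0//.
by apply: le_trans h; rewrite lerDr.
Qed.

Lemma flat0_le1 t : flat 0 t <= 1.
Proof.
rewrite /flat; case: ifPn => t0 //; rewrite mul1r expR_le1 oppr_le0 invr_ge0.
exact: ltW.
Qed.

Lemma flat01_le1 t : flat 0 t + flat 1 t <= 1.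
Proof.
rewrite /flat; case: ifPn => t0; last by rewrite addr0.
rewrite expr0 expr1 -mulrDl expRN ler_pdivrMr ?expR_gt0// mul1r.
exact: expR_ge1Dx.
Qed.

Lemma flat_le_lin k t : `|flat k t| <= (k.+1)`!%:R * `|t|.
Proof. by rewrite -flat_mulS normrM mulrC ler_wpM2r// ger0_norm ?flat_ge0// flat_le. Qed.

Lemma is_derive_flat k t :
  is_derive t (1:R) (flat k) (flat k.+2 t - k%:R * flat k.+1 t).
Proof.
have [t0|t0|->] := ltgtP t 0.
- rewrite !(flat_le0 _ (ltW t0)) mulr0 subr0.
  have H := @is_derive_cst R R R 0 t 1.
  apply: (near_eq_is_derive _ H).
  near=> z; rewrite flat_le0//= ltW//; near: z; exact: lt_nbhsl.
- pose g (z : R) := z^-1 ^+ k * expR (- z^-1).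
  have d1 : is_derive t (1:R) (fun z : R => z^-1) (- t ^- 2).
    have := @is_deriveV R id t 1 1 (lt0r_neq0 t0) _.
    by rewrite /GRing.scale /= mulr1; apply; exact: is_derive_id.
  have d2 : is_derive t (1:R) (fun z : R => expR (- z^-1)) (expR (- t^-1) * t ^- 2).
    have d3 : is_derive t (1:R) (fun z : R => - z^-1) (t ^- 2).
      by have := is_deriveN d1; rewrite opprK.
    exact: is_derive1_comp.
  have := is_deriveM (is_deriveX k d1) d2 => H.
  have E : \near t, g t = flat k t.
    by near=> z; rewrite /g /flat ifT//; near: z; exact: lt_nbhsr.
  apply: (near_eq_is_derive E).
  have -> : g = (fun z : R => z^-1) ^+ k * (fun z => expR (- z^-1)).
    by apply/funext => z; rewrite /g !fctE.
  apply: (is_derive_eq H).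
  rewrite /flat t0 /GRing.scale /= !fctE /=.
  case: k {H g E} => [|k]; first by rewrite !mul0r !mulr0 addr0 subr0 expr0 mul1r mulrC exprVn.
  rewrite /= -!exprVn !exprS; ring.
(* at the junction, [flat k.+1] is the difference quotient of [flat k] *)
- rewrite !(flat_le0 _ (lexx 0)) mulr0 subr0.
  apply/is_derive1_caratheodory; exists (flat k.+1); split.
  + by move=> z; rewrite (flat_le0 _ (lexx 0)) !subr0 mulrC flat_mulS.
  + rewrite /prop_for /continuous_at (flat_le0 k.+1 (lexx 0)); apply/cvgr0Pnorm_lt => e e0.
    have f0 : 0 < e / (k.+2)`!%:R by rewrite divr_gt0// ltr0n fact_gt0.
    near=> z; apply: (le_lt_trans (flat_le_lin _ _)).
    rewrite mulrC -ltr_pdivlMr ?ltr0n ?fact_gt0//.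
  + exact: flat_le0.
Unshelve. all: by end_near. Qed.

Lemma derivable_flat k t : derivable (flat k) t 1.
Proof. by have [] := is_derive_flat k t. Qed.

Lemma derive1_flat k : derive1 (flat k) = (fun t => flat k.+2 t - k%:R * flat k.+1 t).
Proof.
by apply/funext => t; rewrite derive1E; have H := is_derive_flat k t; rewrite derive_val.
Qed.

Lemma Ck1_flat n k : Ck1 n (flat k).
Proof.
elim: n k => [|n IH] k.
  move=> t; apply/differentiable_continuous/derivable1_diffP.
  exact: derivable_flat.
split; first exact: derivable_flat.
rewrite derive1_flat; apply: Ck1_add => //.
have := @Ck1_scale R n (- k%:R) (flat k.+1) (IH _); congr (Ck1 _ _).
by apply/funext => t; rewrite mulNr.
Qed.

Lemma near_flat_arg (t a A : R) : 0 < t -> \forall n \near \oo, A < n%:R * t + a.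
Proof.
move=> t0; near=> n; rewrite -ltrBlDr -ltr_pdivrMr//.
near: n; exact: nbhs_infty_gtr.
Unshelve. all: by end_near. Qed.

Lemma cvg_flat_arg_inv (t a : R) : 0 < t -> (n%:R * t + a)^-1 @[n --> \oo] --> (0:R).
Proof.
move=> t0; apply/cvgr0Pnorm_lt => e e0; near=> n.
have h : e^-1 < n%:R * t + a by near: n; exact: near_flat_arg.
have h0 : 0 < n%:R * t + a by apply: lt_trans h; rewrite invr_gt0.
by rewrite gtr0_norm ?invr_gt0// -(invrK e) ltf_pV2// posrE// invr_gt0.
Unshelve. all: by end_near. Qed.

(** Only [flat 0], whose limit at infinity is 1, survives; powers of 1/t kill the
    others. *)
Lemma cvg_flat k (t a : R) : 0 < t ->
  flat k (n%:R * t + a) @[n --> \oo] --> ((k == 0)%:R : R).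
Proof.
move=> t0; have c := cvg_flat_arg_inv a t0.
have : (n%:R * t + a)^-1 ^+ k * expR (- (n%:R * t + a)^-1) @[n --> \oo] -->
    (0 ^+ k * expR (- 0) : R).
  have c1 := cvg_comp _ _ c (@exprn_continuous R k 0).
  have c0 : - (n%:R * t + a)^-1 @[n --> \oo] --> (- 0 : R) by exact: cvgN.
  have c2 := cvg_comp _ _ c0 (@continuous_expR R (- 0)).
  exact: (cvgM c1 c2).
rewrite oppr0 expR0 mulr1 expr0n; apply: cvg_trans; apply: near_eq_cvg.
by near=> n; rewrite /flat ifT//; near: n; exact: near_flat_arg.
Unshelve. all: by end_near. Qed.

End bump.

(** * The fundamental lemma of the calculus of variations *)

Section dynkin_zero.
Context d (T : measurableType d) (R : realType).
Variables (mu : {measure set T -> \bar R}) (F : T -> R).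
Hypothesis Fi : mu.-integrable setT (EFin \o F).

(** The sets over which F integrates to zero form a Dynkin class, so vanishing
    on a generating pi-system is enough; [phi] and [Q] allow one coordinate to
    be treated at a time. *)
Lemma integral_eq0_dynkin d' (T' : measurableType d') (phi : T -> T')
    (Q : set T) (G : set (set T')) :
  measurable_fun setT phi -> measurable Q ->
  @measurable _ T' = <<s G >> -> setI_closed G ->
  (\int[mu]_(x in Q) (F x)%:E = 0)%E ->
  (forall A, G A -> (\int[mu]_(x in phi @^-1` A `&` Q) (F x)%:E = 0)%E) ->
  forall A, measurable A -> (\int[mu]_(x in phi @^-1` A `&` Q) (F x)%:E = 0)%E.
Proof.
move=> mphi mQ GE GI Q0 G0 A mA.
have mpre B : measurable B -> measurable (phi @^-1` B).
  by move=> mB; rewrite -[X in measurable X]setTI; exact: mphi.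
have mPQ B : measurable B -> measurable (phi @^-1` B `&` Q).
  by move=> mB; apply: measurableI => //; exact: mpre.
apply: (@dynkin_induction _ T' G
  (fun A => (\int[mu]_(x in phi @^-1` A `&` Q) (F x)%:E = 0)%E)) => //.
- by rewrite preimage_setT setTI.
- move=> B mB B0.
  have : (\int[mu]_(x in (phi @^-1` B `&` Q) `|` (phi @^-1` (~` B) `&` Q)) (F x)%:E = 0)%E.
    by rewrite -setIUl -preimage_setU setUv preimage_setT setTI.
  rewrite integral_setU_EFin ?B0 ?add0e//.
  + by apply: mPQ; exact: mB.
  + by apply: mPQ; exact: measurableC.
  + apply: measurable_funTS; apply/measurable_EFinP.
    by have /integrableP[] := Fi.
  + apply/disj_setPS => x [[/= h _] [h' _]]; exact: h'.
- move=> E mE tE E0.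
  rewrite preimage_bigcup setI_bigcupl integral_bigcup.
  + by rewrite (eq_eseriesr (fun n _ => E0 n)) eseries0.
  + by move=> i j _ _ [x [[/= h1 _] [h2 _]]]; apply: (tE i j) => //; exists (phi x).
  + by move=> k; apply: mPQ; exact: mE.
  + apply: (integrableS measurableT) => //.
    by apply: bigcupT_measurable => k; apply: mPQ; exact: mE.
- by rewrite -GE.
Qed.

End dynkin_zero.

Section fundamental_lemma.
Variable R : realType.
Notation plane := (measurableTypeR R * measurableTypeR R)%type.
Implicit Types (F : R * R -> R) (s c M : R).

Definition quadrant s c : set (R * R) := [set x | x.1 < s /\ x.2 < c].

(** Bounded support is measured by squares, for which Fubini and the swap of
    coordinates are immediate. *)
Definition bsupp M F := forall x : R * R, M < `|x.1| \/ M < `|x.2| -> F x = 0.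

Lemma measurable_fst_lt s : measurable ([set x | x.1 < s] : set plane).
Proof.
have -> : [set x : R * R | x.1 < s] = fst @^-1` `]-oo, s[%classic.
  by apply/seteqP; split => x /=; rewrite in_itv.
rewrite -[X in measurable X]setTI; apply: (@measurable_fst _ _ _ _ measurableT).
exact: measurable_itv.
Qed.

Lemma measurable_snd_lt c : measurable ([set x | x.2 < c] : set plane).
Proof.
have -> : [set x : R * R | x.2 < c] = snd @^-1` `]-oo, c[%classic.
  by apply/seteqP; split => x /=; rewrite in_itv.
rewrite -[X in measurable X]setTI; apply: (@measurable_snd _ _ _ _ measurableT).
exact: measurable_itv.
Qed.

Lemma measurable_quadrant s c : measurable (quadrant s c : set plane).
Proof. by apply: measurableI; [exact: measurable_fst_lt|exact: measurable_snd_lt]. Qed.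

(** Quadrants generate the Borel sets of the plane: first the half-lines in the
    first coordinate are extended to Borel sets, then those in the second, and
    the resulting rectangles generate. *)
Lemma integral_quadrant_ae0 F M : (leb2 R).-integrable setT (EFin \o F) ->
  bsupp M F ->
  (forall s c, \int[leb2 R]_(x in quadrant s c) F x = 0) ->
  ae_eq (leb2 R) setT F (cst 0).
Proof.
move=> Fi bF q0.
have Q0 s c : (\int[leb2 R]_(x in quadrant s c) (F x)%:E = 0)%E.
  have mq := measurable_quadrant s c.
  have fin : (\int[leb2 R]_(x in quadrant s c) (F x)%:E)%E \is a fin_num.
    by apply: integrable_fin_num => //; exact: (integrableS measurableT).
  by rewrite -(fineK fin); congr (_%:E); exact: q0.
(* beyond the square, integrating over a half-plane adds nothing *)
have restr (A B : set plane) : measurable A -> measurable B ->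
   (forall x, `|x.1| <= M -> `|x.2| <= M -> (A x <-> B x)) ->
   (\int[leb2 R]_(x in A) (F x)%:E = \int[leb2 R]_(x in B) (F x)%:E)%E.
  move=> mA mB AB; rewrite integral_mkcond [RHS]integral_mkcond.
  apply: eq_integral => x _; rewrite !patchE.
  have [h|h] := pselect (`|x.1| <= M /\ `|x.2| <= M).
    by have e := AB x h.1 h.2; congr (if _ then _ else _); apply/idP/idP; rewrite !inE => /e.
  have -> : F x = 0.
    by apply: bF; move/not_andP : h => [] /negP; rewrite -ltNge; [left|right].
  by rewrite !if_same.
have gen : @measurable _ (measurableTypeR R) = <<s @RGenInftyO.G R >>.
  exact: (RGenInftyO.measurableE R).
have genI : setI_closed (@RGenInftyO.G R).
  move=> _ _ [s ->] [t ->]; exists (Num.min s t).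
  by apply/seteqP; split => z /=; rewrite !in_itv /= lt_min => /andP.
have lastM (t : R) : `|t| <= M -> t < M + 1.
  by move=> h; apply: (le_lt_trans (ler_norm _)); apply: (le_lt_trans h); rewrite ltrDl.
have step1 c A : measurable (A : set (measurableTypeR R)) ->
    (\int[leb2 R]_(x in fst @^-1` A `&` [set x : R * R | (x.2 < c)%R]) (F x)%:E = 0)%E.
  move=> mA; apply: (@integral_eq0_dynkin _ _ _ _ _ Fi _ _ fst _ (@RGenInftyO.G R)) => //.
  - exact: measurable_snd_lt.
  - transitivity (\int[leb2 R]_(x in (quadrant (M + 1) c)) (F x)%:E)%E; last by rewrite Q0.
    apply: restr.
    + exact: measurable_snd_lt.
    + exact: measurable_quadrant.
    + by move=> x h _; split => [h2|[]//]; split => //; exact: lastM.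
  - move=> _ [s ->]; transitivity (\int[leb2 R]_(x in (quadrant s c)) (F x)%:E)%E; last by rewrite Q0.
    apply: restr.
    + apply: measurableI; last exact: measurable_snd_lt.
      rewrite -[X in measurable X]setTI; apply: (@measurable_fst _ _ _ _ measurableT).
      exact: measurable_itv.
    + exact: measurable_quadrant.
    + by move=> x _ _; rewrite /quadrant /= in_itv.
have mfst A : measurable (A : set (measurableTypeR R)) -> measurable (fst @^-1` A : set plane).
  by move=> mA; rewrite -[X in measurable X]setTI; apply: (@measurable_fst _ _ _ _ measurableT).
have msnd A : measurable (A : set (measurableTypeR R)) -> measurable (snd @^-1` A : set plane).
  by move=> mA; rewrite -[X in measurable X]setTI; apply: (@measurable_snd _ _ _ _ measurableT).
have step2 A B : measurable (A : set (measurableTypeR R)) ->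
    measurable (B : set (measurableTypeR R)) ->
    (\int[leb2 R]_(x in snd @^-1` B `&` fst @^-1` A) (F x)%:E = 0)%E.
  move=> mA mB; apply: (@integral_eq0_dynkin _ _ _ _ _ Fi _ _ snd _ (@RGenInftyO.G R)) => //.
  - exact: mfst.
  - transitivity (\int[leb2 R]_(x in (fst @^-1` A `&` [set x : R * R | (x.2 < M + 1)%R])) (F x)%:E)%E; last by rewrite step1.
    apply: restr.
    + exact: mfst.
    + by apply: measurableI; [exact: mfst|exact: measurable_snd_lt].
    + by move=> x _ h; split => [h2|[]//]; split => //; exact: lastM.
  - move=> _ [s ->]; transitivity (\int[leb2 R]_(x in (fst @^-1` A `&` [set x : R * R | (x.2 < s)%R])) (F x)%:E)%E; last by rewrite step1.
    apply: restr.
    + by apply: measurableI; [apply: msnd; exact: measurable_itv|exact: mfst].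
    + by apply: measurableI; [exact: mfst|exact: measurable_snd_lt].
    + by move=> x _ _; rewrite /= in_itv /=; split => -[].
have step3 E : measurable (E : set plane) -> (\int[leb2 R]_(x in E) (F x)%:E = 0)%E.
  move=> mE; have -> : E = id @^-1` E `&` setT by rewrite setIT.
  apply: (@integral_eq0_dynkin _ _ _ _ _ Fi _ plane id _
    [set A `*` B | A in measurable & B in measurable]) => //.
  - exact: measurable_prod_measurableType.
  - move=> _ _ [A1 mA1 [A2 mA2 <-]] [B1 mB1 [B2 mB2 <-]].
    exists (A1 `&` B1); first exact: measurableI.
    exists (A2 `&` B2); first exact: measurableI.
    by rewrite setXI.
  - by rewrite -(@step2 setT setT)// !preimage_setT setIT.
  - move=> _ [A mA [B mB <-]]; rewrite -(@step2 A B)// setIT.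
    by congr (integral _ _ _); apply/seteqP; split => x [].
have h : ae_eq (leb2 R) setT (EFin \o F) (cst 0%E).
  apply: integral_ae_eq => //.
  by move=> E _ mE; rewrite step3// integral0.
by apply: ae_mono h => x h _; have [] := h I.
Qed.

End fundamental_lemma.

(** * Integration by parts against smooth functions *)

Section smooth_closure.
Variable R : realType.
Implicit Types (f g : R * R -> R).

Lemma smooth_cst (c : R) : smooth (fun _ : R * R => c).
Proof. by move=> k; exact: Ck_cst. Qed.
Lemma smooth_fst : smooth (fun x : R * R => x.1).
Proof. by move=> k; exact: Ck_fst. Qed.
Lemma smooth_snd : smooth (fun x : R * R => x.2).
Proof. by move=> k; exact: Ck_snd. Qed.
Lemma smooth_add f g : smooth f -> smooth g -> smooth (fun x => f x + g x).
Proof. by move=> h1 h2 k; exact: Ck_add. Qed.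
Lemma smooth_sub f g : smooth f -> smooth g -> smooth (fun x => f x - g x).
Proof. by move=> h1 h2 k; exact: Ck_sub. Qed.
Lemma smooth_mul f g : smooth f -> smooth g -> smooth (fun x => f x * g x).
Proof. by move=> h1 h2 k; exact: Ck_mul. Qed.
Lemma smooth_flat k f : smooth f -> smooth (fun x => flat k (f x)).
Proof. by move=> h n; exact: (Ck_comp (Ck1_flat R n k) (h n)). Qed.
Lemma smooth_pd1 f : smooth f -> smooth (pd1 f).
Proof. by move=> h k; have /CkS[] := h k.+1. Qed.
Lemma smooth_pd2 f : smooth f -> smooth (pd2 f).
Proof. by move=> h k; have /CkS[] := h k.+1. Qed.
Lemma smooth_cont f : smooth f -> continuous f.
Proof. by move=> h; exact: (Ck_cont (h 0%N)). Qed.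
Lemma smooth_D1 f : smooth f -> D1 f.
Proof. by move=> h; exact: (Ck_D1 (h 1%N)). Qed.
Lemma smooth_D2 f : smooth f -> D2 f.
Proof. by move=> h; exact: (Ck_D2 (h 1%N)). Qed.
Lemma smooth_measurable f : smooth f ->
  measurable_fun (setT : set (measurableTypeR R * measurableTypeR R)) f.
Proof. by move=> h; apply: continuous_measurable_plane; exact: smooth_cont. Qed.

End smooth_closure.

Section fundamental_lemma_smooth.
Variable R : realType.
Notation plane := (measurableTypeR R * measurableTypeR R)%type.
Implicit Types (F : R * R -> R) (s c M : R).

(** Smooth approximation from below of the indicator function of a half-line,
    and hence of a quadrant. *)
Definition ray_approx (n : nat) (s t : R) := flat 0 (n%:R * (s - t) + 0).

Lemma ray_approx_bound n s t : `|ray_approx n s t| <= 1.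
Proof. by rewrite ger0_norm ?flat_ge0// flat0_le1. Qed.

Lemma cvg_ray_approx s t :
  ray_approx n s t @[n --> \oo] --> (if t < s then 1 else 0 : R).
Proof.
case: ifPn => [ts|]; first by apply: cvg_flat; rewrite subr_gt0.
rewrite -leNgt => st; apply: cvg_near_cst; apply: nearW => n.
by rewrite /ray_approx flat_le0// addr0 mulr_ge0_le0// subr_le0.
Qed.

Lemma smooth_ray_approx1 n s : smooth (fun x : R * R => ray_approx n s x.1).
Proof.
apply: smooth_flat; apply: smooth_add; last exact: smooth_cst.
apply: smooth_mul; first exact: smooth_cst.
by apply: smooth_sub; [exact: smooth_cst|exact: smooth_fst].
Qed.

Lemma smooth_ray_approx2 n s : smooth (fun x : R * R => ray_approx n s x.2).
Proof.
apply: smooth_flat; apply: smooth_add; last exact: smooth_cst.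
apply: smooth_mul; first exact: smooth_cst.
by apply: smooth_sub; [exact: smooth_cst|exact: smooth_snd].
Qed.

Lemma cvg_integral_quadrant F s c : (leb2 R).-integrable setT (EFin \o F) ->
  \int[leb2 R]_x (F x * (ray_approx n s x.1 * ray_approx n c x.2)) @[n --> \oo]
  --> \int[leb2 R]_(x in quadrant s c) F x.
Proof.
move=> Fi; rewrite Rintegral_mkcond.
have mF := Rint_measurable Fi.
have [] := @Rdominated_cvg _ _ _ (leb2 R) setT
  (fun n x => F x * (ray_approx n s x.1 * ray_approx n c x.2))
  (F \_ (quadrant s c)) (fun x => `|F x|) measurableT => //.
- move=> n; apply: measurable_funM => //; apply: smooth_measurable.
  by apply: smooth_mul; [exact: smooth_ray_approx1|exact: smooth_ray_approx2].
- move=> x _; rewrite patchE.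
  have -> : (if x \in quadrant s c then F x else 0) =
     F x * ((if x.1 < s then 1 else 0) * (if x.2 < c then 1 else 0)).
    have [/set_mem [/= -> ->]|] := ifPn; first by rewrite !mulr1.
    case: ifPn => h1; last by rewrite mul0r mulr0.
    case: ifPn => h2; last by rewrite !mulr0.
    by rewrite notin_setE => /(_ (conj h1 h2)).
  apply: cvgM; first exact: cvg_cst.
  by apply: cvgM; exact: cvg_ray_approx.
- exact: Rint_norm.
- move=> n x _; rewrite !normrM ler_piMr// -[leRHS]mulr1.
  by apply: ler_pM => //; exact: ray_approx_bound.
Qed.

(** Integrals over quadrants are limits of integrals against products of smooth
    approximations of half-lines. *)
Lemma ae0_of_smooth F M : (leb2 R).-integrable setT (EFin \o F) ->
  bsupp M F ->
  (forall phi, smooth phi -> \int[leb2 R]_x (F x * phi x) = 0) ->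
  ae_eq (leb2 R) setT F (cst 0).
Proof.
move=> Fi bF H; apply: (integral_quadrant_ae0 Fi bF) => s c.
have c1 := @cvg_integral_quadrant F s c Fi.
have := cvg_lim (@Rhausdorff R) c1 => <-.
apply/cvg_lim; first exact: Rhausdorff.
apply: cvg_near_cst; apply: nearW => n; apply: H.
by apply: smooth_mul; [exact: smooth_ray_approx1|exact: smooth_ray_approx2].
Qed.

End fundamental_lemma_smooth.

Section integration_by_parts.
Variable R : realType.
Notation plane := (measurableTypeR R * measurableTypeR R)%type.
Notation mu := (@lebesgue_measure R).
Implicit Types (f g : R * R -> R) (M : R).

Definition box M : set (R * R) := `[- M, M]%classic `*` `[- M, M]%classic.

Lemma boxP M x : box M x <-> `|x.1| <= M /\ `|x.2| <= M.
Proof. by rewrite /box /= !in_itv /= !ler_norml; split. Qed.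

Lemma compact_box M : compact (box M).
Proof. by apply: compact_setX; exact: segment_compact. Qed.

Lemma measurable_box M : measurable (box M : set plane).
Proof. by apply: measurableX; exact: measurable_itv. Qed.

Lemma box_lty M : (leb2 R (box M) < +oo)%E.
Proof.
have mI : measurable (`[- M, M]%classic : set (measurableTypeR R)) by exact: measurable_itv.
have e := @product_measure1E _ _ _ _ R mu mu _ _ mI mI.
apply: (@eq_ind_r _ _ (fun z => (z < +oo)%E) _ _ e).
have h : (@lebesgue_measure R `[(- M)%R, M]%classic < +oo)%E.
  by rewrite lebesgue_measure_itv/=; case: ifP => // _; rewrite -EFinB ltry.
by rewrite lte_mul_pinfty// ge0_fin_numE.
Qed.

Lemma bsupp_box M f x : bsupp M f -> ~ box M x -> f x = 0.
Proof.
move=> bf; rewrite boxP => /not_andP[] /negP; rewrite -ltNge => h; apply: bf.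
  by left.
by right.
Qed.

Lemma continuous_box_bounded M f : continuous f ->
  exists2 C, 0 <= C & forall x, box M x -> `|f x| <= C.
Proof.
move=> cf.
have : compact (f @` box M).
  by apply: continuous_compact; [exact: continuous_subspaceT|exact: compact_box].
move=> /compact_bounded[C [Cr HC]]; exists (`|C| + 1); first by rewrite addr_ge0.
move=> x Bx; apply: (HC (`|C| + 1)); last by exists x.
by rewrite (le_lt_trans (ler_norm _))// ltrDl.
Qed.

Lemma Rint_bsupp M C f : measurable_fun (setT : set plane) f -> bsupp M f ->
  (forall x, box M x -> `|f x| <= C) -> (leb2 R).-integrable setT (EFin \o f).
Proof.
move=> mf bf fC.
have -> : EFin \o f = (EFin \o f) \_ (box M).
  apply/funext => x; rewrite patchE; case: ifPn => //.
  by rewrite notin_setE => h /=; rewrite (bsupp_box bf h).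
apply/(integrable_mkcond _ (measurable_box M)).1.
apply: (@Rint_bounded _ _ _ _ _ _ C) => //; first exact: measurable_box.
  exact: box_lty.
exact: measurable_funTS.
Qed.

Lemma Rint_cont_bsupp M f : continuous f -> bsupp M f ->
  (leb2 R).-integrable setT (EFin \o f).
Proof.
move=> cf bf; have [C _ fC] := continuous_box_bounded M cf.
by apply: (Rint_bsupp _ bf fC); exact: continuous_measurable_plane.
Qed.

Lemma bsupp_pd1 M f : bsupp M f -> bsupp M (pd1 f).
Proof.
move=> bf x h; rewrite /pd1 derive1E.
suff -> : 'D_1 (fun t => f (t, x.2)) x.1 = 'D_1 (cst 0 : R -> R) x.1 by rewrite derive_cst.
apply: near_eq_derive; case: h => h.
  near=> t; apply: bf; left => /=.
  near: t.
  by apply: (@cvgr_gt R R (nbhs x.1) _ (fun t : R => `|t|) `|x.1|) => //; exact: norm_continuous.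
by near=> t; apply: bf; right.
Unshelve. all: by end_near. Qed.

Lemma integral_pd1_line M f (y : R) : 0 < M -> D1 f -> continuous (pd1 f) ->
  bsupp M f -> \int[mu]_x pd1 f (x, y) = 0.
Proof.
move=> M0 df cdf bf.
have bd := bsupp_pd1 bf.
have -> : \int[mu]_x pd1 f (x, y) = \int[mu]_(x in `[- (M + 1), M + 1]) pd1 f (x, y).
  rewrite [RHS]Rintegral_mkcond; apply: eq_Rintegral => x _; rewrite patchE.
  case: ifPn => //; rewrite notin_setE /= in_itv /= -ler_norml => /negP.
  rewrite -ltNge => h; apply: bd; left => /=; apply: le_lt_trans h.
  by rewrite lerDl.
have ab : - (M + 1) < M + 1 by lra.
have fz (t : R) : M < `|t| -> f (t, y) = 0 by move=> h; apply: bf; left.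
have ct : continuous (fun t => f (t, y)).
  move=> t; apply/differentiable_continuous/derivable1_diffP.
  exact: (df (t, y)).
rewrite /Rintegral (@continuous_FTC2 _ _ (fun t => f (t, y))) //.
- have h1 : M < `|M + 1| by rewrite gtr0_norm; lra.
  by rewrite (fz _ h1) fz ?normrN// -EFinB subr0.
- apply: continuous_subspaceT => t.
  apply: (@continuous_comp _ _ _ (fun t => (t, y)) (pd1 f)); last exact: cdf.
  exact: (@cvg_pair R R R (nbhs t) (nbhs t) (nbhs y) _ _ _ id (fun=> y) cvg_id (cvg_cst y)).
- split; first by move=> t _; exact: (df (t, y)).
  + by apply: cvg_at_right_filter; exact: ct.
  + by apply: cvg_at_left_filter; exact: ct.
Qed.

Lemma integral_pd1_0 M f : 0 < M -> D1 f -> continuous (pd1 f) ->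
  bsupp M f -> \int[leb2 R]_x pd1 f x = 0.
Proof.
move=> M0 df cdf bf; rewrite Rfubini; last first.
  exact: (Rint_cont_bsupp cdf (bsupp_pd1 bf)).
under eq_Rintegral do rewrite (integral_pd1_line _ M0 df cdf bf).
by rewrite Rintegral_cst// mul0r.
Qed.

End integration_by_parts.

Section swap.
Variable R : realType.
Notation plane := (measurableTypeR R * measurableTypeR R)%type.
Notation mu := (@lebesgue_measure R).
Implicit Types (f g : R * R -> R) (M : R).

(** Statements about the second coordinate direction are deduced from those
    about the first through this exchange. *)
Definition swp (x : R * R) : R * R := (x.2, x.1).

Lemma swpK : involutive swp. Proof. by case. Qed.

Lemma measurable_swp : measurable_fun (setT : set plane) (swp : plane -> plane).
Proof. by apply: measurable_fun_pair; [exact: measurable_snd|exact: measurable_fst]. Qed.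

Lemma Rint_swp f : (leb2 R).-integrable setT (EFin \o f) ->
  (leb2 R).-integrable setT (EFin \o (f \o swp)).
Proof.
move=> fi; have /integrableP[mf _] := fi.
have mfs : measurable_fun (setT : set plane) (EFin \o (f \o swp)).
  exact: (measurableT_comp mf measurable_swp).
apply/(integrable21ltyP mu mu mfs).
exact: ((integrable12ltyP mu mu mf).1 fi).
Qed.

Lemma Rintegral_swp f : (leb2 R).-integrable setT (EFin \o f) ->
  \int[leb2 R]_x f (swp x) = \int[leb2 R]_x f x.
Proof.
move=> fi; rewrite /Rintegral; congr fine.
have := integral21_prod_meas1 (Rint_swp fi); rewrite /fubini_G /= => <-.
by have := integral12_prod_meas1 fi; rewrite /fubini_F /= => <-.
Qed.

Lemma pd1_swp f : pd1 (f \o swp) = pd2 f \o swp. Proof. by []. Qed.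
Lemma pd2_swp f : pd2 (f \o swp) = pd1 f \o swp. Proof. by []. Qed.

Lemma continuous_swp : continuous swp.
Proof.
move=> x; apply: (@cvg_pair (R * R)%type R R (nbhs x) (nbhs x.2) (nbhs x.1) _ _ _ snd fst).
  exact: cvg_snd.
exact: cvg_fst.
Qed.

Lemma Ck_swp k f : Ck k f -> Ck k (f \o swp).
Proof.
elim: k f => [|k IH] f.
  by move=> [cf _]; split => // x; apply: continuous_comp; [exact: continuous_swp|exact: cf].
move=> /CkS[cf d1 d2 c1 c2]; apply/CkS; split.
- by move=> x; apply: continuous_comp; [exact: continuous_swp|exact: cf].
- by move=> x; exact: (d2 (swp x)).
- by move=> x; exact: (d1 (swp x)).
- by rewrite pd1_swp; exact: IH.
- by rewrite pd2_swp; exact: IH.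
Qed.

Lemma smooth_swp f : smooth f -> smooth (f \o swp).
Proof. by move=> h k; exact: Ck_swp. Qed.

Lemma bsupp_swp M f : bsupp M f -> bsupp M (f \o swp).
Proof. by move=> h x [] hx; apply: h; [right|left]. Qed.

Lemma bsupp_pd2 M f : bsupp M f -> bsupp M (pd2 f).
Proof.
move=> h; have := bsupp_swp (bsupp_pd1 (bsupp_swp h)); rewrite pd1_swp.
by congr bsupp; apply/funext => -[].
Qed.

Lemma bsuppM M f g : bsupp M f -> bsupp M (fun x => f x * g x).
Proof. by move=> h x hx; rewrite h// mul0r. Qed.

Lemma integral_by_parts1 M f g : 0 < M -> smooth f -> smooth g -> bsupp M f ->
  \int[leb2 R]_x (pd1 f x * g x) = - \int[leb2 R]_x (f x * pd1 g x).
Proof.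
move=> M0 sf sg bf.
have sfg := smooth_mul sf sg.
have := @integral_pd1_0 R M (fun x => f x * g x) M0 (smooth_D1 sfg)
  (smooth_cont (smooth_pd1 sfg)) (bsuppM g bf).
rewrite pd1M; [|exact: smooth_D1|exact: smooth_D1].
rewrite RintegralD//.
- move=> /eqP; rewrite addrC addr_eq0 => /eqP <-.
  by apply: eq_Rintegral => x _; rewrite mulrC.
- apply: (@Rint_cont_bsupp R M); last exact: bsuppM.
  by apply: smooth_cont; apply: smooth_mul => //; exact: smooth_pd1.
- apply: (@Rint_cont_bsupp R M).
    by apply: smooth_cont; apply: smooth_mul => //; exact: smooth_pd1.
  by move=> x hx; rewrite (bsupp_pd1 bf) ?mulr0.
Qed.

Lemma integral_by_parts2 M f g : 0 < M -> smooth f -> smooth g -> bsupp M f ->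
  \int[leb2 R]_x (pd2 f x * g x) = - \int[leb2 R]_x (f x * pd2 g x).
Proof.
move=> M0 sf sg bf.
have := integral_by_parts1 M0 (smooth_swp sf) (smooth_swp sg) (bsupp_swp bf).
rewrite !pd1_swp => h.
have i1 : (leb2 R).-integrable setT (EFin \o (fun x => pd2 f x * g x)).
  apply: (@Rint_cont_bsupp R M); last by apply: bsuppM; exact: bsupp_pd2.
  by apply: smooth_cont; apply: smooth_mul => //; exact: smooth_pd2.
have i2 : (leb2 R).-integrable setT (EFin \o (fun x => f x * pd2 g x)).
  apply: (@Rint_cont_bsupp R M); last exact: bsuppM.
  by apply: smooth_cont; apply: smooth_mul => //; exact: smooth_pd2.
by rewrite -(Rintegral_swp i1) -(Rintegral_swp i2).
Qed.

(** Tested against a product of functions of one variable, both orders of differentiation give the same number. *)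
Lemma pd12_sym_ae M f : 0 < M -> smooth f -> bsupp M f ->
  ae_eq (leb2 R) setT (pd1 (pd2 f)) (pd2 (pd1 f)).
Proof.
move=> M0 sf bf.
pose F x := pd1 (pd2 f) x - pd2 (pd1 f) x.
have b12 := bsupp_pd1 (bsupp_pd2 bf).
have b21 := bsupp_pd2 (bsupp_pd1 bf).
have sm12 := smooth_pd1 (smooth_pd2 sf).
have sm21 := smooth_pd2 (smooth_pd1 sf).
have bF : bsupp M F by move=> x hx; rewrite /F b12// b21// subrr.
have Fi : (leb2 R).-integrable setT (EFin \o F).
  by apply: (Rint_cont_bsupp _ bF); apply: smooth_cont; exact: smooth_sub.
suff : ae_eq (leb2 R) setT F (cst 0).
  by apply: ae_mono => x h _; apply/eqP; rewrite -subr_eq0; apply/eqP; exact: h.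
apply: (integral_quadrant_ae0 Fi bF) => s c.
have <- := cvg_lim (@Rhausdorff R) (@cvg_integral_quadrant R F s c Fi).
apply/cvg_lim; first exact: Rhausdorff.
apply: cvg_near_cst; apply: nearW => n.
set g1 := fun x : R * R => ray_approx n s x.1.
set g2 := fun x : R * R => ray_approx n c x.2.
have s1 : smooth g1 by exact: smooth_ray_approx1.
have s2 : smooth g2 by exact: smooth_ray_approx2.
have z12 : pd2 g1 = cst 0.
  by apply/funext => x; apply: pd2P; exact: (is_derive_cst (g1 x)).
have z21 : pd1 g2 = cst 0.
  by apply/funext => x; apply: pd1P; exact: (is_derive_cst (g2 x)).
have e1 : pd1 (fun x => g1 x * g2 x) = (fun x => pd1 g1 x * g2 x).
  rewrite pd1M; [|exact: smooth_D1|exact: smooth_D1].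
  by apply/funext => x; rewrite z21 mulr0 add0r mulrC.
have e2 : pd2 (fun x => g1 x * g2 x) = (fun x => g1 x * pd2 g2 x).
  rewrite pd2M; [|exact: smooth_D2|exact: smooth_D2].
  by apply/funext => x; rewrite z12 mulr0 addr0.
have z112 : pd2 (pd1 g1) = cst 0.
  by apply/funext => x; apply: pd2P; exact: (is_derive_cst (pd1 g1 x)).
have z221 : pd1 (pd2 g2) = cst 0.
  by apply/funext => x; apply: pd1P; exact: (is_derive_cst (pd2 g2 x)).
have e12 : pd2 (fun x => pd1 g1 x * g2 x) = (fun x => pd1 g1 x * pd2 g2 x).
  rewrite pd2M; [|apply: smooth_D2; exact: smooth_pd1|exact: smooth_D2].
  by apply/funext => x; rewrite z112 mulr0 addr0.
have e21 : pd1 (fun x => g1 x * pd2 g2 x) = (fun x => pd1 g1 x * pd2 g2 x).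
  rewrite pd1M; [|exact: smooth_D1|apply: smooth_D1; exact: smooth_pd2].
  by apply/funext => x; rewrite z221 mulr0 add0r mulrC.
have s12 := smooth_mul s1 s2.
have i1 : (leb2 R).-integrable setT (EFin \o (fun x => pd1 (pd2 f) x * (g1 x * g2 x))).
  by apply: (@Rint_cont_bsupp R M); [apply: smooth_cont; exact: smooth_mul|exact: bsuppM].
have i2 : (leb2 R).-integrable setT (EFin \o (fun x => pd2 (pd1 f) x * (g1 x * g2 x))).
  by apply: (@Rint_cont_bsupp R M); [apply: smooth_cont; exact: smooth_mul|exact: bsuppM].
have -> : \int[leb2 R]_x (F x * (ray_approx n s x.1 * ray_approx n c x.2)) =
    \int[leb2 R]_x (pd1 (pd2 f) x * (g1 x * g2 x) - pd2 (pd1 f) x * (g1 x * g2 x)).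
  by apply: eq_Rintegral => x _; rewrite /F mulrBl.
rewrite (RintegralB measurableT i1 i2).
have sa : smooth (fun x => pd1 g1 x * g2 x) by apply: smooth_mul => //; exact: smooth_pd1.
have sb : smooth (fun x => g1 x * pd2 g2 x) by apply: smooth_mul => //; exact: smooth_pd2.
have E1 := integral_by_parts1 M0 (smooth_pd2 sf) s12 (bsupp_pd2 bf).
have E2 := integral_by_parts2 M0 sf sa bf.
have E3 := integral_by_parts2 M0 (smooth_pd1 sf) s12 (bsupp_pd1 bf).
have E4 := integral_by_parts1 M0 sf sb bf.
rewrite e1 in E1; rewrite e12 in E2; rewrite e2 in E3; rewrite e21 in E4.
apply/eqP; rewrite subr_eq0; apply/eqP.
by apply: (etrans E1); apply: esym; apply: (etrans E3); rewrite E2; congr (- _).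
Qed.

End swap.

(** * Weak derivatives on the disk *)

Section disk.
Variables (R : realType) (rho : R).
Hypothesis rho0 : 0 < rho.
Notation plane := (measurableTypeR R * measurableTypeR R)%type.
Notation Om := (disk rho).
Implicit Types (f g u phi psi : R * R -> R) (x : R * R).

Definition sqn x : R := x.1 ^+ 2 + x.2 ^+ 2.

Lemma sqn_ge0 x : 0 <= sqn x. Proof. by rewrite addr_ge0// sqr_ge0. Qed.

Lemma smooth_sqn : smooth sqn.
Proof.
have -> : sqn = (fun x => x.1 * x.1 + x.2 * x.2).
  by apply/funext => x; rewrite /sqn !expr2.
by apply: smooth_add; apply: smooth_mul; [exact: smooth_fst|exact: smooth_fst|
  exact: smooth_snd|exact: smooth_snd].
Qed.

Lemma diskE : disk rho = [set x | sqn x < rho ^+ 2].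
Proof.
apply/seteqP; split => x; rewrite /disk /enorm /= -/(sqn x) => h.
  by rewrite -(sqr_sqrtr (sqn_ge0 x)) ltr_sqr// ?nnegrE ?sqrtr_ge0// ltW.
by rewrite -[rho]gtr0_norm// -sqrtr_sqr ltr_sqrt// exprn_gt0.
Qed.

Lemma closed_diskE : closed_disk rho = [set x | sqn x <= rho ^+ 2].
Proof.
apply/seteqP; split => x; rewrite /closed_disk /enorm /= -/(sqn x) => h.
  by rewrite -(sqr_sqrtr (sqn_ge0 x)) ler_sqr// ?nnegrE ?sqrtr_ge0// ltW.
by rewrite -[rho]gtr0_norm// -sqrtr_sqr ler_wsqrtr.
Qed.

Lemma disk_box x : Om x -> box rho x.
Proof.
rewrite diskE boxP /= /sqn => h.
have aux (t : R) : t ^+ 2 <= rho ^+ 2 -> `|t| <= rho.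
  by move=> ht; rewrite -[rho]gtr0_norm// -ler_sqr ?nnegrE// !real_normK ?num_real.
by split; apply: aux; apply: ltW; apply: le_lt_trans h; rewrite ?lerDl ?lerDr ?sqr_ge0.
Qed.

Lemma open_disk : open (Om : set (R * R)).
Proof.
rewrite diskE.
have -> : [set x | sqn x < rho ^+ 2] = sqn @^-1` `]-oo, (rho ^+ 2)[%classic.
  by apply/seteqP; split => x /=; rewrite in_itv.
move: (smooth_cont smooth_sqn) => /continuousP; apply.
exact: interval_open.
Qed.

Lemma measurable_disk : measurable (Om : set plane).
Proof. exact: measurable_open_plane open_disk. Qed.

Lemma disk_lty : (leb2 R Om < +oo)%E.
Proof.
apply: le_lt_trans (box_lty rho); apply: le_measure => //; rewrite ?inE.
- exact: measurable_disk.
- exact: measurable_box.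
- by move=> x; exact: disk_box.
Qed.

(** Cutoff functions: the offset [-1] makes the support of [chi n] compact in the
    disk, and the values inside the disk tend to 1. *)
Definition chi (n : nat) x := flat 0 (n%:R * (rho ^+ 2 - sqn x) + (- 1)).

Lemma smooth_chi_arg n : smooth (fun x => n%:R * (rho ^+ 2 - sqn x) + (- 1)).
Proof.
apply: smooth_add; last exact: smooth_cst.
apply: smooth_mul; first exact: smooth_cst.
by apply: smooth_sub; [exact: smooth_cst|exact: smooth_sqn].
Qed.

Lemma smooth_chi n : smooth (chi n).
Proof. by apply: smooth_flat; exact: smooth_chi_arg. Qed.

Lemma chi_ge0 n x : 0 <= chi n x. Proof. exact: flat_ge0. Qed.
Lemma chi_le1 n x : chi n x <= 1. Proof. exact: flat0_le1. Qed.
Lemma chi_norm n x : `|chi n x| <= 1.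
Proof. by rewrite ger0_norm ?chi_ge0// chi_le1. Qed.

Lemma cvg_chi x : Om x -> chi n x @[n --> \oo] --> (1:R).
Proof. by rewrite diskE /= => h; apply: cvg_flat; rewrite subr_gt0. Qed.

Definition chi_supp n : set (R * R) := [set x | 1 <= n%:R * (rho ^+ 2 - sqn x)].

Lemma chi_supp_disk n : chi_supp n `<=` Om.
Proof.
move=> x; rewrite /chi_supp diskE /= => h; rewrite -subr_gt0.
have : 0 < n%:R * (rho ^+ 2 - sqn x) by apply: lt_le_trans h.
by case: n {h} => [|n]; rewrite ?mul0r ?ltxx// pmulr_rgt0.
Qed.

Lemma compact_chi_supp n : compact (chi_supp n).
Proof.
apply: (subclosed_compact _ (@compact_box R rho)); last first.
  by move=> x /chi_supp_disk/disk_box.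
have -> : chi_supp n = (fun x => n%:R * (rho ^+ 2 - sqn x) + (-1)) @^-1` `[0, +oo[%classic.
  apply/seteqP; split => x; rewrite /chi_supp /= in_itv /= andbT; by rewrite subr_ge0.
have /continuous_closedP := smooth_cont (smooth_chi_arg n); apply.
exact: interval_closed.
Qed.

Lemma chi0 n x : ~ chi_supp n x -> chi n x = 0.
Proof.
rewrite /chi_supp /= => /negP; rewrite -ltNge => h.
by rewrite /chi flat_le0// subr_le0 ltW.
Qed.

Lemma near0_pd1 phi x : (\near x, phi x = 0) -> pd1 phi x = 0.
Proof.
move=> h; rewrite /pd1 derive1E.
suff -> : 'D_1 (fun t => phi (t, x.2)) x.1 = 'D_1 (cst 0 : R -> R) x.1 by rewrite derive_cst.
apply: near_eq_derive.
have c : continuous (fun t : R => (t, x.2)).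
  move=> t; exact: (@cvg_pair R R R (nbhs t) (nbhs t) (nbhs x.2) _ _ _ id (fun=> x.2) cvg_id (cvg_cst x.2)).
have h' : nbhs (x.1, x.2) (fun z => phi z = 0) by rewrite -surjective_pairing.
exact: (c x.1 _ h').
Qed.

Lemma near0_pd2 phi x : (\near x, phi x = 0) -> pd2 phi x = 0.
Proof.
move=> h; rewrite /pd2 derive1E.
suff -> : 'D_1 (fun t => phi (x.1, t)) x.2 = 'D_1 (cst 0 : R -> R) x.2 by rewrite derive_cst.
apply: near_eq_derive.
have c : continuous (fun t : R => (x.1, t)).
  move=> t; exact: (@cvg_pair R R R (nbhs t) (nbhs x.1) (nbhs t) _ _ _ (fun=> x.1) id (cvg_cst x.1) cvg_id).
have h' : nbhs (x.1, x.2) (fun z => phi z = 0) by rewrite -surjective_pairing.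
exact: (c x.2 _ h').
Qed.

Lemma plane_hausdorff : hausdorff_space (R * R)%type.
Proof. exact: norm_hausdorff. Qed.

Lemma test_pd1 phi : test_function Om phi -> test_function Om (pd1 phi).
Proof.
move=> [sp [K [cK KO phi0]]]; split; first exact: smooth_pd1.
exists K; split => // x Kx; apply: near0_pd1.
have oK : open (~` K) by apply: closed_openC; exact: compact_closed plane_hausdorff cK.
by apply: filterS (oK x Kx) => y; exact: phi0.
Qed.

Lemma test_pd2 phi : test_function Om phi -> test_function Om (pd2 phi).
Proof.
move=> [sp [K [cK KO phi0]]]; split; first exact: smooth_pd2.
exists K; split => // x Kx; apply: near0_pd2.
have oK : open (~` K) by apply: closed_openC; exact: compact_closed plane_hausdorff cK.
by apply: filterS (oK x Kx) => y; exact: phi0.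
Qed.

Lemma test_mul phi psi : test_function Om phi -> smooth psi ->
  test_function Om (fun x => phi x * psi x).
Proof.
move=> [sp [K [cK KO phi0]]] spsi; split; first exact: smooth_mul.
by exists K; split => // x Kx; rewrite phi0// mul0r.
Qed.

Lemma test_chi n : test_function Om (chi n).
Proof.
split; first exact: smooth_chi.
exists (chi_supp n); split; [exact: compact_chi_supp|exact: chi_supp_disk|exact: chi0].
Qed.

Lemma test_bsupp phi : test_function Om phi -> bsupp rho phi.
Proof.
move=> [_ [K [_ KO phi0]]] x h; apply: phi0 => /KO /disk_box; rewrite boxP => -[h1 h2].
by case: h => h; [move: h1|move: h2]; rewrite leNgt h.
Qed.

Lemma measurable_compact_plane (K : set (R * R)) : compact K ->
  measurable (K : set plane).
Proof.
move=> cK; rewrite -[X in measurable X]setCK; apply: measurableC.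
apply: measurable_open_plane; apply: closed_openC.
exact: compact_closed plane_hausdorff cK.
Qed.

Lemma test_bounded phi : test_function Om phi -> exists2 C, 0 <= C & forall x, `|phi x| <= C.
Proof.
move=> tp; have [C C0 h] := continuous_box_bounded rho (smooth_cont tp.1).
exists C => // x; have [/h//|bx] := pselect (box rho x).
by rewrite (bsupp_box (test_bsupp tp) bx) normr0.
Qed.

Lemma test_out phi x : test_function Om phi -> ~ Om x -> phi x = 0.
Proof. by move=> [_ [K [_ KO phi0]]] h; apply: phi0 => /KO. Qed.

Lemma L1loc_test_int g phi : L1loc Om g -> test_function Om phi ->
  (leb2 R).-integrable setT (EFin \o (fun x => g x * phi x)).
Proof.
move=> [mg ig] tp; have [C C0 phiC] := test_bounded tp.
have [sp [K [cK KO phi0]]] := tp.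
have mK := measurable_compact_plane cK.
have -> : EFin \o (fun x => g x * phi x) = (EFin \o (fun x => g x * phi x)) \_ K.
  apply/funext => x; rewrite patchE; case: ifPn => //.
  by rewrite notin_setE /= => h; rewrite phi0// mulr0.
apply/(integrable_mkcond _ mK).1.
apply: (@Rint_mul_bounded _ _ _ _ _ _ _ C) => //; first exact: ig.
by apply: measurable_funTS; exact: smooth_measurable.
Qed.

Lemma Rintegral_test g phi : test_function Om phi ->
  \int[leb2 R]_(x in Om) (g x * phi x) = \int[leb2 R]_x (g x * phi x).
Proof.
move=> tp; rewrite Rintegral_mkcond; apply: eq_Rintegral => x _.
rewrite patchE; case: ifPn => //; rewrite notin_setE => h.
by rewrite (test_out tp h) mulr0.
Qed.

Lemma smooth_pd a b phi : smooth phi -> smooth (pd a b phi).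
Proof.
move=> sp; rewrite /pd; elim: a => [|a IH] /=; last exact: smooth_pd1.
by elim: b => [|b IH] //=; exact: smooth_pd2.
Qed.

Lemma is_wderiv_mono a b u u' g : is_wderiv Om a b u g ->
  L1loc Om u' -> ae_eq_on Om u u' -> is_wderiv Om a b u' g.
Proof.
move=> [lu lg H] lu' uu'; split => // phi tp; rewrite -H//.
have mp : measurable_fun (Om : set plane) (pd a b phi).
  by apply: measurable_funTS; apply: smooth_measurable; apply: smooth_pd; exact: tp.1.
apply: ae_eq_Rintegral; first exact: measurable_disk.
- exact: (measurable_funM lu'.1 mp).
- exact: (measurable_funM lu.1 mp).
- by apply: ae_mono uu' => x h Ox; rewrite h.
Qed.

(** Multiplying by a cutoff turns a locally integrable function on the disk into
    an integrable function with bounded support on the plane. *)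
Lemma wderiv_ae_unique a b u g1 g2 :
  is_wderiv Om a b u g1 -> is_wderiv Om a b u g2 -> ae_eq_on Om g1 g2.
Proof.
move=> [_ l1 H1] [_ l2 H2].
have Fn0 n : ae_eq (leb2 R) setT (fun x => g1 x * chi n x - g2 x * chi n x) (cst 0).
  have i1 := L1loc_test_int l1 (test_chi n).
  have i2 := L1loc_test_int l2 (test_chi n).
  apply: (@ae0_of_smooth R _ rho).
  - exact: (RintB measurableT i1 i2).
  - by move=> x h; rewrite (test_bsupp (test_chi n) h) !mulr0 subrr.
  - move=> phi sp; have tp := test_mul (test_chi n) sp.
    have j1 := L1loc_test_int l1 tp; have j2 := L1loc_test_int l2 tp.
    have -> : \int[leb2 R]_x ((g1 x * chi n x - g2 x * chi n x) * phi x) =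
        \int[leb2 R]_x (g1 x * (chi n x * phi x) - g2 x * (chi n x * phi x)).
      by apply: eq_Rintegral => x _; ring.
    rewrite (RintegralB measurableT j1 j2).
    have e1 := H1 _ tp; have e2 := H2 _ tp.
    rewrite e1 in e2; rewrite !(Rintegral_test _ tp) in e2.
    apply/eqP; rewrite subr_eq0; apply/eqP.
    apply: (@mulfI R ((-1) ^+ (a + b))); last exact: e2.
    by rewrite signr_eq0.
have : {ae leb2 R, forall x, forall n, setT x -> g1 x * chi n x - g2 x * chi n x = cst 0 x}.
  by apply/ae_foralln => n; exact: Fn0.
apply: ae_mono => x h Ox.
have : exists n, 0 < chi n x.
  have [N _ HN] := @cvgr_gt _ _ _ _ _ _ (cvg_chi Ox) 0 ltr01.
  by exists N; exact: (HN N (leqnn N)).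
move=> [n cn]; have /= := h n I; rewrite -mulrBl => /eqP.
by rewrite mulf_eq0 (gt_eqF cn) orbF subr_eq0 => /eqP.
Qed.

End disk.

Section wderiv_calculus.
Variables (R : realType) (rho : R).
Hypothesis rho0 : 0 < rho.
Notation plane := (measurableTypeR R * measurableTypeR R)%type.
Notation Om := (disk rho).
Implicit Types (f g u v phi psi : R * R -> R) (x : R * R).

Lemma L1loc_lin c d u v : L1loc Om u -> L1loc Om v ->
  L1loc Om (fun x => c * u x + d * v x).
Proof.
move=> [mu iu] [mv iv]; split.
  by apply: measurable_funD; apply: measurable_funM => //; exact: measurable_cst.
move=> K cK KO; have mK := measurable_compact_plane cK.
by apply: RintD => //; apply: RintZ => //; [exact: iu|exact: iv].
Qed.

Lemma L1loc_continuous u : continuous u -> L1loc Om u.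
Proof.
move=> cu; split; first by apply: measurable_funTS; exact: continuous_measurable_plane.
move=> K cK KO; have mK := measurable_compact_plane cK.
have [C C0 h] := continuous_box_bounded rho cu.
apply: (@Rint_bounded _ _ _ _ _ _ C) => //.
- apply: le_lt_trans (box_lty rho); apply: le_measure => //; rewrite ?inE//.
    exact: measurable_box.
  by move=> x /KO/(disk_box rho0).
- by apply: measurable_funTS; exact: continuous_measurable_plane.
- by move=> x /KO/(disk_box rho0)/h.
Qed.

Lemma is_wderiv_lin a b c d u v g h : is_wderiv Om a b u g -> is_wderiv Om a b v h ->
  is_wderiv Om a b (fun x => c * u x + d * v x) (fun x => c * g x + d * h x).
Proof.
move=> [lu lg H1] [lv lh H2]; split; [exact: L1loc_lin|exact: L1loc_lin|].
move=> phi tp.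
have tpd : test_function Om (pd a b phi).
  rewrite /pd; elim: a {H1 H2} => [|a IH] /=; last exact: test_pd1.
  by elim: b => [|b IH] //=; exact: test_pd2.
have E w w' psi : L1loc Om w -> L1loc Om w' -> test_function Om psi ->
    \int[leb2 R]_(x in Om) ((c * w x + d * w' x) * psi x) =
    c * \int[leb2 R]_(x in Om) (w x * psi x) + d * \int[leb2 R]_(x in Om) (w' x * psi x).
  move=> lw lw' tpsi.
  have i1 := L1loc_test_int rho0 lw tpsi; have i2 := L1loc_test_int rho0 lw' tpsi.
  rewrite !(Rintegral_test _ tpsi).
  rewrite -(RintegralZl c measurableT i1) -(RintegralZl d measurableT i2).
  rewrite -(RintegralD measurableT (RintZ c measurableT i1) (RintZ d measurableT i2)).
  by apply: eq_Rintegral => x _; rewrite mulrDl !mulrA.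
by rewrite (E _ _ _ lu lv tpd) (E _ _ _ lg lh tp) H1// H2//; ring.
Qed.

Lemma is_wderiv_smooth1 f : smooth f -> is_wderiv Om 1 0 f (pd1 f).
Proof.
move=> sf; split.
- by apply: L1loc_continuous; exact: smooth_cont.
- by apply: L1loc_continuous; apply: smooth_cont; exact: smooth_pd1.
move=> phi tp; rewrite (Rintegral_test _ tp).
have -> : \int[leb2 R]_(x in Om) (f x * pd 1 0 phi x) = \int[leb2 R]_x (f x * pd1 phi x).
  exact: (Rintegral_test _ (test_pd1 tp)).
rewrite expr1 mulN1r.
have E := integral_by_parts1 rho0 tp.1 sf (test_bsupp rho0 tp).
have e1 : \int[leb2 R]_x (f x * pd1 phi x) = \int[leb2 R]_x (pd1 phi x * f x).
  by apply: eq_Rintegral => x _; rewrite mulrC.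
rewrite e1 E; congr (- _).
by apply: eq_Rintegral => x _; rewrite mulrC.
Qed.

Lemma is_wderiv_smooth2 f : smooth f -> is_wderiv Om 0 1 f (pd2 f).
Proof.
move=> sf; split.
- by apply: L1loc_continuous; exact: smooth_cont.
- by apply: L1loc_continuous; apply: smooth_cont; exact: smooth_pd2.
move=> phi tp; rewrite (Rintegral_test _ tp).
have -> : \int[leb2 R]_(x in Om) (f x * pd 0 1 phi x) = \int[leb2 R]_x (f x * pd2 phi x).
  exact: (Rintegral_test _ (test_pd2 tp)).
rewrite expr1 mulN1r.
have E := integral_by_parts2 rho0 tp.1 sf (test_bsupp rho0 tp).
have e1 : \int[leb2 R]_x (f x * pd2 phi x) = \int[leb2 R]_x (pd2 phi x * f x).
  by apply: eq_Rintegral => x _; rewrite mulrC.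
rewrite e1 E; congr (- _).
by apply: eq_Rintegral => x _; rewrite mulrC.
Qed.

Lemma is_wderiv0 u : L1loc Om u -> is_wderiv Om 0 0 u u.
Proof. by move=> lu; split => // phi tp; rewrite expr0 mul1r. Qed.

(** Higher weak derivatives of u are weak derivatives of its gradient: the test
    function absorbs the first differentiation, and [E] exchanges the order of
    the others. *)
Lemma wderiv_step a b c d a' b' u g g' :
  (a' + b' = a + b + (c + d))%N ->
  (forall phi, test_function Om phi -> test_function Om (pd c d phi)) ->
  (forall phi, test_function Om phi ->
    ae_eq (leb2 R) setT (pd a' b' phi) (pd a b (pd c d phi))) ->
  is_wderiv Om a b u g -> is_wderiv Om a' b' u g' -> is_wderiv Om c d g g'.
Proof.
move=> ab tcd E [lu lg H] [_ lg' H']; split => // phi tp.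
have tcp := tcd _ tp.
have h1 := H _ tcp; have h2 := H' _ tp.
have mO : measurable (Om : set plane) := measurable_disk rho0.
have m k l psi : test_function Om psi -> measurable_fun (Om : set plane) (pd k l psi).
  by move=> tpsi; apply: measurable_funTS; apply: smooth_measurable; apply: smooth_pd; exact: tpsi.1.
have e : \int[leb2 R]_(x in Om) (u x * pd a' b' phi x) =
         \int[leb2 R]_(x in Om) (u x * pd a b (pd c d phi) x).
  apply: ae_eq_Rintegral => //.
  - by apply: measurable_funM; [exact: lu.1|exact: m].
  - by apply: measurable_funM; [exact: lu.1|exact: m].
  - by apply: ae_mono (E _ tp) => x h _; rewrite h.
rewrite -e h2 ab in h1.
apply: (@mulfI R ((-1) ^+ (a + b))); first by rewrite signr_eq0.
by rewrite -h1 exprD mulrA.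
Qed.

Lemma wderiv_11 u g g' : is_wderiv Om 1 0 u g -> is_wderiv Om 2 0 u g' ->
  is_wderiv Om 1 0 g g'.
Proof.
apply: (@wderiv_step 1 0 1 0) => // [phi|phi _]; first exact: test_pd1.
exact: ae_eq_refl.
Qed.

Lemma wderiv_21 u g g' : is_wderiv Om 0 1 u g -> is_wderiv Om 1 1 u g' ->
  is_wderiv Om 1 0 g g'.
Proof.
apply: (@wderiv_step 0 1 1 0) => // [phi|phi tp]; first exact: test_pd1.
exact: (pd12_sym_ae rho0 tp.1 (test_bsupp rho0 tp)).
Qed.

Lemma wderiv_12 u g g' : is_wderiv Om 1 0 u g -> is_wderiv Om 1 1 u g' ->
  is_wderiv Om 0 1 g g'.
Proof.
apply: (@wderiv_step 1 0 0 1) => // [phi|phi _]; first exact: test_pd2.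
exact: ae_eq_refl.
Qed.

Lemma wderiv_22 u g g' : is_wderiv Om 0 1 u g -> is_wderiv Om 0 2 u g' ->
  is_wderiv Om 0 1 g g'.
Proof.
apply: (@wderiv_step 0 1 0 1) => // [phi|phi _]; first exact: test_pd2.
exact: ae_eq_refl.
Qed.

End wderiv_calculus.

(** * The chain rule along lines *)

Section line_chain.
Variable R : realType.
Notation mu := (@lebesgue_measure R).
Variables (g ga gb : R * R -> R) (C : R).
(** [ga] and [gb] are the partial derivatives of the outer function [g]. *)
Hypothesis chain : forall (V1 V2 : R -> R) (t d1 d2 : R),
  is_derive t (1:R) V1 d1 -> is_derive t (1:R) V2 d2 ->
  is_derive t (1:R) (fun t => g (V1 t, V2 t))
    (ga (V1 t, V2 t) * d1 + gb (V1 t, V2 t) * d2).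
Hypothesis cg : continuous g.
Hypothesis cga : continuous ga.
Hypothesis cgb : continuous gb.
Hypothesis gC : forall x, `|g x| <= C.
Hypothesis gaC : forall x, `|ga x| <= C.
Hypothesis gbC : forall x, `|gb x| <= C.
Variable M : R.
Hypothesis M0 : 0 < M.
Variables (phi phi' : R -> R).
Hypothesis dphi : forall t, is_derive t (1:R) phi (phi' t).
Hypothesis cphi' : continuous phi'.
Hypothesis phiM : phi M = 0.
Hypothesis phiNM : phi (- M) = 0.

Let L := M + 1.
Let I : set R := `[- M, M]%classic.
Let E : set R := `[- L, L]%classic.

(** Starting the primitive strictly to the left of [- M] makes it
    differentiable on a neighbourhood of the interval. *)
Let prim (h : R -> R) (s : R) := \int[mu]_(t in `[- L, s]) h t.

Lemma continuous_at_pair (G : R * R -> R) (V1 V2 : R -> R) (s : R) : continuous G ->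
  {for s, continuous V1} -> {for s, continuous V2} ->
  {for s, continuous (fun t => G (V1 t, V2 t))}.
Proof.
move=> cG c1 c2; apply: (@continuous_comp _ _ _ (fun t => (V1 t, V2 t)) G); last exact: cG.
exact: (@cvg_pair R R R (nbhs s) (nbhs (V1 s)) (nbhs (V2 s)) _ _ _ V1 V2 c1 c2).
Qed.

Let cphi : continuous phi.
Proof.
move=> t; apply/differentiable_continuous/derivable1_diffP.
by have [] := dphi t.
Qed.

Let mI : measurable (I : set (measurableTypeR R)).
Proof. exact: measurable_itv. Qed.

Let mE : measurable (E : set (measurableTypeR R)).
Proof. exact: measurable_itv. Qed.

Let IE : I `<=` E.
Proof. by move=> x; rewrite /I /E /L /= !in_itv /= => /andP[h1 h2]; apply/andP; split; lra. Qed.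

Let int_cont (h : R -> R) (a b : R) : (forall x, x \in `[a, b]%classic -> {for x, continuous h}) ->
  mu.-integrable `[a, b] (EFin \o h).
Proof.
move=> ch; apply: continuous_compact_integrable; first exact: segment_compact.
exact: continuous_in_subspaceT.
Qed.

Let prim_derive (h : R -> R) (s : R) : continuous h -> I s -> is_derive s (1:R) (prim h) (h s).
Proof.
move=> ch; rewrite /I /= in_itv /= => /andP[s1 s2].
have sL : s < L by rewrite /L; lra.
have Ls : - L < s by rewrite /L; lra.
have iE : mu.-integrable `[- L, L] (EFin \o h) by apply: int_cont => x _; exact: ch.
have [d e] := continuous_FTC1_closed sL iE Ls (ch s).
by apply: DeriveDef; [exact: d|rewrite -derive1E; exact: e].
Qed.

(** For continuous densities this is the fundamental theorem of calculus applied
    to the product of phi with the composite; phi vanishes at both ends. *)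
Let chain_cont (h1 h2 : R -> R) : continuous h1 -> continuous h2 ->
  \int[mu]_(s in I) (g (prim h1 s, prim h2 s) * phi' s) =
  - \int[mu]_(s in I) ((ga (prim h1 s, prim h2 s) * h1 s
                        + gb (prim h1 s, prim h2 s) * h2 s) * phi s).
Proof.
move=> c1 c2.
have cV (h : R -> R) s : continuous h -> I s -> {for s, continuous (prim h)}.
  move=> ch Is; apply/differentiable_continuous/derivable1_diffP.
  by have [] := prim_derive ch Is.
have cG (G : R * R -> R) s : continuous G -> s \in I -> {for s, continuous (fun s => G (prim h1 s, prim h2 s))}.
  move=> cG; rewrite inE => Is.
  exact: (@continuous_at_pair G _ _ s cG (cV _ _ c1 Is) (cV _ _ c2 Is)).
pose f1 s := g (prim h1 s, prim h2 s) * phi' s.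
pose f2 s := (ga (prim h1 s, prim h2 s) * h1 s + gb (prim h1 s, prim h2 s) * h2 s) * phi s.
have cf1 s : s \in I -> {for s, continuous f1}.
  by move=> Is; apply: cvgM; [exact: (cG g)|exact: cphi'].
have cf2 s : s \in I -> {for s, continuous f2}.
  move=> Is; apply: cvgM; last exact: cphi.
  apply: cvgD; apply: cvgM; [exact: (cG ga)|exact: c1|exact: (cG gb)|exact: c2].
pose W s := g (prim h1 s, prim h2 s) * phi s.
have dW s : I s -> is_derive s (1:R) W (f1 s + f2 s).
  move=> Is.
  have H1 := chain (prim_derive c1 Is) (prim_derive c2 Is).
  have := is_deriveM H1 (dphi s) => H; apply: (is_derive_eq H).
  by rewrite /f1 /f2 /GRing.scale /=; ring.
have i1 : mu.-integrable I (EFin \o f1) by exact: int_cont.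
have i2 : mu.-integrable I (EFin \o f2) by exact: int_cont.
have ab : - M < M by rewrite (lt_trans _ M0)// oppr_lt0.
have ct : {within I, continuous (fun s => f1 s + f2 s)}.
  apply: continuous_in_subspaceT => s Is.
  by apply: cvgD; [exact: cf1|exact: cf2].
have cW s : I s -> {for s, continuous W}.
  move=> Is; apply/differentiable_continuous/derivable1_diffP.
  by have [] := dW _ Is.
have dLR : derivable_oo_LRcontinuous W (- M) M.
  split.
  - move=> s Hs; have Is : I s by exact: (subset_itv_oo_cc Hs).
    by have [] := dW _ Is.
  - by apply: cvg_at_right_filter; apply: cW; rewrite /I /= in_itv /= lexx /= ltW.
  - by apply: cvg_at_left_filter; apply: cW; rewrite /I /= in_itv /= lexx andbT ltW.
have W' : {in `]- M, M[, derive1 W =1 (fun s => f1 s + f2 s)}.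
  move=> s Hs; have Is : I s by exact: (subset_itv_oo_cc Hs).
  by have H := dW _ Is; rewrite derive1E derive_val.
have : \int[mu]_(s in I) (f1 s + f2 s) = 0.
  rewrite /Rintegral (continuous_FTC2 ab ct dLR W').
  by rewrite /W phiM phiNM !mulr0 subee.
rewrite (RintegralD mI i1 i2) => /eqP; rewrite addr_eq0 => /eqP; exact.
Qed.

Let int_C (h : R -> R) : continuous h -> mu.-integrable I (EFin \o h).
Proof. by move=> ch; apply: int_cont => x _; exact: ch. Qed.

Let prim_measurable (G : R * R -> R) (h1 h2 : R -> R) : continuous G ->
  continuous h1 -> continuous h2 ->
  measurable_fun (I : set (measurableTypeR R)) (fun s => G (prim h1 s, prim h2 s)).
Proof.
move=> cG c1 c2; apply: Rint_measurable; apply: int_cont => s; rewrite inE => Is.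
have cV (h : R -> R) : continuous h -> {for s, continuous (prim h)}.
  move=> ch; apply/differentiable_continuous/derivable1_diffP.
  by have [] := prim_derive ch Is.
exact: (@continuous_at_pair G _ _ s cG (cV _ c1) (cV _ c2)).
Qed.

Let prim_dist (A h : R -> R) (s : R) : mu.-integrable E (EFin \o A) ->
  mu.-integrable E (EFin \o h) -> I s ->
  `|prim A s - prim h s| <= \int[mu]_(t in E) `|A t - h t|.
Proof.
move=> Ai hi Is.
have sub : `[- L, s]%classic `<=` E.
  move: Is; rewrite /I /E /= in_itv /= => /andP[_ sM] x.
  by rewrite /L /= !in_itv /= => /andP[h1 h2]; apply/andP; split => //; lra.
have mS : measurable (`[- L, s]%classic : set (measurableTypeR R)) by exact: measurable_itv.
have Ai' := integrableS mE mS sub Ai; have hi' := integrableS mE mS sub hi.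
have d' := RintB mS Ai' hi'; have d := RintB mE Ai hi.
rewrite /prim -(RintegralB mS Ai' hi').
apply: (le_trans (le_normr_Rintegral mS d')).
rewrite Rintegral_mkcond [leRHS]Rintegral_mkcond.
have mT : measurable (setT : set (measurableTypeR R)) by exact: measurableT.
apply: (le_Rintegral mT).
- have := (integrable_mkcond _ mS).1 (Rint_norm d'); congr (_.-integrable _ _).
  by apply/funext => x; rewrite /= !patchE; case: ifP.
- have := (integrable_mkcond _ mE).1 (Rint_norm d); congr (_.-integrable _ _).
  by apply/funext => x; rewrite /= !patchE; case: ifP.
- move=> x _; rewrite !patchE; case: ifPn => // xs.
    by rewrite ifT// inE; apply: sub; rewrite inE in xs.
  by case: ifP => _; [exact: normr_ge0|exact: lexx].
Qed.

(** Approximating the densities by continuous functions reduces the statement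
    to the classical chain rule; the primitives converge uniformly. *)
Lemma chain_AC (A1 A2 : R -> R) :
  mu.-integrable E (EFin \o A1) -> mu.-integrable E (EFin \o A2) ->
  \int[mu]_(s in I) (g (prim A1 s, prim A2 s) * phi' s) =
  - \int[mu]_(s in I) ((ga (prim A1 s, prim A2 s) * A1 s
                        + gb (prim A1 s, prim A2 s) * A2 s) * phi s).
Proof.
move=> A1i A2i.
have Efin : (mu E < +oo)%E.
  by rewrite /E lebesgue_measure_itv/=; case: ifP => // _; rewrite -EFinB ltry.
have approx A : mu.-integrable E (EFin \o A) -> exists h : nat -> R -> R,
    [/\ forall n, continuous (h n), forall n, mu.-integrable E (EFin \o h n) &
     \int[mu]_(t in E) `|A t - h n t| @[n --> \oo] --> (0:R)].
  move=> Ai; have [h [c i l]] := approximation_continuous_integrable mE Efin Ai.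
  by exists h; split => //; apply: (fine_cvg l).
have [h1 [c1 i1 l1]] := approx _ A1i.
have [h2 [c2 i2 l2]] := approx _ A2i.
have cvgP (A : R -> R) (h : nat -> R -> R) : mu.-integrable E (EFin \o A) ->
    (forall n, mu.-integrable E (EFin \o h n)) ->
    \int[mu]_(t in E) `|A t - h n t| @[n --> \oo] --> (0:R) ->
    forall s, I s -> prim (h n) s @[n --> \oo] --> prim A s.
  move=> Ai hi l s Is; apply/cvgrPdist_le => e e0.
  move/cvgrPdist_le : l => /(_ e e0); apply: filterS => n.
  rewrite sub0r normrN => H; apply: (le_trans (prim_dist Ai (hi n) Is)).
  exact: (le_trans (ler_norm _) H).
have cvgG (G : R * R -> R) s : continuous G -> I s ->
    G (prim (h1 n) s, prim (h2 n) s) @[n --> \oo] --> G (prim A1 s, prim A2 s).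
  move=> cG Is.
  have cc : (prim (h1 n) s, prim (h2 n) s) @[n --> \oo] --> (prim A1 s, prim A2 s).
    exact: (@cvg_pair nat R R \oo (nbhs (prim A1 s)) (nbhs (prim A2 s)) _ _ _ _ _
      (cvgP _ _ A1i i1 l1 s Is) (cvgP _ _ A2i i2 l2 s Is)).
  apply: (@continuous_cvg _ _ _ _ _ (fun n => (prim (h1 n) s, prim (h2 n) s)) G) => //.
  exact: cG.
have mphi' : measurable_fun (I : set (measurableTypeR R)) phi'.
  exact: Rint_measurable (int_C cphi').
have mphi : measurable_fun (I : set (measurableTypeR R)) phi.
  exact: Rint_measurable (int_C cphi).
have [Cp Cp0 phiC] : exists2 Cp, 0 <= Cp & forall s, I s -> `|phi s| <= Cp.
  have : compact (phi @` I).
    by apply: continuous_compact; [exact: continuous_subspaceT|exact: segment_compact].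
  move=> /compact_bounded[K [Kr HK]]; exists (`|K| + 1); first by rewrite addr_ge0.
  move=> x Ix; apply: (HK (`|K| + 1)); last by exists x.
  by rewrite (le_lt_trans (ler_norm _))// ltrDl.
have C0 : 0 <= C by apply: le_trans (gC (0,0)).
have LHS : \int[mu]_(s in I) (g (prim (h1 n) s, prim (h2 n) s) * phi' s) @[n --> \oo] -->
    \int[mu]_(s in I) (g (prim A1 s, prim A2 s) * phi' s).
  have [] := @Rdominated_cvg _ _ _ mu I
    (fun n s => g (prim (h1 n) s, prim (h2 n) s) * phi' s)
    (fun s => g (prim A1 s, prim A2 s) * phi' s) (fun s => C * `|phi' s|) mI _ _ _ _.
  - by move=> n; apply: measurable_funM => //; exact: prim_measurable.
  - by move=> s Is; apply: cvgM; [exact: cvgG|exact: cvg_cst].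
  - by apply: RintZ => //; apply: Rint_norm; exact: int_C.
  - by move=> n s _; rewrite normrM ler_wpM2r.
  - by [].
have A1I := integrableS mE mI IE A1i; have A2I := integrableS mE mI IE A2i.
have RHS1 : \int[mu]_(s in I) ((ga (prim (h1 n) s, prim (h2 n) s) * A1 s
       + gb (prim (h1 n) s, prim (h2 n) s) * A2 s) * phi s) @[n --> \oo] -->
    \int[mu]_(s in I) ((ga (prim A1 s, prim A2 s) * A1 s
                        + gb (prim A1 s, prim A2 s) * A2 s) * phi s).
  have [] := @Rdominated_cvg _ _ _ mu I
    (fun n s => (ga (prim (h1 n) s, prim (h2 n) s) * A1 s
       + gb (prim (h1 n) s, prim (h2 n) s) * A2 s) * phi s)
    (fun s => (ga (prim A1 s, prim A2 s) * A1 s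
                        + gb (prim A1 s, prim A2 s) * A2 s) * phi s)
    (fun s => (C * Cp) * (`|A1 s| + `|A2 s|)) mI _ _ _ _.
  - move=> n; apply: measurable_funM => //; apply: measurable_funD; apply: measurable_funM.
    + exact: prim_measurable.
    + exact: Rint_measurable A1I.
    + exact: prim_measurable.
    + exact: Rint_measurable A2I.
  - move=> s Is; apply: cvgM; last exact: cvg_cst.
    by apply: cvgD; apply: cvgM; try exact: cvg_cst; exact: cvgG.
  - by apply: RintZ => //; apply: RintD => //; exact: Rint_norm.
  - move=> n s Is; rewrite normrM mulrAC ler_pM//; last exact: phiC.
    by rewrite (le_trans (ler_normD _ _))// mulrDr lerD// normrM ler_wpM2r.
  - by [].
have RHS2 : \int[mu]_(s in I) ((ga (prim (h1 n) s, prim (h2 n) s) * (h1 n s - A1 s)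
       + gb (prim (h1 n) s, prim (h2 n) s) * (h2 n s - A2 s)) * phi s) @[n --> \oo] --> (0:R).
  have e0 : (C * Cp) * (\int[mu]_(t in E) `|A1 t - h1 n t| + \int[mu]_(t in E) `|A2 t - h2 n t|)
     @[n --> \oo] --> (0 : R).
    have l12 := cvgD l1 l2; rewrite addr0 in l12.
    by rewrite -(mulr0 (C * Cp)); apply: cvgM; [exact: cvg_cst|exact: l12].
  apply/cvgrPdist_le => e e_gt0; move/cvgrPdist_le : e0 => /(_ e e_gt0).
  apply: filterS => n; rewrite !sub0r !normrN => H.
  apply: le_trans (le_trans (ler_norm _) H).
  have h1I := integrableS mE mI IE (i1 n); have h2I := integrableS mE mI IE (i2 n).
  have d1 := RintB mI A1I h1I; have d2 := RintB mI A2I h2I.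
  have n1 := Rint_norm d1; have n2 := Rint_norm d2.
  have mono A h : mu.-integrable E (EFin \o A) -> mu.-integrable E (EFin \o h) ->
     \int[mu]_(t in I) `|A t - h t| <= \int[mu]_(t in E) `|A t - h t|.
    move=> Ai hi; have d := Rint_norm (RintB mE Ai hi).
    rewrite Rintegral_mkcond [leRHS]Rintegral_mkcond.
    apply: (le_Rintegral measurableT).
    - have := (integrable_mkcond _ mI).1 (integrableS mE mI IE d); congr (_.-integrable _ _).
      by apply/funext => x; rewrite /= !patchE; case: ifP.
    - have := (integrable_mkcond _ mE).1 d; congr (_.-integrable _ _).
      by apply/funext => x; rewrite /= !patchE; case: ifP.
    - move=> x _; rewrite !patchE; case: ifPn => // xs.
        by rewrite ifT// inE; apply: IE; rewrite inE in xs.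
      by case: ifP => _; [exact: normr_ge0|exact: lexx].
  apply: (@le_trans _ _ (C * Cp * (\int[mu]_(t in I) `|A1 t - h1 n t| + \int[mu]_(t in I) `|A2 t - h2 n t|))); last first.
    by apply: ler_wpM2l; [exact: mulr_ge0|apply: lerD; exact: mono].
  rewrite -(RintegralD mI n1 n2) -(RintegralZl _ mI (RintD mI n1 n2)).
  apply: Rintegral_le_norm => //.
  - have q : mu.-integrable I (EFin \o (fun s => C * Cp * (`|A1 s - h1 n s| + `|A2 s - h2 n s|))).
      by apply: RintZ => //; exact: RintD.
    apply: (Rint_le mI _ _ q).
      apply: measurable_funM => //; apply: measurable_funD; apply: measurable_funM.
      + exact: prim_measurable.
      + by apply: measurable_funB; [exact: Rint_measurable h1I|exact: Rint_measurable A1I].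
      + exact: prim_measurable.
      + by apply: measurable_funB; [exact: Rint_measurable h2I|exact: Rint_measurable A2I].
    move=> s Is; rewrite normrM mulrAC ler_pM//; last exact: phiC.
    rewrite (le_trans (ler_normD _ _))// [leRHS]mulrDr lerD// normrM.
      by rewrite distrC ler_wpM2r.
    by rewrite distrC ler_wpM2r.
  - by apply: RintZ => //; exact: RintD.
  - move=> s Is; rewrite normrM mulrAC ler_pM//; last exact: phiC.
    rewrite (le_trans (ler_normD _ _))// [leRHS]mulrDr lerD// normrM.
      by rewrite distrC ler_wpM2r.
    by rewrite distrC ler_wpM2r.
have sum n : \int[mu]_(s in I) (g (prim (h1 n) s, prim (h2 n) s) * phi' s) =
   - (\int[mu]_(s in I) ((ga (prim (h1 n) s, prim (h2 n) s) * A1 s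
       + gb (prim (h1 n) s, prim (h2 n) s) * A2 s) * phi s) +
     \int[mu]_(s in I) ((ga (prim (h1 n) s, prim (h2 n) s) * (h1 n s - A1 s)
       + gb (prim (h1 n) s, prim (h2 n) s) * (h2 n s - A2 s)) * phi s)).
  rewrite chain_cont//; congr (- _).
  have h1I := integrableS mE mI IE (i1 n); have h2I := integrableS mE mI IE (i2 n).
  have key B1 B2 : mu.-integrable I (EFin \o B1) -> mu.-integrable I (EFin \o B2) ->
     mu.-integrable I (EFin \o (fun s => (ga (prim (h1 n) s, prim (h2 n) s) * B1 s
       + gb (prim (h1 n) s, prim (h2 n) s) * B2 s) * phi s)).
    move=> b1 b2; apply: (@Rint_mul_bounded _ _ _ _ _ _ _ Cp) => //.
    apply: RintD => //.
      under eq_fun do rewrite mulrC.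
      by apply: (@Rint_mul_bounded _ _ _ _ _ _ _ C) => //; exact: prim_measurable.
    under eq_fun do rewrite mulrC.
    by apply: (@Rint_mul_bounded _ _ _ _ _ _ _ C) => //; exact: prim_measurable.
  have k1 := key _ _ A1I A2I.
  have k2 := key _ _ (RintB mI h1I A1I) (RintB mI h2I A2I).
  rewrite -(RintegralD mI k1 k2); apply: eq_Rintegral => s _; ring.
have RHS := cvgN (cvgD RHS1 RHS2); rewrite addr0 in RHS.
apply: (cvg_unique (@Rhausdorff R) LHS).
by rewrite (funext sum); exact: RHS.
Qed.

End line_chain.

Section lines.
Variable R : realType.
Notation mu := (@lebesgue_measure R).
Notation line := (measurableTypeR R).
Notation plane := (measurableTypeR R * measurableTypeR R)%type.
Implicit Types (f v a A : R -> R) (M s : R).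

Lemma measurable_ray s : measurable ([set x | x < s] : set line).
Proof.
have -> : [set x : R | x < s] = `]-oo, s[%classic by apply/seteqP; split => x /=; rewrite in_itv.
exact: measurable_itv.
Qed.

Lemma Rint_patch_ray f s : mu.-integrable setT (EFin \o f) ->
  mu.-integrable setT (EFin \o (fun x => if x < s then f x else 0)).
Proof.
move=> fi; apply: (Rint_le measurableT _ _ (Rint_norm fi)).
  apply: measurable_fun_ifT => //; last exact: Rint_measurable fi.
  exact: measurable_fun_ltr.
by move=> x _ /=; case: ifP => // _; rewrite normr0.
Qed.

(** All rays are reached as left limits of rational ones, and they generate the
    Borel sets; only countably many identities are assumed, so that they can hold
    simultaneously on almost every line. *)
Lemma integral_ray_ae0 f M : mu.-integrable setT (EFin \o f) ->
  (forall x, M < `|x| -> f x = 0) ->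
  (forall q : rat, \int[mu]_x (if x < ratr q then f x else 0) = 0) ->
  ae_eq mu setT f (cst 0).
Proof.
move=> fi fM fq.
have real s : \int[mu]_x (if x < s then f x else 0) = 0.
  have /choice[r rP] : forall n : nat, exists q : rat, s - n.+1%:R^-1 < ratr q < s.
    move=> n; have /rat_in_itvoo[q] : s - n.+1%:R^-1 < s by rewrite ltrBlDr ltrDl invr_gt0.
    by rewrite in_itv => h; exists q.
  have [_ c] : mu.-integrable setT (EFin \o (fun x => if x < s then f x else 0)) /\
      \int[mu]_x (if x < ratr (r n) then f x else 0) @[n --> \oo] -->
      \int[mu]_x (if x < s then f x else 0).
    apply: (@Rdominated_cvg _ _ _ mu setT
      (fun n x => if x < ratr (r n) then f x else 0)
      (fun x => if x < s then f x else 0) (fun x => `|f x|)) => //.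
    - by move=> n; apply: Rint_measurable; exact: Rint_patch_ray.
    - move=> x _; case: ifPn => xs; last first.
        apply: cvg_near_cst; apply: nearW => n; rewrite ifF//; apply/negbTE.
        rewrite -leNgt; rewrite -leNgt in xs; apply: (le_trans _ xs); apply: ltW.
        by have /andP[] := rP n.
      have sx0 : 0 < s - x by rewrite subr_gt0.
      apply: cvg_near_cst; near=> n; rewrite ifT//.
      have /andP[h _] := rP n; apply: lt_trans h.
      rewrite ltrBrDl -ltrBrDr; near: n.
      exact: (near_infty_natSinv_lt (PosNum sx0)).
    - exact: Rint_norm.
    - by move=> n x _; case: ifP => // _; rewrite normr0.
  rewrite -(cvg_lim (@Rhausdorff R) c); apply/cvg_lim; first exact: Rhausdorff.
  by apply: cvg_near_cst; apply: nearW => n; exact: fq.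
have zero s : (\int[mu]_(x in [set x | (x < s)%R]) (f x)%:E = 0)%E.
  have mr := measurable_ray s.
  have fin : (\int[mu]_(x in [set x | (x < s)%R]) (f x)%:E)%E \is a fin_num.
    by apply: integrable_fin_num => //; exact: (integrableS measurableT).
  rewrite -(fineK fin); congr (_%:E).
  transitivity (\int[mu]_(x in [set x | x < s]) f x) => //.
  rewrite -(real s) Rintegral_mkcond; apply: eq_Rintegral => x _; rewrite patchE.
  by have -> : (x \in [set x | x < s]) = (x < s) by apply/idP/idP; rewrite inE.
have zT : (\int[mu]_x (f x)%:E = 0)%E.
  rewrite -(zero (`|M| + 1)) [RHS]integral_mkcond; apply: eq_integral => x _.
  rewrite patchE; case: ifPn => //; rewrite notin_setE /= => /negP.
  rewrite -leNgt => h; rewrite fM//; apply: (le_lt_trans (ler_norm M)).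
  by apply: (lt_le_trans _ (le_trans h (ler_norm x))); rewrite ltrDl.
have all0 (D : set R) : measurable (D : set line) -> (\int[mu]_(x in D) (f x)%:E = 0)%E.
  move=> mD; have -> : D = id @^-1` D `&` setT by rewrite setIT.
  apply: (@integral_eq0_dynkin _ _ _ _ _ fi _ line id _ (@RGenInftyO.G R)) => //.
  - exact: (RGenInftyO.measurableE R).
  - move=> _ _ [s ->] [t ->]; exists (Num.min s t).
    by apply/seteqP; split => z /=; rewrite !in_itv /= lt_min => /andP.
  - move=> _ [s ->]; rewrite setIT preimage_id -(zero s).
    by congr (integral _ _ _); apply/seteqP; split => x /=; rewrite in_itv.
have h : ae_eq mu setT (EFin \o f) (cst 0%E).
  apply: integral_ae_eq => //.
  by move=> D _ mD; rewrite all0// integral0.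
by apply: ae_mono h => x h _; have [] := h I.
Unshelve. all: by end_near. Qed.

Lemma Rint_tensor (u w : R -> R) : mu.-integrable setT (EFin \o u) ->
  mu.-integrable setT (EFin \o w) ->
  (leb2 R).-integrable setT (EFin \o (fun z => u z.1 * w z.2)).
Proof.
move=> ui wi.
have mu_ := Rint_measurable ui; have mw := Rint_measurable wi.
have m : measurable_fun (setT : set plane) (fun z : plane => u z.1 * w z.2).
  apply: measurable_funM; first exact: (measurableT_comp mu_ measurable_fst).
  exact: (measurableT_comp mw measurable_snd).
have mE : measurable_fun (setT : set plane) (EFin \o (fun z : plane => u z.1 * w z.2)).
  exact/measurable_EFinP.
apply/(integrable21ltyP mu mu mE) => /=.
have nu := Rint_norm ui; have nw := Rint_norm wi.
apply: (@le_lt_trans _ _ (\int[mu]_y ((\int[mu]_x `|u x|)%R * `|w y|)%:E)%E).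
  rewrite le_eqVlt; apply/orP; left; apply/eqP; apply: eq_integral => y _.
  under eq_integral do rewrite normrM mulrC.
  have := RintegralZl `|w y| measurableT nu; rewrite [in RHS]mulrC => <-.
  by rewrite /Rintegral fineK//; apply: integrable_fin_num => //; exact: RintZ.
have := RintZ (\int[mu]_x `|u x|) measurableT nw.
move=> /integrableP[_]; apply: le_lt_trans; apply: ge0_le_integral => //.
- by move=> y _; rewrite lee_fin mulr_ge0// Rintegral_ge0.
- apply/measurable_EFinP; apply: measurable_funM => //; exact: Rint_measurable nw.
- apply: measurableT_comp => //; apply/measurable_EFinP.
  by apply: measurable_funM => //; exact: Rint_measurable nw.
- by move=> y _; rewrite lee_fin ler_norm.
Qed.

Section primitive.
Variables (M : R) (A : R -> R).
Hypothesis M0 : 0 < M.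
Hypothesis Ai : mu.-integrable setT (EFin \o A).
Hypothesis AM : forall x, M < `|x| -> A x = 0.
Let L := M + 1.
Let P x := \int[mu]_(t in `[- L, x]) A t.

Lemma prim_restrict x : P x = \int[mu]_t (if t <= x then A t else 0).
Proof.
rewrite /P Rintegral_mkcond; apply: eq_Rintegral => t _; rewrite patchE.
case: ifPn => [|]; first by rewrite inE /= in_itv /= => /andP[_ ->].
rewrite notin_setE /= in_itv /= => /negP; case: ifP => // tx; rewrite andbT.
rewrite -ltNge => tL; rewrite AM// -normrN (lt_le_trans _ (ler_norm _))// /L.
by rewrite ltrNr (lt_trans tL)// ltrN2 ltrDl.
Qed.

Let f s (z : R * R) : R :=
  (if (- L <= z.1) && (z.1 < s) then 1 else 0) * A z.2 * (if z.2 <= z.1 then 1 else 0).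

Let ind_int s : mu.-integrable setT (EFin \o (fun x : R => if (- L <= x) && (x < s) then 1 else 0 : R)).
Proof.
have := @integrable_indic_itv R (- L) s true true; congr (_.-integrable _ _).
apply/funext => x /=; rewrite indicE; congr (_%:E).
by rewrite mem_setE in_itv /=; case: (_ && _).
Qed.

Let fi s : (leb2 R).-integrable setT (EFin \o f s).
Proof.
apply: (@Rint_mul_bounded _ _ _ _ _ _ _ 1 measurableT).
- exact: (Rint_tensor (ind_int s) Ai).
- apply: measurable_fun_ifT => //.
  by apply: measurable_fun_ler; [exact: measurable_snd|exact: measurable_fst].
- by move=> x _; case: ifP => _; rewrite ?normr1 ?normr0.
Qed.

(** Both sides are the integral of A(t) over the triangle of all (x, t) with
    t <= x < s. *)
Lemma integral_prim s :
  mu.-integrable setT (EFin \o (fun x => if (- L <= x) && (x < s) then P x else 0)) /\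
  \int[mu]_x (if (- L <= x) && (x < s) then P x else 0) =
  \int[mu]_t (A t * Num.max 0 (s - t)).
Proof.
have e1 x : \int[mu]_t f s (x, t) = if (- L <= x) && (x < s) then P x else 0.
  rewrite /f /=; case: ifPn => _; last first.
    by under eq_Rintegral do rewrite !mul0r; rewrite Rintegral_cst// mul0r.
  rewrite prim_restrict; apply: eq_Rintegral => t _; rewrite mul1r.
  by case: ifP; rewrite ?mulr1 ?mulr0.
have e2 t : \int[mu]_x f s (x, t) = A t * Num.max 0 (s - t).
  have -> : \int[mu]_x f s (x, t) = \int[mu]_(x in `[t, s[) A t.
    rewrite [RHS]Rintegral_mkcond; apply: eq_Rintegral => x _; rewrite /f patchE /=.
    rewrite mem_setE in_itv /=.
    have [tx|xt] := leP t x; last by rewrite mulr0.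
    rewrite /= mulr1; have [xs|sx] := ltP x s; last by rewrite andbF mul0r.
    rewrite andbT; case: ifPn; rewrite ?mul1r// -ltNge => xL.
    rewrite mul0r AM// -normrN (lt_le_trans _ (ler_norm _))//.
    by rewrite ltrNr (le_lt_trans tx)// (lt_trans xL)// ltrN2 ltrDl.
  have mts : measurable (`[t, s[%classic : set line) by exact: measurable_itv.
  have len : fine (@lebesgue_measure R `[t, s[%classic) = Num.max 0 (s - t).
    rewrite lebesgue_measure_itv /=; case: ltP => /= h.
      by rewrite lte_fin in h; rewrite max_r// subr_ge0 ltW.
    by rewrite lee_fin in h; rewrite max_l// subr_le0.
  rewrite (Rintegral_cst mu mts); apply: (f_equal (fun z => A t * z)); exact: len.
have fs := Rint_swp (fi s).
split.
  have := Rint_fubini fs; congr (_.-integrable _ _).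
  by apply/funext => x /=; rewrite -e1.
under eq_Rintegral do rewrite -e1.
transitivity (\int[leb2 R]_z f s (swp z)); first by rewrite (Rfubini fs).
rewrite (Rintegral_swp (fi s)) (Rfubini (fi s)).
by apply: eq_Rintegral => t _; rewrite e2.
Qed.

(** Testing with functions whose derivative is a ray identifies [v] with the
    primitive of [A]. *)
Lemma ae_eq_prim (v : R -> R) : mu.-integrable setT (EFin \o v) ->
  (forall x, M < `|x| -> v x = 0) ->
  (forall q : rat, \int[mu]_x (if x < ratr q then v x else 0) =
    \int[mu]_t (A t * Num.max 0 (ratr q - t))) ->
  mu.-integrable setT (EFin \o P) /\ ae_eq mu setT v P.
Proof.
move=> vi vM H.
have Axi : mu.-integrable setT (EFin \o (fun t => A t * t)).
  apply: (Rint_le measurableT _ _ (RintZ M measurableT (Rint_norm Ai))).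
    by apply: measurable_funM => //; exact: Rint_measurable Ai.
  move=> t _; rewrite normrM mulrC; have [h|h] := leP `|t| M; first by rewrite ler_wpM2r.
  by rewrite AM// normr0 !mulr0.
have bigq (q : rat) : M < ratr q ->
    \int[mu]_x v x = ratr q * (\int[mu]_t A t) - \int[mu]_t (A t * t).
  move=> Mq; rewrite -(RintegralZl _ measurableT Ai).
  rewrite -(RintegralB measurableT (RintZ _ measurableT Ai) Axi).
  transitivity (\int[mu]_x (if x < ratr q then v x else 0)).
    apply: eq_Rintegral => x _; case: ltP => // qx; rewrite vM//.
    exact: (lt_le_trans Mq (le_trans qx (ler_norm _))).
  rewrite H; apply: eq_Rintegral => t _; have [tq|qt] := leP t (ratr q).
    by rewrite max_r ?subr_ge0// mulrBr mulrC.
  rewrite AM ?mul0r ?mulr0 ?subrr//.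
  exact: (lt_trans Mq (lt_le_trans qt (ler_norm _))).
have A0 : \int[mu]_t A t = 0.
  have /rat_in_itvoo[q1] : M < M + 1 by rewrite ltrDl.
  rewrite in_itv => /andP[h1 h1'].
  have /rat_in_itvoo[q2] : ratr q1 < ratr q1 + 1 :> R by rewrite ltrDl.
  rewrite in_itv => /andP[h2 _].
  have b1 := bigq q1 h1; have b2 := bigq q2 (lt_trans h1 h2).
  have : (ratr q2 - ratr q1) * \int[mu]_t A t = 0 by rewrite mulrBl; lra.
  by move/eqP; rewrite mulf_eq0 subr_eq0 (gt_eqF h2) /= => /eqP.
have PM x : M < `|x| -> P x = 0.
  rewrite prim_restrict lter_normr => /orP[Mx|xM].
    rewrite -A0; apply: eq_Rintegral => t _; case: leP => // xt.
    by rewrite AM// (lt_le_trans (lt_trans Mx xt) (ler_norm _)).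
  rewrite -[RHS](mul0r (fine (mu setT))) -(Rintegral_cst mu measurableT).
  apply: eq_Rintegral => t _; case: leP => // tx.
  rewrite AM// -normrN (lt_le_trans _ (ler_norm _))// (lt_le_trans xM)//.
  by rewrite lerN2.
have PL s : (fun x => if (- L <= x) && (x < s) then P x else 0) = (fun x => if x < s then P x else 0).
  apply/funext => x; case: (leP (- L) x) => //= xL; rewrite PM ?if_same//.
  rewrite -normrN (lt_le_trans _ (ler_norm _))// ltrNr (lt_trans xL)//.
  by rewrite ltrN2 ltrDl.
have Pi : mu.-integrable setT (EFin \o P).
  have [+ _] := integral_prim L; rewrite PL; congr (_.-integrable _ _).
  apply/funext => x /=; congr (_%:E); case: ltP => // Lx.
  by rewrite PM// (lt_le_trans _ (ler_norm _))// (lt_le_trans _ Lx)// ltrDl.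
have h : ae_eq mu setT (fun x => v x - P x) (cst 0).
  apply: (@integral_ray_ae0 _ M).
  - exact: (RintB measurableT vi Pi).
  - by move=> x Mx; rewrite vM// PM// subrr.
  - move=> q; have [_ +] := integral_prim (ratr q); rewrite PL -H => E.
    transitivity (\int[mu]_x ((if x < ratr q then v x else 0) - (if x < ratr q then P x else 0))).
      by apply: eq_Rintegral => x _; case: ifP => // _; rewrite subrr.
    rewrite (RintegralB measurableT (Rint_patch_ray _ vi) (Rint_patch_ray _ Pi)).
    by rewrite E subrr.
split; first exact: Pi.
by apply: ae_mono h => x h _; apply/eqP; rewrite -subr_eq0; apply/eqP; exact: h.
Qed.

End primitive.

End lines.

(** * The chain rule for weak derivatives *)

Section weak_lines.
Variable R : realType.
Notation mu := (@lebesgue_measure R).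
Notation line := (measurableTypeR R).
Notation plane := (measurableTypeR R * measurableTypeR R)%type.
Variables (M : R) (v a : R * R -> R).
Hypothesis M0 : 0 < M.
Hypothesis vi : (leb2 R).-integrable setT (EFin \o v).
Hypothesis ai : (leb2 R).-integrable setT (EFin \o a).
Hypothesis vM : bsupp M v.
Hypothesis aM : bsupp M a.
Hypothesis weak : forall phi, smooth phi ->
  \int[leb2 R]_x (v x * pd1 phi x) = - \int[leb2 R]_x (a x * phi x).

(** A smooth approximation of the ramp max(0, s - t), together with minus its
    derivative. *)
Definition ramp (n : nat) (s t : R) := (s - t) * flat 0 (n%:R * (s - t) + 0).
Definition ramp' (n : nat) (s t : R) :=
  flat 0 (n%:R * (s - t) + 0) + flat 1 (n%:R * (s - t) + 0).

Lemma is_derive_ramp n s t : is_derive t (1:R) (ramp n s) (- ramp' n s t).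
Proof.
have d0 : is_derive t (1:R) (fun t => s - t) (- 1).
  have := is_deriveB (is_derive_cst s t (1:R)) (is_derive_id t (1:R)).
  by rewrite sub0r.
have d1 : is_derive t (1:R) (fun t => n%:R * (s - t) + 0) (n%:R * - 1).
  have H := is_deriveD (is_deriveZ n%:R d0) (is_derive_cst (0:R) t (1:R)).
  by apply: (is_derive_eq H); rewrite addr0.
have d2 := @is_derive1_comp R (flat 0) (fun t => n%:R * (s - t) + 0) t _ _
  (is_derive_flat 0 (n%:R * (s - t) + 0)) d1.
have d3 := is_deriveM d0 d2; apply: (is_derive_eq d3).
rewrite /GRing.scale /= /ramp' mul0r subr0 addr0.
have e : n%:R * (s - t) * flat 2 (n%:R * (s - t)) = flat 1 (n%:R * (s - t)) by exact: flat_mulS.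
by rewrite -e; ring.
Qed.

Lemma smooth_ramp n s : smooth (fun x : R * R => ramp n s x.1).
Proof.
apply: smooth_mul; last exact: smooth_ray_approx1.
by apply: smooth_sub; [exact: smooth_cst|exact: smooth_fst].
Qed.

Lemma cvg_ramp s t : ramp n s t @[n --> \oo] --> (Num.max 0 (s - t) : R).
Proof.
have -> : Num.max 0 (s - t) = (s - t) * (if t < s then 1 else 0).
  case: ltP => h; first by rewrite mulr1 max_r// subr_ge0 ltW.
  by rewrite mulr0 max_l// subr_le0.
by apply: cvgM; [exact: cvg_cst|exact: cvg_ray_approx].
Qed.

Lemma ramp_bound n s t : `|ramp n s t| <= `|s| + `|t|.
Proof.
rewrite normrM -[leRHS]mulr1; apply: ler_pM => //; first exact: ler_normB.
exact: ray_approx_bound.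
Qed.

Lemma cvg_ramp' s t : ramp' n s t @[n --> \oo] --> ((if t < s then 1 else 0) : R).
Proof.
rewrite -[X in _ --> X]addr0; apply: cvgD; first exact: cvg_ray_approx.
have [ts|st] := ltP t s.
  have := @cvg_flat R 1 (s - t) 0; rewrite subr_gt0 => /(_ ts); exact.
apply: cvg_near_cst; apply: nearW => n.
by rewrite flat_le0// addr0 mulr_ge0_le0// subr_le0.
Qed.

Lemma ramp'_bound n s t : `|ramp' n s t| <= 1.
Proof. by rewrite ger0_norm ?addr_ge0 ?flat_ge0// flat01_le1. Qed.

Let tst n s c (x : R * R) := ramp n s x.1 * ray_approx n c x.2.

Let pd1_tst n s c : pd1 (tst n s c) = (fun x => - (ramp' n s x.1 * ray_approx n c x.2)).
Proof.
apply/funext => x; apply: pd1P => /=.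
have := is_deriveM (is_derive_ramp n s x.1) (is_derive_cst (ray_approx n c x.2) x.1 (1:R)) => H.
by apply: (is_derive_eq H); rewrite /GRing.scale /= mulr0 add0r mulrN mulrC.
Qed.

Let smooth_tst n s c : smooth (tst n s c).
Proof. by apply: smooth_mul; [exact: smooth_ramp|exact: smooth_ray_approx2]. Qed.

Let Dmax s x := a x * Num.max 0 (s - x.1).

Let measurable_max s : measurable_fun (setT : set plane) (fun x : plane => Num.max 0 (s - x.1)).
Proof.
apply: measurable_maxr; first exact: measurable_cst.
by apply: measurable_funB; [exact: measurable_cst|exact: measurable_fst].
Qed.

Let Dmax_int s : (leb2 R).-integrable setT (EFin \o Dmax s).
Proof.
apply: (Rint_le measurableT _ _ (RintZ (`|s| + M) measurableT (Rint_norm ai))).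
  by apply: measurable_funM; [exact: Rint_measurable ai|exact: measurable_max].
move=> x _; rewrite normrM mulrC; have [h|h] := leP `|x.1| M; last first.
  by rewrite aM ?normr0 ?mulr0//; left.
apply: ler_wpM2r => //; rewrite ger0_norm ?le_max ?lexx// ge_max addr_ge0//=; last exact: ltW.
apply: (le_trans (ler_norm _)); apply: (le_trans (ler_normB _ _)); exact: lerD.
Qed.

Let vray s x := if x.1 < s then v x else 0.

Let vray_int s : (leb2 R).-integrable setT (EFin \o vray s).
Proof.
apply: (Rint_le measurableT _ _ (Rint_norm vi)).
  apply: measurable_fun_ifT => //; last exact: Rint_measurable vi.
  by apply: measurable_fun_ltr => //; exact: measurable_fst.
by move=> x _; rewrite /vray; case: ifP; rewrite ?normr0.
Qed.

Let halfplane_eq s c :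
  \int[leb2 R]_x (if x.2 < c then vray s x else 0) =
  \int[leb2 R]_x (if x.2 < c then Dmax s x else 0).
Proof.
have [_ L1] : (leb2 R).-integrable setT (EFin \o (fun x => if x.2 < c then vray s x else 0)) /\
    \int[leb2 R]_x (v x * (ramp' n s x.1 * ray_approx n c x.2)) @[n --> \oo] -->
    \int[leb2 R]_x (if x.2 < c then vray s x else 0).
  apply: (@Rdominated_cvg _ _ _ (leb2 R) setT
     (fun n x => v x * (ramp' n s x.1 * ray_approx n c x.2))
     (fun x => if x.2 < c then vray s x else 0) (fun x => `|v x|) measurableT).
  - move=> n; apply: measurable_funM; first exact: Rint_measurable vi.
    have := smooth_measurable (smooth_pd1 (smooth_tst n s c)); rewrite pd1_tst => m.
    by have := measurable_funN m; congr measurable_fun; apply/funext => x /=; rewrite opprK.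
  - move=> x _; rewrite /vray.
    have -> : (if x.2 < c then if x.1 < s then v x else 0 else 0) =
        v x * ((if x.1 < s then 1 else 0) * (if x.2 < c then 1 else 0)).
      by case: ifP => _; case: ifP => _; rewrite ?mulr1 ?mulr0.
    apply: cvgM; first exact: cvg_cst.
    by apply: cvgM; [exact: cvg_ramp'|exact: cvg_ray_approx].
  - exact: Rint_norm vi.
  - move=> n x _; rewrite normrM ler_piMr// normrM -[leRHS]mulr1.
    by apply: ler_pM => //; [exact: ramp'_bound|exact: ray_approx_bound].
have [_ L2] : (leb2 R).-integrable setT (EFin \o (fun x => if x.2 < c then Dmax s x else 0)) /\
    \int[leb2 R]_x (a x * tst n s c x) @[n --> \oo] -->
    \int[leb2 R]_x (if x.2 < c then Dmax s x else 0).
  apply: (@Rdominated_cvg _ _ _ (leb2 R) setT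
     (fun n x => a x * tst n s c x)
     (fun x => if x.2 < c then Dmax s x else 0) (fun x => (`|s| + M) * `|a x|) measurableT).
  - move=> n; apply: measurable_funM; first exact: Rint_measurable ai.
    exact: smooth_measurable.
  - move=> x _; rewrite /Dmax.
    have -> : (if x.2 < c then a x * Num.max 0 (s - x.1) else 0) =
        a x * (Num.max 0 (s - x.1) * (if x.2 < c then 1 else 0)).
      by case: (x.2 < c); rewrite ?mulr1 ?mulr0.
    apply: cvgM; first exact: cvg_cst.
    by apply: cvgM; [exact: cvg_ramp|exact: cvg_ray_approx].
  - by apply: RintZ => //; exact: Rint_norm ai.
  - move=> n x _; rewrite normrM mulrC; have [h|h] := leP `|x.1| M; last first.
      by rewrite aM ?normr0 ?mulr0//; left.
    apply: ler_wpM2r => //; rewrite normrM -[leRHS]mulr1; apply: ler_pM => //.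
      by apply: (le_trans (ramp_bound _ _ _)); rewrite lerD2l.
    exact: ray_approx_bound.
have E n : \int[leb2 R]_x (v x * (ramp' n s x.1 * ray_approx n c x.2)) =
    \int[leb2 R]_x (a x * tst n s c x).
  have := weak (smooth_tst n s c); rewrite pd1_tst => W.
  apply: oppr_inj; rewrite -W -mulN1r -(RintegralZl _ measurableT); last first.
    apply: (@Rint_mul_bounded _ _ _ _ _ _ _ 1 measurableT vi).
      have := smooth_measurable (smooth_pd1 (smooth_tst n s c)); rewrite pd1_tst => m.
      by have := measurable_funN m; congr measurable_fun; apply/funext => x /=; rewrite opprK.
    move=> x _; rewrite normrM -[leRHS]mulr1.
    by apply: ler_pM => //; [exact: ramp'_bound|exact: ray_approx_bound].
  by apply: eq_Rintegral => x _; rewrite mulN1r mulrN.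
apply: (cvg_unique (@Rhausdorff R) L1).
by rewrite (funext E); exact: L2.
Qed.

Let slice_eq s : {ae mu, forall y, \int[mu]_x (vray s (x, y) - Dmax s (x, y)) = 0}.
Proof.
have Di := RintB measurableT (vray_int s) (Dmax_int s).
have hi := Rint_fubini Di.
have : ae_eq mu setT (fun y => \int[mu]_x (vray s (x, y) - Dmax s (x, y))) (cst 0).
  apply: (@integral_ray_ae0 _ _ M) => //.
  - move=> y yM; rewrite -[RHS](mul0r (fine (mu setT))) -(Rintegral_cst mu measurableT).
    apply: eq_Rintegral => x _.
    rewrite /vray /Dmax vM; last by right.
    by rewrite aM ?mul0r ?if_same ?subrr//; right.
  - move=> q.
    have mh : measurable_fun (setT : set plane) (fun x : plane => x.2 < ratr q).
      by apply: measurable_fun_ltr => //; exact: measurable_snd.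
    have cut f : (leb2 R).-integrable setT (EFin \o f) ->
        (leb2 R).-integrable setT (EFin \o (fun x => if x.2 < ratr q then f x else 0)).
      move=> fi; apply: (Rint_le measurableT _ _ (Rint_norm fi)).
        by apply: measurable_fun_ifT => //; exact: Rint_measurable fi.
      by move=> x _; case: ifP; rewrite ?normr0.
    transitivity (\int[mu]_y \int[mu]_x (if y < ratr q then vray s (x, y) - Dmax s (x, y) else 0)).
      apply: eq_Rintegral => y _; case: ifP => // _.
      by rewrite (Rintegral_cst mu measurableT) mul0r.
    have Df := Rfubini (cut _ Di).
    apply: (etrans (esym Df)) => /=.
    transitivity (\int[leb2 R]_x ((if x.2 < ratr q then vray s x else 0) -
        (if x.2 < ratr q then Dmax s x else 0))).
      by apply: eq_Rintegral => x _; case: ifP => _; rewrite ?subrr.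
    rewrite (RintegralB measurableT (cut _ (vray_int s)) (cut _ (Dmax_int s))).
    by rewrite halfplane_eq subrr.
by apply: ae_mono => y h; exact: h.
Qed.

(** Testing with ramps times half-lines and applying Fubini gives, for each
    rational ray, an identity on almost every line, and [ae_eq_prim] turns these
    identities into the equality of v with a primitive. *)
Lemma weak_lines : {ae mu, forall y,
  [/\ mu.-integrable setT (EFin \o (fun x => v (x, y))),
      mu.-integrable setT (EFin \o (fun x => a (x, y))),
      mu.-integrable setT (EFin \o (fun x => \int[mu]_(t in `[- (M + 1), x]) a (t, y))) &
      ae_eq mu setT (fun x => v (x, y)) (fun x => \int[mu]_(t in `[- (M + 1), x]) a (t, y))]}.
Proof.
have h : {ae mu, forall y, forall n : nat,
    \int[mu]_x (vray (ratr (odflt 0 (unpickle n))) (x, y) - Dmax (ratr (odflt 0 (unpickle n))) (x, y)) = 0}.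
  by apply/ae_foralln => n; exact: slice_eq.
have hs := ae_mono2 (fun y p q => conj p q) (Rint_slice vi) (Rint_slice ai).
apply: ae_mono2 h hs => y h [vy ay].
suff [pi pe] : mu.-integrable setT (EFin \o (fun x => \int[mu]_(t in `[- (M + 1), x]) a (t, y))) /\
  ae_eq mu setT (fun x => v (x, y)) (fun x => \int[mu]_(t in `[- (M + 1), x]) a (t, y)) by [].
apply: ae_eq_prim => //.
- by move=> x xM; apply: aM; left.
- by move=> x xM; apply: vM; left.
- move=> q; have := h (pickle q); rewrite pickleK /= => H.
  apply/eqP; rewrite -subr_eq0; apply/eqP.
  have di : mu.-integrable setT (EFin \o (fun x => a (x, y) * Num.max 0 (ratr q - x))).
    apply: (Rint_le measurableT _ _ (RintZ (`|ratr q| + M) measurableT (Rint_norm ay))).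
      apply: measurable_funM; first exact: Rint_measurable ay.
      by apply: measurable_maxr; [exact: measurable_cst|apply: measurable_funB].
    move=> x _; rewrite normrM mulrC; have [hx|hx] := leP `|x| M; last first.
      by rewrite aM ?normr0 ?mulr0//; left.
    apply: ler_wpM2r => //; rewrite ger0_norm ?le_max ?lexx// ge_max addr_ge0//=; last exact: ltW.
    by apply: (le_trans (ler_norm _)); apply: (le_trans (ler_normB _ _)); exact: lerD.
  by move: H; rewrite /vray /Dmax /= (RintegralB measurableT (Rint_patch_ray (ratr q) vy) di).
Qed.

End weak_lines.

Section weak_chain.
Variable R : realType.
Notation mu := (@lebesgue_measure R).
Notation plane := (measurableTypeR R * measurableTypeR R)%type.
Variables (g ga gb : R * R -> R) (C : R).
Hypothesis chain : forall (V1 V2 : R -> R) (t d1 d2 : R),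
  is_derive t (1:R) V1 d1 -> is_derive t (1:R) V2 d2 ->
  is_derive t (1:R) (fun t => g (V1 t, V2 t))
    (ga (V1 t, V2 t) * d1 + gb (V1 t, V2 t) * d2).
Hypothesis cg : continuous g.
Hypothesis cga : continuous ga.
Hypothesis cgb : continuous gb.
Hypothesis gC : forall x, `|g x| <= C.
Hypothesis gaC : forall x, `|ga x| <= C.
Hypothesis gbC : forall x, `|gb x| <= C.
Variables (M : R) (v1 v2 a1 a2 : R * R -> R).
Hypothesis M0 : 0 < M.
Hypothesis v1i : (leb2 R).-integrable setT (EFin \o v1).
Hypothesis v2i : (leb2 R).-integrable setT (EFin \o v2).
Hypothesis a1i : (leb2 R).-integrable setT (EFin \o a1).
Hypothesis a2i : (leb2 R).-integrable setT (EFin \o a2).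
Hypothesis v1M : bsupp M v1.
Hypothesis v2M : bsupp M v2.
Hypothesis a1M : bsupp M a1.
Hypothesis a2M : bsupp M a2.
Hypothesis weak1 : forall phi, smooth phi ->
  \int[leb2 R]_x (v1 x * pd1 phi x) = - \int[leb2 R]_x (a1 x * phi x).
Hypothesis weak2 : forall phi, smooth phi ->
  \int[leb2 R]_x (v2 x * pd1 phi x) = - \int[leb2 R]_x (a2 x * phi x).

Lemma measurable_comp2 (G : R * R -> R) : continuous G ->
  measurable_fun (setT : set plane) (fun x => G (v1 x, v2 x)).
Proof.
move=> cG; apply: (measurableT_comp (continuous_measurable_plane cG)).
by apply: measurable_fun_pair; [exact: Rint_measurable v1i|exact: Rint_measurable v2i].
Qed.

Lemma weak_chain_int B phi : smooth phi -> (forall x, `|phi x| <= B) ->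
  (leb2 R).-integrable setT (EFin \o (fun x => (ga (v1 x, v2 x) * a1 x + gb (v1 x, v2 x) * a2 x) * phi x)).
Proof.
move=> sp pB.
apply: (@Rint_mul_bounded _ _ _ _ _ _ _ B) => //; last exact: smooth_measurable.
apply: RintD => //; under eq_fun do rewrite mulrC.
  by apply: (@Rint_mul_bounded _ _ _ _ _ _ _ C) => //; exact: measurable_comp2.
by apply: (@Rint_mul_bounded _ _ _ _ _ _ _ C) => //; exact: measurable_comp2.
Qed.

(** On almost every horizontal line both functions are primitives, to which
    [chain_AC] applies; the identities on lines are then integrated. *)
Lemma weak_chain_rule N phi : N < M -> smooth phi -> bsupp N phi ->
  \int[leb2 R]_x (g (v1 x, v2 x) * pd1 phi x) =
  - \int[leb2 R]_x ((ga (v1 x, v2 x) * a1 x + gb (v1 x, v2 x) * a2 x) * phi x).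
Proof.
move=> NM sp bp.
have bpM : bsupp M phi by move=> x h; apply: bp; case: h => h; [left|right]; exact: lt_trans h.
have [B B0 pB'] := continuous_box_bounded M (smooth_cont sp).
have pB x : `|phi x| <= B.
  by have [/pB'//|bx] := pselect (box M x); rewrite (bsupp_box bpM bx) normr0.
have bd := bsupp_pd1 bpM.
have i1 : (leb2 R).-integrable setT (EFin \o (fun x => g (v1 x, v2 x) * pd1 phi x)).
  under eq_fun do rewrite mulrC.
  apply: (@Rint_mul_bounded _ _ _ _ _ _ _ C) => //; last exact: measurable_comp2.
  by apply: (Rint_cont_bsupp _ bd); apply: smooth_cont; exact: smooth_pd1.
have i2 := weak_chain_int sp pB.
have h1 := weak_lines M0 v1i a1i v1M a1M weak1.
have h2 := weak_lines M0 v2i a2i v2M a2M weak2.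
pose I : set R := `[- M, M]%classic.
have mI : measurable (I : set (measurableTypeR R)) by exact: measurable_itv.
have restr (F : R * R -> R) y : bsupp M F -> \int[mu]_x F (x, y) = \int[mu]_(x in I) F (x, y).
  move=> bF; rewrite [RHS]Rintegral_mkcond; apply: eq_Rintegral => x _; rewrite patchE.
  case: ifPn => //; rewrite notin_setE /I /= in_itv /= -ler_norml => /negP.
  by rewrite -ltNge => h; apply: bF; left.
rewrite (Rfubini i1) (Rfubini i2) -mulN1r -(RintegralZl _ measurableT (Rint_fubini i2)).
apply: ae_eq_Rintegral => //.
- exact: (Rint_measurable (Rint_fubini i1)).
- by apply: measurable_funM => //; exact: (Rint_measurable (Rint_fubini i2)).
apply: ae_mono2 h1 h2 => y [vy1 ay1 py1 e1] [vy2 ay2 py2 e2] _.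
rewrite mulN1r (restr (fun x => g (v1 x, v2 x) * pd1 phi x)); last first.
  by move=> x h; rewrite bd// mulr0.
rewrite (restr (fun x => (ga (v1 x, v2 x) * a1 x + gb (v1 x, v2 x) * a2 x) * phi x)); last first.
  by move=> x h; rewrite bpM// mulr0.
have dphi (t : R) : is_derive t (1:R) (fun t => phi (t, y)) (pd1 phi (t, y)).
  exact: (D1P (smooth_D1 sp) (t, y)).
have cpd : continuous (fun t => pd1 phi (t, y)).
  move=> t; apply: (@continuous_comp _ _ _ (fun t => (t, y)) (pd1 phi)).
    exact: (@cvg_pair R R R (nbhs t) (nbhs t) (nbhs y) _ _ _ id (fun=> y) cvg_id (cvg_cst y)).
  exact: (smooth_cont (smooth_pd1 sp)).
have pM : phi (M, y) = 0 by apply: bp; left; rewrite /= gtr0_norm.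
have pNM : phi (- M, y) = 0 by apply: bp; left; rewrite /= normrN gtr0_norm.
pose J : set R := `[- (M + 1), M + 1]%classic.
have I0 : True := Logic.I.
have mJ : measurable (J : set (measurableTypeR R)) by exact: measurable_itv.
have ay1E := integrableS measurableT mJ (@subsetT _ _) ay1.
have ay2E := integrableS measurableT mJ (@subsetT _ _) ay2.
have E := chain_AC chain cg cga cgb gC gaC gbC M0 dphi cpd pM pNM ay1E ay2E.
have mG (w1 w2 : R -> R) (G : R * R -> R) : continuous G ->
    mu.-integrable setT (EFin \o w1) -> mu.-integrable setT (EFin \o w2) ->
    measurable_fun (I : set (measurableTypeR R)) (fun s => G (w1 s, w2 s)).
  move=> cG w1i w2i; apply: measurable_funTS.
  apply: (measurableT_comp (continuous_measurable_plane cG)).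
  by apply: measurable_fun_pair; [exact: Rint_measurable w1i|exact: Rint_measurable w2i].
have mpd : measurable_fun (I : set (measurableTypeR R)) (fun t => pd1 phi (t, y)).
  by apply: measurable_funTS; exact: continuous_measurable_fun.
have mph : measurable_fun (I : set (measurableTypeR R)) (fun t => phi (t, y)).
  apply: measurable_funTS; apply: continuous_measurable_fun => t.
  apply/differentiable_continuous/derivable1_diffP; by have [] := dphi t.
have mI1 (w1 w2 : R -> R) : mu.-integrable setT (EFin \o w1) -> mu.-integrable setT (EFin \o w2) ->
    measurable_fun (I : set (measurableTypeR R)) (fun s => g (w1 s, w2 s) * pd1 phi (s, y)).
  by move=> j1 j2; apply: measurable_funM => //; exact: mG.
have mI2 (w1 w2 : R -> R) : mu.-integrable setT (EFin \o w1) -> mu.-integrable setT (EFin \o w2) ->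
    measurable_fun (I : set (measurableTypeR R))
      (fun s => (ga (w1 s, w2 s) * a1 (s, y) + gb (w1 s, w2 s) * a2 (s, y)) * phi (s, y)).
  move=> j1 j2; apply: measurable_funM => //; apply: measurable_funD; apply: measurable_funM.
  - exact: mG.
  - by apply: measurable_funTS; exact: Rint_measurable ay1.
  - exact: mG.
  - by apply: measurable_funTS; exact: Rint_measurable ay2.
have e12 := ae_mono2 (fun x (p : setT x -> _) (q : setT x -> _) => conj (p I0) (q I0)) e1 e2.
transitivity (\int[mu]_(s in I) (g (\int[mu]_(t in `[- (M + 1), s]) a1 (t, y),
    \int[mu]_(t in `[- (M + 1), s]) a2 (t, y)) * pd1 phi (s, y))).
  apply: ae_eq_Rintegral => //; [exact: mI1|exact: mI1|].
  by apply: ae_mono e12 => x [h k] _; rewrite h k.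
rewrite E; congr (- _).
apply: ae_eq_Rintegral => //; [exact: mI2|exact: mI2|].
by apply: ae_mono e12 => x [h k] _; rewrite h k.
Qed.

End weak_chain.

(** * Weak derivatives of functions of the gradient *)

Section plateau.
Variables (R : realType) (rho : R).
Hypothesis rho0 : 0 < rho.
Notation Om := (disk rho).

(** Where [chi n] exceeds [flat 0 1] the outer flat function vanishes, so that the
    composite is exactly 1 there, while it is still 0 off the support of
    [chi n]. *)
Definition plateau (n : nat) (x : R * R) : R :=
  1 - (flat 0 (flat 0 1))^-1 * flat 0 (flat 0 1 - chi rho n x).

Lemma smooth_plateau n : smooth (plateau n).
Proof.
apply: smooth_sub; first exact: smooth_cst.
apply: smooth_mul; first exact: smooth_cst.
apply: smooth_flat; apply: smooth_sub; first exact: smooth_cst.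
exact: smooth_chi.
Qed.

Lemma test_plateau n : test_function Om (plateau n).
Proof.
split; first exact: smooth_plateau.
exists (chi_supp rho n); split.
- exact: compact_chi_supp.
- exact: chi_supp_disk.
- move=> x /chi0 h; rewrite /plateau h subr0 mulVf ?subrr//.
  by rewrite gt_eqF// flat_gt0// flat_gt0.
Qed.

Lemma plateau1 n x : 2 <= n%:R * (rho ^+ 2 - sqn x) -> plateau n x = 1.
Proof.
move=> h; rewrite /plateau [flat 0 (_ - _)]flat_le0 ?mulr0 ?subr0//.
rewrite subr_le0 /chi /flat ltr01 ifT; last by lra.
rewrite !mul1r ler_expR lerN2 invr1 invf_le1; lra.
Qed.

Lemma plateau_near K : compact K -> K `<=` Om ->
  exists n, forall x, K x -> plateau n x = 1.
Proof.
move=> cK KO; have [K0|/set0P K0] := eqVneq K set0.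
  by exists 0%N => x; rewrite K0.
have [|c Kc cmax] := @compact_EVT_max _ R (@sqn R) K K0 cK.
  by apply: continuous_subspaceT; apply: smooth_cont; exact: smooth_sqn.
have := KO c; rewrite inE in Kc; move/(_ Kc); rewrite diskE//= => hc.
have d0 : 0 < rho ^+ 2 - sqn c by rewrite subr_gt0.
pose n := (Num.truncn (2 / (rho ^+ 2 - sqn c))).+1.
exists n => x Kx; apply: plateau1.
have h : 2 / (rho ^+ 2 - sqn c) <= n%:R.
  by rewrite ltW// /n truncnS_gt.
rewrite ler_pdivrMr// in h; apply: (le_trans h); apply: ler_wpM2l => //.
by rewrite lerD2l lerN2; apply: cmax; rewrite inE.
Qed.

End plateau.

Section mean_curvature_function.
Variable R : realType.

(** [flux q] is the first component of the nonlinear flux q / sqrt(1 + |q|^2); by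
    symmetry the second one is [flux (q.2, q.1)]. *)
Definition slope (q : R * R) : R := Num.sqrt (1 + (q.1 ^+ 2 + q.2 ^+ 2)).
Definition flux (q : R * R) : R := q.1 / slope q.
(** The partial derivatives of [flux]. *)
Definition flux1 (q : R * R) : R := (1 + q.2 ^+ 2) / slope q ^+ 3.
Definition flux2 (q : R * R) : R := - (q.1 * q.2) / slope q ^+ 3.

Lemma slope_ge1 q : 1 <= slope q.
Proof.
rewrite /slope -[leLHS]sqrtr1 ler_wsqrtr// lerDl addr_ge0// sqr_ge0//.
Qed.

Lemma slope_gt0 q : 0 < slope q. Proof. exact: lt_le_trans (slope_ge1 q). Qed.

Lemma slope2 q : slope q ^+ 2 = 1 + (q.1 ^+ 2 + q.2 ^+ 2).
Proof. by rewrite sqr_sqrtr// addr_ge0// addr_ge0// sqr_ge0. Qed.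

Lemma flux_le1 q : `|flux q| <= 1.
Proof.
rewrite /flux normrM normfV (gtr0_norm (slope_gt0 q)) ler_pdivrMr ?slope_gt0// mul1r.
rewrite -sqrtr_sqr ler_wsqrtr//; nra.
Qed.

Lemma slope3_ge q : slope q ^+ 2 <= slope q ^+ 3.
Proof. by rewrite [leRHS]exprS ler_peMl ?slope_ge1// sqr_ge0. Qed.

Lemma flux1_le1 q : `|flux1 q| <= 1.
Proof.
have s3 : 0 < slope q ^+ 3 by rewrite exprn_gt0// slope_gt0.
rewrite /flux1 normrM normfV (gtr0_norm s3) ler_pdivrMr// mul1r.
apply: le_trans (slope3_ge q); rewrite slope2 ger0_norm ?addr_ge0 ?sqr_ge0//.
by rewrite lerD2l lerDr sqr_ge0.
Qed.

Lemma flux2_le1 q : `|flux2 q| <= 1.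
Proof.
have s3 : 0 < slope q ^+ 3 by rewrite exprn_gt0// slope_gt0.
rewrite /flux2 normrM normfV (gtr0_norm s3) ler_pdivrMr// mul1r normrN.
apply: le_trans (slope3_ge q); rewrite slope2 ler_norml; apply/andP; split; nra.
Qed.

Lemma continuous_slope : continuous (@slope : R * R -> R).
Proof.
move=> q; apply: (@continuous_comp _ _ _ (fun q : R * R => 1 + (q.1 ^+ 2 + q.2 ^+ 2)) Num.sqrt).
  apply: (@smooth_cont R (fun q : R * R => 1 + sqn q)).
  by apply: smooth_add; [exact: smooth_cst|exact: smooth_sqn].
exact: sqrt_continuous.
Qed.

Lemma continuous_divr (f h : R * R -> R) : continuous f -> continuous h ->
  (forall x, h x != 0) -> continuous (fun x => f x / h x).
Proof. by move=> cf ch h0 x; apply: cvgM; [exact: cf|apply: cvgV; [exact: h0|exact: ch]]. Qed.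

Lemma continuous_slope3 : continuous (fun q : R * R => slope q ^+ 3).
Proof.
move=> q; apply: (@continuous_comp _ _ _ slope (fun z : R => z ^+ 3)).
  exact: continuous_slope.
exact: exprn_continuous.
Qed.

Lemma slope3_neq0 q : slope q ^+ 3 != 0.
Proof. by rewrite gt_eqF// exprn_gt0// slope_gt0. Qed.

Lemma continuous_flux : continuous flux.
Proof.
apply: continuous_divr; [exact: (smooth_cont (@smooth_fst R))|exact: continuous_slope|].
by move=> x; rewrite gt_eqF// slope_gt0.
Qed.

Lemma continuous_flux1 : continuous flux1.
Proof.
apply: continuous_divr; last exact: slope3_neq0; last exact: continuous_slope3.
apply: (@smooth_cont R); have -> : (fun x : R * R => 1 + x.2 ^+ 2) = (fun x => 1 + x.2 * x.2).
  by apply/funext => x; rewrite expr2.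
apply: smooth_add; first exact: smooth_cst.
by apply: smooth_mul; exact: smooth_snd.
Qed.

Lemma continuous_flux2 : continuous flux2.
Proof.
apply: continuous_divr; last exact: slope3_neq0; last exact: continuous_slope3.
apply: (@smooth_cont R).
have -> : (fun x : R * R => - (x.1 * x.2)) = (fun x => (- 1) * (x.1 * x.2)).
  by apply/funext => x; rewrite mulN1r.
apply: smooth_mul; first exact: smooth_cst.
by apply: smooth_mul; [exact: smooth_fst|exact: smooth_snd].
Qed.

Lemma flux_chain (V1 V2 : R -> R) (t d1 d2 : R) :
  is_derive t (1:R) V1 d1 -> is_derive t (1:R) V2 d2 ->
  is_derive t (1:R) (fun t => flux (V1 t, V2 t))
    (flux1 (V1 t, V2 t) * d1 + flux2 (V1 t, V2 t) * d2).
Proof.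
move=> H1 H2.
pose q : R * R := (V1 t, V2 t).
have S1 : is_derive t (1:R) (fun t => 1 + (V1 t * V1 t + V2 t * V2 t))
    (2 * (V1 t * d1 + V2 t * d2)).
  have H := is_deriveD (is_derive_cst (1:R) t (1:R)) (is_deriveD (is_deriveM H1 H1) (is_deriveM H2 H2)).
  by apply: (is_derive_eq H); rewrite /GRing.scale /=; ring.
have e2 z : 1 + (V1 z * V1 z + V2 z * V2 z) = 1 + (V1 z ^+ 2 + V2 z ^+ 2) by rewrite !expr2.
have p0 : 0 < 1 + (V1 t * V1 t + V2 t * V2 t).
  by rewrite e2 -(slope2 q) exprn_gt0// slope_gt0.
have S2 := @is_derive1_comp R Num.sqrt (fun t => 1 + (V1 t * V1 t + V2 t * V2 t)) t _ _
  (is_derive1_sqrt p0) S1.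
have sE : Num.sqrt (1 + (V1 t * V1 t + V2 t * V2 t)) = slope q by rewrite e2.
have s0 : (Num.sqrt \o (fun t => 1 + (V1 t * V1 t + V2 t * V2 t))) t != 0.
  by rewrite /= sE gt_eqF// slope_gt0.
have S3 := is_deriveM H1 (is_deriveV s0 S2).
have -> : (fun t => flux (V1 t, V2 t)) =
   V1 * (fun y => ((Num.sqrt \o (fun t => 1 + (V1 t * V1 t + V2 t * V2 t))) y)^-1).
  by apply/funext => z; rewrite /flux /slope /= -e2.
apply: (is_derive_eq S3).
rewrite /GRing.scale /= sE /flux1 /flux2 -/q /=.
have sq := slope2 q; rewrite /= in sq.
have h0 : slope q != 0 by rewrite gt_eqF// slope_gt0.
have -> : 1 + V2 t ^+ 2 = slope q ^+ 2 - V1 t ^+ 2 by rewrite sq; ring.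
field; exact: h0.
Qed.

End mean_curvature_function.

Section local_chain.
Variables (R : realType) (rho : R).
Hypothesis rho0 : 0 < rho.
Notation plane := (measurableTypeR R * measurableTypeR R)%type.
Notation Om := (disk rho).
Implicit Types (phi psi : R * R -> R) (d : bool).

(** Both coordinate directions are handled at once: [true] is the first. *)
Definition pdd d : (R * R -> R) -> R * R -> R := if d then @pd1 R else @pd2 R.

Lemma pdd_pd d phi : pdd d phi = pd d (~~ d) phi. Proof. by case: d. Qed.

Lemma smooth_pdd d phi : smooth phi -> smooth (pdd d phi).
Proof. by case: d; [exact: smooth_pd1|exact: smooth_pd2]. Qed.

Lemma test_pdd d phi : test_function Om phi -> test_function Om (pdd d phi).
Proof. by case: d; [exact: test_pd1|exact: test_pd2]. Qed.

Lemma pddM d phi psi : smooth phi -> smooth psi ->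
  pdd d (fun x => phi x * psi x) = (fun x => phi x * pdd d psi x + psi x * pdd d phi x).
Proof.
move=> s1 s2; case: d.
  by apply: pd1M; exact: smooth_D1.
by apply: pd2M; exact: smooth_D2.
Qed.

Lemma near_cst_pdd d phi c x : (\near x, phi x = c) -> smooth phi -> pdd d phi x = 0.
Proof.
move=> h sp.
have s : pdd d (fun x => phi x - c) x = pdd d phi x.
  have E : (fun x => phi x - c) = (fun x => phi x + (cst (- c) : R * R -> R) x) by [].
  have sc := @smooth_cst R (- c).
  rewrite E; case: d; rewrite /pdd.
    rewrite (pd1D (smooth_D1 sp) (smooth_D1 sc)).
    rewrite [pd1 (cst _)](_ : _ = cst 0) ?addr0//.
    by apply/funext => z; apply: pd1P; exact: (is_derive_cst (- c)).
  rewrite (pd2D (smooth_D2 sp) (smooth_D2 sc)).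
  rewrite [pd2 (cst _)](_ : _ = cst 0) ?addr0//.
  by apply/funext => z; apply: pd2P; exact: (is_derive_cst (- c)).
rewrite -s; have h' : \near x, phi x - c = 0 by apply: filterS h => z ->; rewrite subrr.
by case: d {s}; [exact: near0_pd1|exact: near0_pd2].
Qed.

Lemma wderiv_int d u g phi : is_wderiv Om d (~~ d) u g -> test_function Om phi ->
  \int[leb2 R]_x (u x * pdd d phi x) = - \int[leb2 R]_x (g x * phi x).
Proof.
move=> [_ _ H] tp; have := H _ tp; rewrite -pdd_pd.
rewrite (Rintegral_test _ tp) (Rintegral_test _ (test_pdd d tp)) => ->.
by case: d {H}; rewrite expr1 mulN1r.
Qed.

(** For the second direction, swap the coordinates. *)
Lemma weak_chain_rule_dir d (g ga gb : R * R -> R) (C M : R) (v1 v2 a1 a2 : R * R -> R) :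
  (forall (V1 V2 : R -> R) (t d1 d2 : R),
    is_derive t (1:R) V1 d1 -> is_derive t (1:R) V2 d2 ->
    is_derive t (1:R) (fun t => g (V1 t, V2 t))
      (ga (V1 t, V2 t) * d1 + gb (V1 t, V2 t) * d2)) ->
  continuous g -> continuous ga -> continuous gb ->
  (forall x, `|g x| <= C) -> (forall x, `|ga x| <= C) -> (forall x, `|gb x| <= C) ->
  0 < M ->
  (leb2 R).-integrable setT (EFin \o v1) -> (leb2 R).-integrable setT (EFin \o v2) ->
  (leb2 R).-integrable setT (EFin \o a1) -> (leb2 R).-integrable setT (EFin \o a2) ->
  bsupp M v1 -> bsupp M v2 -> bsupp M a1 -> bsupp M a2 ->
  (forall phi, smooth phi ->
    \int[leb2 R]_x (v1 x * pdd d phi x) = - \int[leb2 R]_x (a1 x * phi x)) ->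
  (forall phi, smooth phi ->
    \int[leb2 R]_x (v2 x * pdd d phi x) = - \int[leb2 R]_x (a2 x * phi x)) ->
  forall N phi, N < M -> smooth phi -> bsupp N phi ->
  \int[leb2 R]_x (g (v1 x, v2 x) * pdd d phi x) =
  - \int[leb2 R]_x ((ga (v1 x, v2 x) * a1 x + gb (v1 x, v2 x) * a2 x) * phi x).
Proof.
move=> chain cg cga cgb gC gaC gbC M0 v1i v2i a1i a2i v1M v2M a1M a2M w1 w2 N phi NM sp bp.
case: d w1 w2 => w1 w2; first exact: (weak_chain_rule chain cg cga cgb gC gaC gbC M0 v1i v2i a1i a2i v1M v2M a1M a2M w1 w2 NM sp bp).
have bpM : bsupp M phi by move=> x h; apply: bp; case: h => h; [left|right]; exact: lt_trans h.
have [B B0 pB'] := continuous_box_bounded M (smooth_cont sp).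
have pB x : `|phi x| <= B.
  by have [/pB'//|bx] := pselect (box M x); rewrite (bsupp_box bpM bx) normr0.
have weak v a : (leb2 R).-integrable setT (EFin \o v) -> bsupp M v ->
    (leb2 R).-integrable setT (EFin \o a) -> bsupp M a ->
    (forall phi, smooth phi ->
      \int[leb2 R]_x (v x * pdd false phi x) = - \int[leb2 R]_x (a x * phi x)) ->
    forall psi, smooth psi ->
      \int[leb2 R]_x (v (swp x) * pd1 psi x) = - \int[leb2 R]_x (a (swp x) * psi x).
  move=> vi vM ai aM w psi spsi.
  have cut f k : (leb2 R).-integrable setT (EFin \o f) -> bsupp M f -> continuous k ->
      (leb2 R).-integrable setT (EFin \o (fun x => f x * k x)).
    move=> fi fM ck; have [D D0 kD] := continuous_box_bounded M ck.
    apply: (Rint_le measurableT _ _ (RintZ D measurableT (Rint_norm fi))).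
      by apply: measurable_funM; [exact: Rint_measurable fi|exact: continuous_measurable_plane].
    move=> x _; rewrite normrM mulrC; have [bx|bx] := pselect (box M x).
      by apply: ler_wpM2r => //; exact: kD.
    by rewrite (bsupp_box fM bx) normr0 !mulr0.
  have ss := smooth_swp spsi.
  have i1 := cut _ _ vi vM (smooth_cont (smooth_pd2 ss)).
  have i2 := cut _ _ ai aM (smooth_cont ss).
  have := w _ ss; rewrite /pdd -(Rintegral_swp i1) -(Rintegral_swp i2) pd2_swp /=.
  have e (x : R * R) : swp (swp x) = x by exact: swpK.
  under eq_Rintegral do rewrite e.
  by under [X in _ = - X]eq_Rintegral do rewrite e.
have W1 := weak _ _ v1i v1M a1i a1M w1; have W2 := weak _ _ v2i v2M a2i a2M w2.
have E := weak_chain_rule chain cg cga cgb gC gaC gbC M0 (Rint_swp v1i) (Rint_swp v2i)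
  (Rint_swp a1i) (Rint_swp a2i) (bsupp_swp v1M) (bsupp_swp v2M) (bsupp_swp a1M) (bsupp_swp a2M)
  W1 W2 NM (smooth_swp sp) (bsupp_swp bp).
have i2 := weak_chain_int cga cgb gaC gbC v1i v2i a1i a2i sp pB.
have i1 : (leb2 R).-integrable setT (EFin \o (fun x => g (v1 x, v2 x) * pd2 phi x)).
  under eq_fun do rewrite mulrC.
  apply: (@Rint_mul_bounded _ _ _ _ _ _ _ C) => //.
    by apply: (Rint_cont_bsupp _ (bsupp_pd2 bpM)); apply: smooth_cont; exact: smooth_pd2.
  exact: (measurable_comp2 v1i v2i cg).
by rewrite -(Rintegral_swp i1) -(Rintegral_swp i2); exact: E.
Qed.

Lemma measurable_on_comp2 (v1 v2 G : R * R -> R) : continuous G ->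
  measurable_fun (Om : set plane) v1 -> measurable_fun (Om : set plane) v2 ->
  measurable_fun (Om : set plane) (fun x => G (v1 x, v2 x)).
Proof.
move=> cG m1 m2; have mO : measurable (Om : set plane) := measurable_disk rho0.
have p1 := (measurable_restrictT v1 mO).1 m1.
have p2 := (measurable_restrictT v2 mO).1 m2.
apply: (eq_measurable_fun (fun x => G ((v1 \_ Om) x, (v2 \_ Om) x))).
  by move=> x xO; rewrite !patchE xO.
apply: measurable_funTS; apply: (measurableT_comp (continuous_measurable_plane cG)).
exact: measurable_fun_pair.
Qed.

(** The problem is localized with a cutoff equal to 1 on the support of the test
    function, where its derivative does not contribute. *)
Lemma is_wderiv_chain d (g ga gb : R * R -> R) (C : R) (v1 v2 a1 a2 : R * R -> R) :
  (forall (V1 V2 : R -> R) (t d1 d2 : R),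
    is_derive t (1:R) V1 d1 -> is_derive t (1:R) V2 d2 ->
    is_derive t (1:R) (fun t => g (V1 t, V2 t))
      (ga (V1 t, V2 t) * d1 + gb (V1 t, V2 t) * d2)) ->
  continuous g -> continuous ga -> continuous gb ->
  (forall x, `|g x| <= C) -> (forall x, `|ga x| <= C) -> (forall x, `|gb x| <= C) ->
  is_wderiv Om d (~~ d) v1 a1 -> is_wderiv Om d (~~ d) v2 a2 ->
  is_wderiv Om d (~~ d) (fun x => g (v1 x, v2 x))
    (fun x => ga (v1 x, v2 x) * a1 x + gb (v1 x, v2 x) * a2 x).
Proof.
move=> chain cg cga cgb gC gaC gbC W1 W2.
have [l1 k1 _] := W1; have [l2 k2 _] := W2.
have mO : measurable (Om : set plane) := measurable_disk rho0.
have mG (G : R * R -> R) : continuous G ->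
    measurable_fun (Om : set plane) (fun x => G (v1 x, v2 x)).
  by move=> cG; apply: measurable_on_comp2 => //; [exact: l1.1|exact: l2.1].
split.
- split; first exact: mG.
  move=> K cK KO; apply: (@Rint_bounded _ _ _ _ _ _ C) => //.
  + exact: measurable_compact_plane.
  + apply: le_lt_trans (disk_lty rho0); apply: le_measure => //; rewrite ?inE//.
    exact: measurable_compact_plane.
  + by apply: measurable_funS (mG _ cg).
- split.
    by apply: measurable_funD; apply: measurable_funM;
      [exact: mG|exact: k1.1|exact: mG|exact: k2.1].
  move=> K cK KO; have mK := measurable_compact_plane cK.
  apply: RintD => //; under eq_fun do rewrite mulrC.
    apply: (@Rint_mul_bounded _ _ _ _ _ _ _ C) => //; first exact: k1.2.
    exact: measurable_funS (mG _ cga).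
  apply: (@Rint_mul_bounded _ _ _ _ _ _ _ C) => //; first exact: k2.2.
  exact: measurable_funS (mG _ cgb).
move=> phi tp; rewrite -pdd_pd.
rewrite (Rintegral_test _ tp) (Rintegral_test _ (test_pdd d tp)).
have -> : (-1) ^+ (d + ~~ d) = -1 :> R by case: d {W1 W2}; rewrite expr1.
rewrite mulN1r.
have [sp [K [cK KO phi0]]] := tp.
have [n chi1] := plateau_near rho0 cK KO.
set X := plateau rho n in chi1.
have tX : test_function Om X by exact: test_plateau.
have sX := tX.1; have tdX := test_pdd d tX.
have oK : open (~` K) by apply: closed_openC; exact: compact_closed (@plane_hausdorff R) cK.
have dphi0 x : ~ K x -> pdd d phi x = 0.
  move=> Kx; have h : \near x, phi x = 0 by apply: filterS (oK x Kx) => y; exact: phi0.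
  by case: (d); [exact: near0_pd1|exact: near0_pd2].
have dX0 x : phi x != 0 -> pdd d X x = 0.
  move=> px; apply: (@near_cst_pdd d X 1 x) => //.
  have cphi : {for x, continuous phi} by exact: (smooth_cont sp).
  have : \near x, phi x != 0 by apply: (cvgr_neq0 _ cphi).
  by apply: filterS => z pz; apply: chi1; apply: contrapT => /phi0/eqP; apply/negP.
pose tv (v : R * R -> R) x := v x * X x.
pose ta (v a : R * R -> R) x := a x * X x + v x * pdd d X x.
have M0 : 0 < rho + 1 by rewrite addr_gt0.
have NM : rho < rho + 1 by rewrite ltrDl.
have bX f : test_function Om f -> bsupp (rho + 1) f.
  by move=> tf x h; apply: (test_bsupp rho0 tf); case: h => h; [left|right]; exact: lt_trans h.
have props v a : is_wderiv Om d (~~ d) v a ->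
   [/\ (leb2 R).-integrable setT (EFin \o tv v), (leb2 R).-integrable setT (EFin \o ta v a),
       bsupp (rho + 1) (tv v), bsupp (rho + 1) (ta v a) &
       forall psi, smooth psi ->
        \int[leb2 R]_x (tv v x * pdd d psi x) = - \int[leb2 R]_x (ta v a x * psi x)].
  move=> W; have [lv la _] := W.
  have i1 := L1loc_test_int rho0 la tX; have i2 := L1loc_test_int rho0 lv tdX.
  split.
  - exact: (L1loc_test_int rho0 lv tX).
  - exact: RintD.
  - by move=> x h; rewrite /tv (bX _ tX)// mulr0.
  - by move=> x h; rewrite /ta (bX _ tX)// (bX _ tdX)// !mulr0 addr0.
  - move=> psi spsi.
    have tXp := test_mul tX spsi.
    have j1 := L1loc_test_int rho0 lv (test_mul tX (smooth_pdd d spsi)).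
    have j2 := L1loc_test_int rho0 lv (test_mul tdX spsi).
    have j3 := L1loc_test_int rho0 la tXp.
    have := wderiv_int W tXp; rewrite (pddM d sX spsi) => E.
    have E1 : \int[leb2 R]_x (v x * (X x * pdd d psi x + psi x * pdd d X x)) =
       \int[leb2 R]_x (v x * (X x * pdd d psi x)) + \int[leb2 R]_x (v x * (pdd d X x * psi x)).
      rewrite -(RintegralD measurableT j1 j2); apply: eq_Rintegral => x _; ring.
    have E2 : \int[leb2 R]_x (ta v a x * psi x) =
       \int[leb2 R]_x (a x * (X x * psi x)) + \int[leb2 R]_x (v x * (pdd d X x * psi x)).
      rewrite -(RintegralD measurableT j3 j2); apply: eq_Rintegral => x _; rewrite /ta; ring.
    rewrite E2 opprD -E E1 addrK.
    by apply: eq_Rintegral => x _; rewrite /tv mulrA.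
have [v1i a1i v1M a1M w1] := props _ _ W1.
have [v2i a2i v2M a2M w2] := props _ _ W2.
have := weak_chain_rule_dir chain cg cga cgb gC gaC gbC M0 v1i v2i a1i a2i v1M v2M a1M a2M
  w1 w2 NM sp (test_bsupp rho0 tp).
have -> : \int[leb2 R]_x (g (tv v1 x, tv v2 x) * pdd d phi x) =
    \int[leb2 R]_x (g (v1 x, v2 x) * pdd d phi x).
  apply: eq_Rintegral => x _; have [Kx|Kx] := pselect (K x).
    by rewrite /tv chi1// !mulr1.
  by rewrite dphi0// !mulr0.
move=> ->; congr (- _); apply: eq_Rintegral => x _.
have [->|px] := eqVneq (phi x) 0; first by rewrite !mulr0.
have Kx : K x by apply: contrapT => /phi0 h; rewrite h eqxx in px.
by rewrite /tv /ta chi1// (dX0 _ px) !mulr0 !addr0 !mulr1.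
Qed.

End local_chain.

(** * Passing to test functions that do not vanish at the boundary *)

Section boundary.
Variables (R : realType) (rho : R).
Hypothesis rho0 : 0 < rho.
Notation plane := (measurableTypeR R * measurableTypeR R)%type.
Notation Om := (disk rho).
Implicit Types (h p q U : R * R -> R) (x : R * R).

Lemma wDP a b u g : is_wderiv Om a b u g -> is_wderiv Om a b u (wD Om a b u).
Proof. by move=> H; have := @xgetPex _ (cst 0) [set g | is_wderiv Om a b u g]; apply; exists g. Qed.

Lemma test_int_disk g phi : L1loc Om g -> test_function Om phi ->
  (leb2 R).-integrable Om (EFin \o (fun x => g x * phi x)).
Proof.
move=> lg tp; exact: (integrableS measurableT (measurable_disk rho0) (@subsetT _ _)
  (L1loc_test_int rho0 lg tp)).
Qed.

Lemma smooth_disk_bounded f : smooth f -> exists2 C, 0 <= C & forall x, Om x -> `|f x| <= C.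
Proof.
move=> sf; have [C C0 HC] := continuous_box_bounded rho (smooth_cont sf).
by exists C => // x /(disk_box rho0); exact: HC.
Qed.

Lemma smooth_disk_measurable f : smooth f -> measurable_fun (Om : set plane) f.
Proof. by move=> sf; apply: measurable_funTS; exact: smooth_measurable. Qed.

Lemma smooth_mul_integrable f g : (leb2 R).-integrable Om (EFin \o f) -> smooth g ->
  (leb2 R).-integrable Om (EFin \o (fun x => f x * g x)).
Proof.
move=> fi sg; have [C _ HC] := smooth_disk_bounded sg.
by apply: (@Rint_mul_bounded _ _ _ _ _ _ _ C) => //; [exact: measurable_disk|exact: smooth_disk_measurable].
Qed.

Lemma cvg_integral_chi f : (leb2 R).-integrable Om (EFin \o f) ->
  \int[leb2 R]_(x in Om) (f x * chi rho n x) @[n --> \oo] --> \int[leb2 R]_(x in Om) f x.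
Proof.
move=> fi; have mO : measurable (Om : set plane) := measurable_disk rho0.
have [] // := @Rdominated_cvg _ _ _ (leb2 R) Om
  (fun n x => f x * chi rho n x) f (fun x => `|f x|) mO.
- move=> n; apply: measurable_funM; first exact: Rint_measurable fi.
  by apply: smooth_disk_measurable; exact: smooth_chi.
- move=> x Ox; rewrite -[X in _ --> X]mulr1; apply: cvgM; first exact: cvg_cst.
  exact: cvg_chi.
- exact: Rint_norm fi.
- by move=> n x _; rewrite normrM ler_piMr// chi_norm.
Qed.

Lemma slopeC (a b : R) : slope (a, b) = slope (b, a).
Proof. by rewrite /slope /= [X in 1 + X]addrC. Qed.

(** By [is_wderiv_chain] the two weak derivatives of the flux in [Fop] are genuine
    ones and not the default value of [wD]. *)
Lemma flux_weak al h phi :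
  (forall a b, (a + b <= 2)%N -> is_wderiv Om a b h (wD Om a b h)) ->
  ae_eq_on Om (Fop rho al h) (cst 0) -> test_function Om phi ->
  \int[leb2 R]_(x in Om) (flux (wD Om 1 0 h x, wD Om 0 1 h x) * pd1 phi x)
  + \int[leb2 R]_(x in Om) (flux (wD Om 0 1 h x, wD Om 1 0 h x) * pd2 phi x)
  = al * \int[leb2 R]_(x in Om) (h x * phi x).
Proof.
move=> H F0 tp.
set p := wD Om 1 0 h; set q := wD Om 0 1 h.
pose V1 := (fun x => flux (p x, q x)); pose V2 := (fun x => flux (q x, p x)).
have p1 := wderiv_11 rho0 (H 1 0 isT)%N (H 2 0 isT)%N.
have q1 := wderiv_21 rho0 (H 0 1 isT)%N (H 1 1 isT)%N.
have p2 := wderiv_12 rho0 (H 1 0 isT)%N (H 1 1 isT)%N.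
have q2 := wderiv_22 rho0 (H 0 1 isT)%N (H 0 2 isT)%N.
have chain := @flux_chain R.
have D1 : is_wderiv Om 1 0 V1 (wD Om 1 0 V1).
  apply: wDP; exact: (@is_wderiv_chain R rho rho0 true (@flux R) (@flux1 R) (@flux2 R) 1 p q _ _ chain
   (@continuous_flux R) (@continuous_flux1 R) (@continuous_flux2 R) (@flux_le1 R) (@flux1_le1 R) (@flux2_le1 R) p1 q1).
have D2 : is_wderiv Om 0 1 V2 (wD Om 0 1 V2).
  apply: wDP; exact: (@is_wderiv_chain R rho rho0 false (@flux R) (@flux1 R) (@flux2 R) 1 q p _ _ chain
   (@continuous_flux R) (@continuous_flux1 R) (@continuous_flux2 R) (@flux_le1 R) (@flux1_le1 R) (@flux2_le1 R) q2 p2).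
have wE x : Num.sqrt (1 + enorm (p x, q x) ^+ 2) = slope (p x, q x).
  by rewrite /enorm /slope sqr_sqrtr// addr_ge0// sqr_ge0.
have f1 : (fun z => p z / Num.sqrt (1 + enorm (p z, q z) ^+ 2)) = V1.
  by apply/funext => z; rewrite wE.
have f2 : (fun z => q z / Num.sqrt (1 + enorm (p z, q z) ^+ 2)) = V2.
  by apply/funext => z; rewrite wE slopeC.
have FE x : Fop rho al h x = wD Om 1 0 V1 x + wD Om 0 1 V2 x + al * h x.
  by rewrite -f1 -f2.
have [l1 k1 E1] := D1; have [l2 k2 E2] := D2.
have mO : measurable (Om : set plane) := measurable_disk rho0.
have lh : L1loc Om h by have [] := H 1%N 0%N isT.
have i1 := test_int_disk k1 tp; have i2 := test_int_disk k2 tp; have i3 := test_int_disk lh tp.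
have e1 := E1 _ tp; have e2 := E2 _ tp.
rewrite expr1 mulN1r in e1; rewrite expr1 mulN1r in e2.
apply: (etrans (congr2 (fun y z => y + z) e1 e2)).
rewrite -opprD -(RintegralD mO i1 i2) -(RintegralZl _ mO i3).
rewrite -[LHS]mulN1r -(RintegralZl _ mO (RintD mO i1 i2)).
apply: ae_eq_Rintegral => //.
- by apply: measurable_funM => //; exact: Rint_measurable (RintD mO i1 i2).
- by apply: measurable_funM => //; exact: Rint_measurable i3.
apply: ae_mono F0 => x F0x Ox; have := F0x Ox; rewrite FE /= => E.
have -> : al * (h x * phi x) = al * h x * phi x by rewrite mulrA.
have -> : al * h x = - (wD Om 1 0 V1 x + wD Om 0 1 V2 x) by apply/eqP; rewrite -addr_eq0 addrC E.
by rewrite mulN1r mulNr mulrDl.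
Qed.

Lemma pd_chi1 n x : pd1 (chi rho n) x =
  - (2 * n%:R * flat 2 (n%:R * (rho ^+ 2 - sqn x) + (- 1)) * x.1).
Proof.
have s := @smooth_chi_arg R rho n.
have E := pd1_comp (@derivable_flat R 0) (smooth_D1 s).
have -> : chi rho n = flat 0 \o (fun x => n%:R * (rho ^+ 2 - sqn x) + (- 1)) by [].
rewrite E derive1_flat mul0r subr0.
suff -> : pd1 (fun x => n%:R * (rho ^+ 2 - sqn x) + (- 1)) x = - (2 * n%:R * x.1) by ring.
apply: pd1P => /=.
have sq : is_derive x.1 (1:R) (fun t => sqn (t, x.2)) (2 * x.1).
  have H := is_deriveD (is_deriveM (is_derive_id x.1 (1:R)) (is_derive_id x.1 (1:R)))
     (is_derive_cst (x.2 ^+ 2) x.1 (1:R)).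
  have -> : (fun t => sqn (t, x.2)) = (id * id + cst (x.2 ^+ 2)).
    by apply/funext => t; rewrite /sqn /= expr2.
  by apply: (is_derive_eq H); rewrite /GRing.scale /=; ring.
have H := is_deriveD (is_deriveZ n%:R (is_deriveB (is_derive_cst (rho ^+ 2) x.1 (1:R)) sq))
  (is_derive_cst (-1 : R) x.1 (1:R)).
by apply: (is_derive_eq H); rewrite /GRing.scale /=; ring.
Qed.

Lemma chi_swp n : chi rho n \o @swp R = chi rho n.
Proof. by apply/funext => x; rewrite /chi /sqn /= addrC [x.2 ^+ 2 + _]addrC addrC. Qed.

Lemma pd_chi2 n x : pd2 (chi rho n) x =
  - (2 * n%:R * flat 2 (n%:R * (rho ^+ 2 - sqn x) + (- 1)) * x.2).
Proof.
rewrite -(chi_swp n) pd2_swp /= pd_chi1; do 3 congr (_ _).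
by rewrite /sqn /= [x.2 ^+ 2 + _]addrC.
Qed.

(** The part of the gradient of the cutoff that remains once a factor vanishing
    linearly at the boundary is taken out. *)
Definition bdry_weight n x :=
  flat 1 (n%:R * (rho ^+ 2 - sqn x) + (- 1)) + flat 2 (n%:R * (rho ^+ 2 - sqn x) + (- 1)).

Lemma bdry_weightE n x : n%:R * flat 2 (n%:R * (rho ^+ 2 - sqn x) + (- 1)) * (rho ^+ 2 - sqn x) =
  bdry_weight n x.
Proof. by rewrite /bdry_weight -[flat 1 _]flat_mulS; ring. Qed.

Lemma bdry_weight_ge0 n x : 0 <= bdry_weight n x.
Proof. by rewrite addr_ge0// flat_ge0. Qed.

Lemma bdry_weight_le3 n x : bdry_weight n x <= 3.
Proof.
have h1 := @flat_le R 0 (n%:R * (rho ^+ 2 - sqn x) + (- 1)).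
have h2 := @flat_le R 1 (n%:R * (rho ^+ 2 - sqn x) + (- 1)).
rewrite /= in h1 h2; rewrite /bdry_weight; apply: (le_trans (lerD h1 h2)).
by rewrite -natrD.
Qed.

Lemma cvg_bdry_weight x : Om x -> bdry_weight n x @[n --> \oo] --> (0:R).
Proof.
rewrite diskE// => /= hx; have d0 : 0 < rho ^+ 2 - sqn x by rewrite subr_gt0.
have c1 := @cvg_flat R 1 _ (-1) d0; have c2 := @cvg_flat R 2 _ (-1) d0.
have c := cvgD c1 c2; rewrite /= !mulr0n addr0 in c; exact: c.
Qed.

Lemma measurable_bdry_weight n : measurable_fun (Om : set plane) (bdry_weight n).
Proof.
apply: measurable_funTS; apply: smooth_measurable.
by apply: smooth_add; apply: smooth_flat; exact: smooth_chi_arg.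
Qed.

(** Green's identity is tested against the cutoffs times the gradient of U. The
    gradient of [chi n] is radial and of size n near the circle, but it meets
    the radial derivative of U, which vanishes linearly there: only
    [bdry_weight], bounded and tending to 0, is left of the boundary term. *)
Lemma green_helmholtz m B h p q U :
  is_wderiv Om 1 0 h p -> is_wderiv Om 0 1 h q ->
  (leb2 R).-integrable Om (EFin \o h) -> (leb2 R).-integrable Om (EFin \o p) ->
  (leb2 R).-integrable Om (EFin \o q) -> smooth U ->
  (forall x, pd1 (pd1 U) x + pd2 (pd2 U) x = - (m * U x)) ->
  (forall x, Om x -> `|x.1 * pd1 U x + x.2 * pd2 U x| <= B * (rho ^+ 2 - sqn x)) ->
  \int[leb2 R]_(x in Om) (p x * pd1 U x + q x * pd2 U x) =
  m * \int[leb2 R]_(x in Om) (h x * U x).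
Proof.
move=> W1 W2 hi pi qi sU helm bU.
have mO : measurable (Om : set plane) := measurable_disk rho0.
have s1 := smooth_pd1 sU; have s2 := smooth_pd2 sU.
have gi := RintD mO (smooth_mul_integrable pi s1) (smooth_mul_integrable qi s2).
have L1 := cvg_integral_chi gi.
have hU := smooth_mul_integrable hi sU.
have L2 := cvg_integral_chi hU.
pose K n x := 2 * n%:R * flat 2 (n%:R * (rho ^+ 2 - sqn x) + (- 1)) * (x.1 * pd1 U x + x.2 * pd2 U x).
have sK n : smooth (K n).
  apply: smooth_mul.
    apply: smooth_mul; first exact: smooth_cst.
    by apply: smooth_flat; exact: smooth_chi_arg.
  by apply: smooth_add; apply: smooth_mul => //; [exact: smooth_fst|exact: smooth_snd].
have Kb n x : Om x -> `|K n x| <= 2 * B * bdry_weight n x.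
  move=> Ox; have r0 : 0 < rho ^+ 2 - sqn x by move: Ox; rewrite diskE//= subr_gt0.
  rewrite /K normrM ger0_norm; last by rewrite !mulr_ge0// flat_ge0.
  have := ler_wpM2l _ (bU x Ox).
  move=> /(_ (2 * n%:R * flat 2 (n%:R * (rho ^+ 2 - sqn x) + (- 1)))) h'.
  apply: (le_trans (h' _)); first by rewrite !mulr_ge0// flat_ge0.
  by rewrite -bdry_weightE le_eqVlt; apply/orP; left; apply/eqP; ring.
have B0 : 0 <= B.
  have O0 : Om (0, 0) by rewrite diskE//= /sqn /= expr0n /= addr0 exprn_gt0.
  have := bU _ O0; rewrite /sqn /= !mul0r expr0n /= !addr0 normr0 subr0.
  by rewrite pmulr_lge0// exprn_gt0.
have L3 : \int[leb2 R]_(x in Om) (h x * K n x) @[n --> \oo] --> (0:R).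
  have [_] : (leb2 R).-integrable Om (EFin \o (fun x => 0 : R)) /\
    \int[leb2 R]_(x in Om) (h x * K n x) @[n --> \oo] --> \int[leb2 R]_(x in Om) (0:R).
    apply: (@Rdominated_cvg _ _ _ (leb2 R) Om (fun n x => h x * K n x)
      (fun x => 0) (fun x => (2 * B * 3) * `|h x|) mO).
    - by move=> n; apply: measurable_funM; [exact: Rint_measurable hi|exact: smooth_disk_measurable].
    - move=> x Ox; rewrite -(mulr0 (h x)); apply: cvgM; first exact: cvg_cst.
      have c0 : 2 * B * bdry_weight n x @[n --> \oo] --> (0:R).
        by rewrite -(mulr0 (2 * B)); apply: cvgM; [exact: cvg_cst|exact: cvg_bdry_weight].
      apply/cvgrPdist_le => e e0; move/cvgrPdist_le : c0 => /(_ e e0).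
      apply: filterS => n; rewrite !sub0r !normrN => h'.
      by apply: (le_trans (Kb _ _ Ox)); apply: (le_trans (ler_norm _)).
    - by apply: RintZ => //; exact: Rint_norm.
    - move=> n x Ox; rewrite normrM mulrC; apply: ler_wpM2r => //.
      apply: (le_trans (Kb _ _ Ox)); apply: ler_wpM2l; first by rewrite mulr_ge0.
      exact: bdry_weight_le3.
  by rewrite Rintegral_cst// mul0r.
have E n : \int[leb2 R]_(x in Om) ((p x * pd1 U x + q x * pd2 U x) * chi rho n x) =
    m * \int[leb2 R]_(x in Om) ((h x * U x) * chi rho n x) + \int[leb2 R]_(x in Om) (h x * K n x).
  have tc := test_chi rho0 n; have sc := tc.1.
  have t1 := test_mul tc s1; have t2 := test_mul tc s2.
  have [lh lp H1] := W1; have [_ lq H2] := W2.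
  have e1 := H1 _ t1; have e2 := H2 _ t2.
  rewrite /pd /= expr1 mulN1r in e1; rewrite /pd /= expr1 mulN1r in e2.
  have ip := test_int_disk lp t1; have iq := test_int_disk lq t2.
  transitivity (\int[leb2 R]_(x in Om) (p x * (chi rho n x * pd1 U x)) +
                \int[leb2 R]_(x in Om) (q x * (chi rho n x * pd2 U x))).
    by rewrite -(RintegralD mO ip iq); apply: eq_Rintegral => x _; ring.
  have a1 := test_int_disk lh (test_pd1 t1); have a2 := test_int_disk lh (test_pd2 t2).
  apply: oppr_inj; rewrite opprD.
  apply: (etrans (congr2 (fun y z => y + z) (esym e1) (esym e2))).
  apply: (etrans (esym (RintegralD mO a1 a2))).
  have hUc : (leb2 R).-integrable Om (EFin \o (fun x => h x * U x * chi rho n x)) by apply: smooth_mul_integrable => //; exact: smooth_chi.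
  rewrite -(RintegralZl _ mO hUc) -(RintegralD mO (RintZ _ mO hUc) (smooth_mul_integrable hi (sK n))).
  rewrite -[RHS]mulN1r -(RintegralZl _ mO (RintD mO (RintZ _ mO hUc) (smooth_mul_integrable hi (sK n)))).
  apply: eq_Rintegral => x _.
  rewrite (pd1M (smooth_D1 sc) (smooth_D1 s1)) (pd2M (smooth_D2 sc) (smooth_D2 s2)).
  rewrite pd_chi1 pd_chi2 /K.
  have -> : pd1 (pd1 U) x = - (m * U x) - pd2 (pd2 U) x by rewrite -helm addrK.
  ring.
have L4 := cvgD (cvgM (cvg_cst m) L2) L3; rewrite addr0 in L4.
apply: (cvg_unique (@Rhausdorff R) L1).
by rewrite (funext E); exact: L4.
Qed.

End boundary.

Lemma Rintegral_le_norm_ae d (T : measurableType d) (R : realType)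
    (mu : {measure set T -> \bar R}) (D : set T) (f g : T -> R) : measurable D ->
  mu.-integrable D (EFin \o f) -> mu.-integrable D (EFin \o g) ->
  {ae mu, forall x, D x -> `|f x| <= g x} ->
  `|\int[mu]_(x in D) f x| <= \int[mu]_(x in D) g x.
Proof.
move=> mD fi gi fg.
pose g' x := Num.max (g x) `|f x|.
have mg' : measurable_fun D g'.
  apply: measurable_maxr; first exact: Rint_measurable gi.
  exact: Rint_measurable (Rint_norm fi).
have gg' : ae_eq mu D g g' by apply: ae_mono fg => x h Dx; rewrite /g' max_l// h.
rewrite (ae_eq_Rintegral mD (Rint_measurable gi) mg' gg').
apply: Rintegral_le_norm => //; first exact: Rint_ae_eq gi.
by move=> x _; rewrite le_max lexx orbT.
Qed.

Section flux_boundary.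
Variables (R : realType) (rho : R).
Hypothesis rho0 : 0 < rho.
Notation plane := (measurableTypeR R * measurableTypeR R)%type.
Notation Om := (disk rho).
Implicit Types (h p q U : R * R -> R) (x : R * R).

Lemma compact_closed_disk : compact (closed_disk rho : set (R * R)).
Proof.
apply: (subclosed_compact _ (@compact_box R rho)).
  rewrite closed_diskE//.
  have -> : [set x | sqn x <= rho ^+ 2] = @sqn R @^-1` `]-oo, rho ^+ 2]%classic.
    by apply/seteqP; split => x /=; rewrite in_itv.
  have /continuous_closedP := smooth_cont (@smooth_sqn R); apply.
  exact: interval_closed.
move=> x; rewrite closed_diskE// boxP /= /sqn => hx.
have aux (t : R) : t ^+ 2 <= rho ^+ 2 -> `|t| <= rho.
  by move=> ht; rewrite -[rho]gtr0_norm// -ler_sqr ?nnegrE// !real_normK ?num_real.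
by split; apply: aux; apply: le_trans hx; rewrite ?lerDl ?lerDr ?sqr_ge0.
Qed.

(** The part of the closed disk where G is at least [e] is compact and misses the
    circle, so that |x|^2 has a maximum smaller than rho^2 on it. *)
Lemma small_near_circle (G : R * R -> R) (e : R) :
  {within closed_disk rho, continuous G} ->
  (forall x, enorm x = rho -> G x = 0) -> 0 < e ->
  exists2 d, 0 < d & forall x, Om x -> rho ^+ 2 - sqn x < d -> G x < e.
Proof.
move=> cG G0 e0.
pose B := [set x | closed_disk rho x /\ e <= G x].
have cB : compact B.
  have cl : closed (G @^-1` `[e, +oo[%classic : set (subspace (closed_disk rho))).
    by have /continuous_closedP := cG; apply; exact: interval_closed.
  have [V cV VE] := (@closed_subspaceP (R * R)%type (closed_disk rho) (G @^-1` `[e, +oo[%classic)).1 cl.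
  have -> : B = V `&` closed_disk rho.
    rewrite VE; apply/seteqP; split => x /=; rewrite /B /= in_itv /= andbT.
      by move=> [].
    by move=> [].
  apply: (subclosed_compact _ compact_closed_disk); last by move=> x [].
  apply: closedI => //; apply: compact_closed; first exact: plane_hausdorff.
  exact: compact_closed_disk.
have [BE|/set0P BN] := eqVneq B set0.
  exists 1 => // x Ox _; rewrite ltNge; apply/negP => Gx.
  have : B x by split => //; apply: ltW; exact: Ox.
  by rewrite BE.
have cs : {within B, continuous (@sqn R)}.
  by apply: continuous_subspaceT; apply: smooth_cont; exact: smooth_sqn.
have [c cinB cmax] := compact_EVT_max BN cB cs.
move: cinB; rewrite inE => -[cD cG'].
have c_lt : sqn c < rho ^+ 2.
  move: (cD); rewrite closed_diskE//= le_eqVlt => /orP[/eqP cE|//].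
  have : G c = 0 by apply: G0; rewrite /enorm -/(sqn c) cE sqrtr_sqr gtr0_norm.
  by move=> Gc; move: cG'; rewrite Gc leNgt e0.
exists (rho ^+ 2 - sqn c); first by rewrite subr_gt0.
move=> x Ox; rewrite ltrD2l ltrN2 => h; rewrite ltNge; apply/negP => Gx.
have Bx : x \in B by rewrite inE; split => //; apply: ltW; exact: Ox.
by have := cmax _ Bx; rewrite leNgt h.
Qed.

(** The gradients of the cutoffs have bounded integral, as the divergence of the
    field x shows. *)
Lemma chi_gradient_mass n :
  \int[leb2 R]_(x in Om) (2 * n%:R * flat 2 (n%:R * (rho ^+ 2 - sqn x) + (- 1)) * sqn x)
  <= 2 * fine (leb2 R Om).
Proof.
have mO : measurable (Om : set plane) := measurable_disk rho0.
have tc := test_chi rho0 n; have sc := tc.1.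
have sf := @smooth_fst R; have ss := @smooth_snd R.
have E1 := integral_by_parts1 rho0 sc sf (test_bsupp rho0 tc).
have E2 := integral_by_parts2 rho0 sc ss (test_bsupp rho0 tc).
have p1 : pd1 (fun x : R * R => x.1) = cst 1.
  by apply/funext => x; apply: pd1P => /=; exact: is_derive_id.
have p2 : pd2 (fun x : R * R => x.2) = cst 1.
  by apply/funext => x; apply: pd2P => /=; exact: is_derive_id.
rewrite p1 in E1; rewrite p2 in E2.
have t1 := test_pd1 tc; have t2 := test_pd2 tc.
have toD f psi : test_function Om psi ->
    \int[leb2 R]_x (psi x * f x) = \int[leb2 R]_(x in Om) (psi x * f x).
  move=> tp; rewrite [RHS]Rintegral_mkcond; apply: eq_Rintegral => x _.
  rewrite patchE; case: ifPn => //; rewrite notin_setE => hx.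
  by rewrite (test_out tp hx) mul0r.
have intD psi f : test_function Om psi -> smooth f ->
    (leb2 R).-integrable Om (EFin \o (fun x => psi x * f x)).
  move=> tp sf'; have l := L1loc_continuous rho0 (smooth_cont sf').
  by have := test_int_disk rho0 l tp; congr (_.-integrable _ _); apply/funext => x /=; rewrite mulrC.
have s1 : smooth (fun _ : R * R => 1 : R) by exact: smooth_cst.
have j1 : (leb2 R).-integrable Om (EFin \o (fun x => pd1 (chi rho n) x * x.1)) by exact: intD.
have j2 : (leb2 R).-integrable Om (EFin \o (fun x => pd2 (chi rho n) x * x.2)) by exact: intD.
have j0 : (leb2 R).-integrable Om (EFin \o (fun x => chi rho n x * 1)) by exact: (intD _ _ tc s1).
rewrite (toD _ _ t1) (toD _ _ tc) in E1; rewrite (toD _ _ t2) (toD _ _ tc) in E2.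
have -> : \int[leb2 R]_(x in Om) (2 * n%:R * flat 2 (n%:R * (rho ^+ 2 - sqn x) + (- 1)) * sqn x)
   = - (\int[leb2 R]_(x in Om) (pd1 (chi rho n) x * x.1) + \int[leb2 R]_(x in Om) (pd2 (chi rho n) x * x.2)).
  rewrite -(RintegralD mO j1 j2) -[RHS]mulN1r -(RintegralZl _ mO (RintD mO j1 j2)).
  apply: eq_Rintegral => x _; rewrite pd_chi1 pd_chi2 /sqn; ring.
rewrite E1 E2 -opprD opprK -mulr2n -[leLHS]mulr_natl ler_wpM2l//.
have -> : fine (leb2 R Om) = \int[leb2 R]_(x in Om) (1 : R).
  by rewrite (Rintegral_cst _ mO) mul1r.
apply: (le_Rintegral mO j0).
  by apply: (@Rint_bounded _ _ _ _ _ _ 1) => //; [exact: disk_lty|move=> x _; rewrite normr1].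
by move=> x _; rewrite mulr1 chi_le1.
Qed.

Lemma flux_normal_le (p q : R) x (c : R) : `|p * x.1 + q * x.2| <= c ->
  `|flux (p, q) * x.1 + flux (q, p) * x.2| <= c.
Proof.
move=> h; rewrite /flux /= (slopeC q p).
have -> : p / slope (p, q) * x.1 + q / slope (p, q) * x.2 = (p * x.1 + q * x.2) / slope (p, q) by ring.
rewrite normrM normfV (gtr0_norm (slope_gt0 _)).
apply: le_trans h; rewrite ler_pdivrMr ?slope_gt0// ler_peMr//; exact: slope_ge1.
Qed.

(** The normal component meets the gradient of the cutoff. Close to the circle it
    is small and that gradient has bounded mass; farther away the gradient is
    controlled by [bdry_weight], whose integral tends to 0. *)
Lemma divergence_boundary (V1 V2 h G U : R * R -> R) (al : R) :
  measurable_fun (Om : set plane) V1 -> measurable_fun (Om : set plane) V2 ->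
  (forall x, `|V1 x| <= 1) -> (forall x, `|V2 x| <= 1) ->
  {within closed_disk rho, continuous G} -> (forall x, enorm x = rho -> G x = 0) ->
  {ae leb2 R, forall x, Om x -> `|V1 x * x.1 + V2 x * x.2| <= G x} ->
  (leb2 R).-integrable Om (EFin \o h) ->
  (forall phi, test_function Om phi ->
    \int[leb2 R]_(x in Om) (V1 x * pd1 phi x) + \int[leb2 R]_(x in Om) (V2 x * pd2 phi x)
    = al * \int[leb2 R]_(x in Om) (h x * phi x)) ->
  smooth U ->
  \int[leb2 R]_(x in Om) (V1 x * pd1 U x + V2 x * pd2 U x)
  = al * \int[leb2 R]_(x in Om) (h x * U x).
Proof.
move=> mV1 mV2 V1b V2b cG G0 VG hi weak sU.
have mO : measurable (Om : set plane) := measurable_disk rho0.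
have s1 := smooth_pd1 sU; have s2 := smooth_pd2 sU.
have V1i : (leb2 R).-integrable Om (EFin \o V1).
  exact: (Rint_bounded mO (disk_lty rho0) mV1 (fun x _ => V1b x)).
have V2i : (leb2 R).-integrable Om (EFin \o V2).
  exact: (Rint_bounded mO (disk_lty rho0) mV2 (fun x _ => V2b x)).
have gi := RintD mO (smooth_mul_integrable rho0 V1i s1) (smooth_mul_integrable rho0 V2i s2).
have L1 := cvg_integral_chi rho0 gi.
have L2 := cvg_integral_chi rho0 (smooth_mul_integrable rho0 hi sU).
pose k n x := 2 * n%:R * flat 2 (n%:R * (rho ^+ 2 - sqn x) + (- 1)).
have sk n : smooth (k n).
  by apply: smooth_mul; [exact: smooth_cst|apply: smooth_flat; exact: smooth_chi_arg].
have k0 n x : 0 <= k n x by rewrite /k !mulr_ge0// flat_ge0.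
pose N x := V1 x * x.1 + V2 x * x.2.
have mN : measurable_fun (Om : set plane) N.
  apply: measurable_funD; apply: measurable_funM => //; apply: smooth_disk_measurable;
    [exact: smooth_fst|exact: smooth_snd].
have NB x : Om x -> `|N x| <= 2 * rho.
  move=> /(disk_box rho0)/boxP[b1 b2]; rewrite /N (le_trans (ler_normD _ _))// mulrDl mul1r.
  by apply: lerD; rewrite normrM -[leRHS]mul1r ler_pM.
have [CU CU0 HCU] := smooth_disk_bounded rho0 sU.
pose S n x := U x * (N x * k n x).
have Ni : (leb2 R).-integrable Om (EFin \o N).
  by apply: (@Rint_bounded _ _ _ _ _ _ (2 * rho)) => //; exact: disk_lty.
have Si n : (leb2 R).-integrable Om (EFin \o S n).
  by rewrite /S; under eq_fun do rewrite mulrC; exact: (smooth_mul_integrable rho0 (smooth_mul_integrable rho0 Ni (sk n)) sU).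
have E n : \int[leb2 R]_(x in Om) ((V1 x * pd1 U x + V2 x * pd2 U x) * chi rho n x) =
    al * \int[leb2 R]_(x in Om) ((h x * U x) * chi rho n x) + \int[leb2 R]_(x in Om) S n x.
  have tc := test_chi rho0 n; have sc := tc.1.
  have tU := test_mul tc sU.
  have W := weak _ tU.
  have hE : \int[leb2 R]_(x in Om) (h x * U x * chi rho n x) =
     \int[leb2 R]_(x in Om) (h x * (chi rho n x * U x)).
    by apply: eq_Rintegral => x _; rewrite -mulrA [U x * _]mulrC.
  rewrite hE.
  have i1 := smooth_mul_integrable rho0 V1i (smooth_pd1 tU.1); have i2 := smooth_mul_integrable rho0 V2i (smooth_pd2 tU.1).
  apply: (etrans _ (congr1 (fun z => z + \int[leb2 R]_(x in Om) S n x) W)).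
  apply: (etrans _ (congr1 (fun z => z + \int[leb2 R]_(x in Om) S n x) (RintegralD mO i1 i2))).
  apply: (etrans _ (RintegralD mO (RintD mO i1 i2) (Si n))).
  apply: eq_Rintegral => x _.
  rewrite (pd1M (smooth_D1 sc) (smooth_D1 sU)) (pd2M (smooth_D2 sc) (smooth_D2 sU)).
  rewrite pd_chi1 pd_chi2 /S /N /k.
  move: (V1 x) (V2 x) (pd1 U x) (pd2 U x) (flat 2 _) (chi rho n x) (U x) => y1 y2 y3 y4 y5 y6 y7.
  ring.
have L3 : \int[leb2 R]_(x in Om) S n x @[n --> \oo] --> (0:R).
  pose A := fine (leb2 R Om).
  have A0 : 0 <= A by exact: fine_ge0.
  have r2 : 0 < rho ^+ 2 by rewrite exprn_gt0.
  have wi n : (leb2 R).-integrable Om (EFin \o bdry_weight rho n).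
    apply: (@Rint_bounded _ _ _ _ _ _ 3) => //; [exact: disk_lty|exact: measurable_bdry_weight|].
    by move=> x _; rewrite ger0_norm ?bdry_weight_ge0// bdry_weight_le3.
  have w0 : \int[leb2 R]_(x in Om) bdry_weight rho n x @[n --> \oo] --> (0:R).
    have [_] : (leb2 R).-integrable Om (EFin \o (fun x => 0 : R)) /\
      \int[leb2 R]_(x in Om) bdry_weight rho n x @[n --> \oo] --> \int[leb2 R]_(x in Om) (0:R).
      apply: (@Rdominated_cvg _ _ _ (leb2 R) Om (bdry_weight rho) (fun x => 0) (fun x => 3) mO).
      - by move=> n; exact: measurable_bdry_weight.
      - by move=> x Ox; exact: cvg_bdry_weight.
      - by apply: (@Rint_bounded _ _ _ _ _ _ 3) => //; [exact: disk_lty|move=> x _; rewrite ger0_norm].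
      - by move=> n x _; rewrite ger0_norm ?bdry_weight_ge0// bdry_weight_le3.
    by rewrite Rintegral_cst// mul0r.
  apply/cvgrPdist_le => e e0.
  pose c1 := CU * (2 / rho ^+ 2 * (2 * A)).
  have c10 : 0 <= c1 by rewrite !mulr_ge0// ?invr_ge0 ltW.
  pose e1' := e / (2 * (c1 + 1)).
  have e1'0 : 0 < e1' by rewrite divr_gt0// mulr_gt0// ltr_wpDl.
  have [d' d'0 Hd'] := small_near_circle cG G0 e1'0.
  pose d := Num.min d' (rho ^+ 2 / 2).
  have d0 : 0 < d by rewrite lt_min d'0 divr_gt0.
  have Hd x : Om x -> rho ^+ 2 - sqn x < d -> G x < e1'.
    by move=> Ox; rewrite lt_min => /andP[hx _]; exact: Hd'.
  have kint n : (leb2 R).-integrable Om (EFin \o (fun x => k n x * sqn x)).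
    have sks : smooth (fun x => k n x * sqn x) by apply: smooth_mul => //; exact: smooth_sqn.
    have [D _ HD] := smooth_disk_bounded rho0 sks.
    by apply: (@Rint_bounded _ _ _ _ _ _ D) => //; [exact: disk_lty|exact: smooth_disk_measurable].
  have pw n x : Om x -> `|N x| <= G x ->
      `|N x| * k n x <= e1' * (2 / rho ^+ 2) * (k n x * sqn x) + 4 * rho / d * bdry_weight rho n x.
    move=> Ox NG; have [hd|hd] := ltP (rho ^+ 2 - sqn x) d.
      have N1 : `|N x| <= e1'.
        exact: (le_trans NG (ltW (Hd _ Ox hd))).
      have sq : 1 <= 2 / rho ^+ 2 * sqn x.
        rewrite mulrAC ler_pdivlMr// mul1r.
        have : rho ^+ 2 - sqn x < rho ^+ 2 / 2 by apply: lt_le_trans hd _; rewrite ge_min lexx orbT.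
        by move=> ?; lra.
      rewrite -[leLHS]addr0; apply: lerD.
        apply: (@le_trans _ _ (e1' * k n x)); first exact: ler_wpM2r.
        have -> : e1' * (2 / rho ^+ 2) * (k n x * sqn x) = (e1' * k n x) * (2 / rho ^+ 2 * sqn x) by ring.
        by rewrite ler_peMr// mulr_ge0// ltW.
      by rewrite mulr_ge0 ?bdry_weight_ge0// divr_ge0// ?mulr_ge0// ltW.
    rewrite -[leLHS]add0r; apply: lerD.
      apply: mulr_ge0; last by apply: mulr_ge0; [exact: k0|exact: sqn_ge0].
      by apply: mulr_ge0; [exact: ltW|apply: divr_ge0 => //; exact: ltW].
    apply: (@le_trans _ _ (2 * rho * k n x)); first by apply: ler_wpM2r => //; exact: NB.
    rewrite [leRHS]mulrAC ler_pdivlMr// -bdry_weightE.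
    have : n%:R * flat 2 (n%:R * (rho ^+ 2 - sqn x) + (- 1)) * d <=
       n%:R * flat 2 (n%:R * (rho ^+ 2 - sqn x) + (- 1)) * (rho ^+ 2 - sqn x).
      by apply: ler_wpM2l => //; rewrite mulr_ge0// flat_ge0.
    move=> /(ler_wpM2l (mulr_ge0 (ler0n R 4) (ltW rho0))) => H4.
    apply: le_trans H4; rewrite le_eqVlt; apply/orP; left; apply/eqP.
    by rewrite /k; move: (flat 2 _) => z; ring.
  pose bd n x := CU * (e1' * (2 / rho ^+ 2) * (k n x * sqn x) + 4 * rho / d * bdry_weight rho n x).
  have bdi n : (leb2 R).-integrable Om (EFin \o bd n).
    by apply: RintZ => //; apply: RintD => //; apply: RintZ.
  have Sb n : `|\int[leb2 R]_(x in Om) S n x| <= \int[leb2 R]_(x in Om) bd n x.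
    apply: Rintegral_le_norm_ae => //.
    apply: ae_mono VG => x NG Ox.
    rewrite /S normrM; apply: ler_pM => //; first exact: HCU.
    by rewrite normrM (ger0_norm (k0 n x)); apply: pw => //; exact: NG.
  have bdE n : \int[leb2 R]_(x in Om) bd n x <=
     c1 * e1' + CU * (4 * rho / d) * \int[leb2 R]_(x in Om) bdry_weight rho n x.
    have j1 := RintZ (e1' * (2 / rho ^+ 2)) mO (kint n).
    have j2 := RintZ (4 * rho / d) mO (wi n).
    rewrite (RintegralZl CU mO (RintD mO j1 j2)) (RintegralD mO j1 j2).
    rewrite (RintegralZl _ mO (kint n)) (RintegralZl _ mO (wi n)) mulrDr.
    rewrite [CU * (4 * rho / d * _)]mulrA lerD2r.
    have -> : c1 * e1' = CU * (e1' * (2 / rho ^+ 2)) * (2 * A) by rewrite /c1; ring.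
    rewrite mulrA; apply: ler_wpM2l; last exact: chi_gradient_mass.
    apply: mulr_ge0 => //; apply: mulr_ge0; first exact: ltW.
    by apply: divr_ge0 => //; exact: ltW.
  have small : c1 * e1' <= e / 2.
    have c11 : 0 < c1 + 1 by rewrite ltr_wpDl.
    have -> : c1 * e1' = e / 2 * (c1 / (c1 + 1)) by rewrite /e1'; field; rewrite gt_eqF.
    rewrite ler_piMr ?ler_pdivrMr ?mul1r ?lerDl ?ler01//; apply: ltW.
    by rewrite divr_gt0.
  have cw : CU * (4 * rho / d) * \int[leb2 R]_(x in Om) bdry_weight rho n x @[n --> \oo] --> (0:R).
    by rewrite -(mulr0 (CU * (4 * rho / d))); apply: cvgM; [exact: cvg_cst|exact: w0].
  move/cvgrPdist_le : cw => /(_ (e / 2)); rewrite divr_gt0// => /(_ isT).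
  apply: filterS => n; rewrite !sub0r !normrN => Hn.
  apply: (le_trans (Sb n)); apply: (le_trans (bdE n)); rewrite [leRHS]splitr.
  by apply: lerD => //; exact: (le_trans (ler_norm _) Hn).
have L4 := cvgD (cvgM (cvg_cst al) L2) L3; rewrite addr0 in L4.
apply: (cvg_unique (@Rhausdorff R) L1).
by rewrite (funext E); exact: L4.
Qed.

(** By the Neumann condition the flux, which is parallel to the gradient and not
    longer, has vanishing normal component at the circle. *)
Lemma flux_weak_boundary al h U :
  (forall a b, (a + b <= 2)%N -> is_wderiv Om a b h (wD Om a b h)) ->
  ae_eq_on Om (Fop rho al h) (cst 0) -> neumann rho h ->
  (leb2 R).-integrable Om (EFin \o h) -> smooth U ->
  \int[leb2 R]_(x in Om) (flux (wD Om 1 0 h x, wD Om 0 1 h x) * pd1 U x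
    + flux (wD Om 0 1 h x, wD Om 1 0 h x) * pd2 U x)
  = al * \int[leb2 R]_(x in Om) (h x * U x).
Proof.
move=> H F0 [g1 [g2 [cg1 cg2 e1 e2 nu0]]] hi sU.
have [_ lp _] := (H 1 0 isT)%N; have [_ lq _] := (H 0 1 isT)%N.
pose G x := `|g1 x * x.1 + g2 x * x.2|.
apply: (@divergence_boundary _ _ h G U al).
- exact: (measurable_on_comp2 rho0 (@continuous_flux R) lp.1 lq.1).
- exact: (measurable_on_comp2 rho0 (@continuous_flux R) lq.1 lp.1).
- by move=> x; exact: flux_le1.
- by move=> x; exact: flux_le1.
- move=> x; apply: cvg_norm; apply: cvgD; apply: cvgM.
  + exact: cg1.
  + exact: (@continuous_subspaceT _ _ (closed_disk rho) _ (smooth_cont (@smooth_fst R)) x).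
  + exact: cg2.
  + exact: (@continuous_subspaceT _ _ (closed_disk rho) _ (smooth_cont (@smooth_snd R)) x).
- move=> x xr; have := nu0 x xr; rewrite !mulrA -mulrDl => /eqP.
  by rewrite mulf_eq0 invr_eq0 (gt_eqF rho0) orbF /G => /eqP ->; rewrite normr0.
- apply: ae_mono2 e1 e2 => x h1 h2 Ox; apply: flux_normal_le.
  by rewrite (h1 Ox) (h2 Ox).
- exact: hi.
- by move=> phi; exact: flux_weak.
- exact: sU.
Qed.

End flux_boundary.

(** * The first Bessel function and the eigenfunction *)

Section entire.
Variable R : realType.
Implicit Types (c : nat -> R) (x : R).

(** A class of coefficients that gives everywhere convergent power series and is
    visibly stable under differentiation. *)
Definition exp_bounded c := exists A b : R,
  [/\ 0 <= A, 0 <= b & forall k, `|c k| <= A * (b ^+ k / k`!%:R)].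

Definition psum c x := limn (pseries c x).

Lemma exp_bounded_cvg c x : exp_bounded c -> cvgn (pseries c x).
Proof.
move=> [A [b [A0 b0 H]]]; apply: normed_cvg.
apply: (@series_le_cvg R _ (fun k => A * exp_coeff (b * `|x|) k)) => /=.
- by move=> k; exact: normr_ge0.
- by move=> k; rewrite mulr_ge0// exp_coeff_ge0// mulr_ge0.
- move=> k; rewrite normrM normrX /exp_coeff /= exprMn.
  apply: (le_trans (ler_wpM2r _ (H k))); first by rewrite exprn_ge0.
  by rewrite le_eqVlt; apply/orP; left; apply/eqP; ring.
- by apply: is_cvg_seriesZ; exact: is_cvg_series_exp_coeff.
Qed.

Lemma exp_bounded_diffs c : exp_bounded c -> exp_bounded (pseries_diffs c).
Proof.
move=> [A [b [A0 b0 H]]]; exists (A * b), b; split => //; first exact: mulr_ge0.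
move=> k; rewrite /pseries_diffs normrM ger0_norm//.
apply: (le_trans (ler_wpM2l _ (H k.+1))) => //.
rewrite factS natrM exprS le_eqVlt; apply/orP; left; apply/eqP; field.
by rewrite nat1r !pnatr_eq0 -lt0n fact_gt0.
Qed.

Lemma is_derive_psum c x : exp_bounded c ->
  is_derive x (1:R) (psum c) (psum (pseries_diffs c) x).
Proof.
move=> H; have H1 := exp_bounded_diffs H; have H2 := exp_bounded_diffs H1.
apply: (@pseries_snd_diffs _ _ (`|x| + 1)); try exact: exp_bounded_cvg.
by rewrite [ltRHS]ger0_norm ?addr_ge0// ltrDl.
Qed.

Lemma Ck1_psum n c : exp_bounded c -> Ck1 n (psum c).
Proof.
elim: n c => [|n IH] c H.
  move=> x; apply/differentiable_continuous/derivable1_diffP.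
  by have [] := is_derive_psum x H.
split; first by move=> x; have [] := is_derive_psum x H.
have -> : derive1 (psum c) = psum (pseries_diffs c).
  by apply/funext => x; rewrite derive1E; have D := is_derive_psum x H; rewrite derive_val.
by apply: IH; exact: exp_bounded_diffs.
Qed.

Lemma psum0 c : exp_bounded c -> psum c 0 = c 0%N.
Proof.
move=> H; apply/cvg_lim; first exact: Rhausdorff.
rewrite -(cvg_shiftS _); apply: cvg_near_cst; apply: nearW => n.
rewrite /pseries /series /= big_nat_recl//= expr0 mulr1 big1 ?addr0// => i _.
by rewrite expr0n mulr0.
Qed.

(** The entire function B with J_1(z) = (z/2) B(z^2). *)
Definition bessel_coeff (k : nat) : R := (-1) ^+ k / (k`!%:R * (k.+1)`!%:R * 4 ^+ k).
Definition besselB := psum bessel_coeff.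
Definition besselB' := psum (pseries_diffs bessel_coeff).
Definition besselB'' := psum (pseries_diffs (pseries_diffs bessel_coeff)).

Lemma bessel_coeff_bounded : exp_bounded bessel_coeff.
Proof.
exists 1, 1; split => // k; rewrite mul1r expr1n mul1r /bessel_coeff.
rewrite normrM normrX normrN1 expr1n mul1r normfV gtr0_norm; last first.
  by rewrite !mulr_gt0// ?ltr0n ?fact_gt0// exprn_gt0.
rewrite lef_pV2 ?posrE ?mulr_gt0 ?ltr0n ?fact_gt0 ?exprn_gt0//.
rewrite -mulrA ler_peMr// -[leLHS]mulr1; apply: ler_pM => //.
  by rewrite ler1n fact_gt0.
by rewrite exprn_ege1// ler1n.
Qed.

Lemma besselB0 : besselB 0 = 1.
Proof. by rewrite /besselB psum0 ?/bessel_coeff ?expr0 ?fact0 ?mulr1 ?divr1//; exact: bessel_coeff_bounded. Qed.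

Lemma is_derive_besselB x : is_derive x (1:R) besselB (besselB' x).
Proof. exact: is_derive_psum bessel_coeff_bounded. Qed.

Lemma bessel_coeffS k : (k.+1%:R * k.+2%:R) * bessel_coeff k.+1 = - (bessel_coeff k / 4).
Proof.
rewrite /bessel_coeff !factS !natrM !exprS; field.
have f0 : (k`!%:R : R) != 0 by rewrite pnatr_eq0 -lt0n fact_gt0.
have k1 : (1 + k%:R : R) != 0 by rewrite nat1r pnatr_eq0.
have k2 : (2 + k%:R : R) != 0 by rewrite -natrD pnatr_eq0.
by rewrite f0 k1 k2 expf_neq0// pnatr_eq0.
Qed.

(** Bessel's equation for J_1, rewritten in the variable z^2. *)
Lemma besselB_ode x : x * besselB'' x + 2 * besselB' x = - (besselB x / 4).
Proof.
have b0 := bessel_coeff_bounded; have b1 := exp_bounded_diffs b0.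
have b2 := exp_bounded_diffs b1.
have c0 : pseries bessel_coeff x n.+1 @[n --> \oo] --> besselB x.
  by rewrite (cvg_shiftS (pseries bessel_coeff x)); exact: exp_bounded_cvg.
have c1 : pseries (pseries_diffs bessel_coeff) x n.+1 @[n --> \oo] --> besselB' x.
  by rewrite (cvg_shiftS (pseries (pseries_diffs bessel_coeff) x)); exact: exp_bounded_cvg.
have c2 : pseries (pseries_diffs (pseries_diffs bessel_coeff)) x n @[n --> \oo] --> besselB'' x.
  exact: exp_bounded_cvg.
have E n : x * pseries (pseries_diffs (pseries_diffs bessel_coeff)) x n
    + 2 * pseries (pseries_diffs bessel_coeff) x n.+1 = - (pseries bessel_coeff x n.+1 / 4).
(* the second sum is one term longer: multiplying by x shifts the degree *)
  rewrite /pseries /series /=; elim: n => [|n IH].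
    rewrite !big_nat1 big_nil /= !expr0 !mulr1 mulr0 add0r.
    by have := bessel_coeffS 0; rewrite /pseries_diffs mul1r => <-; rewrite mul1r.
  rewrite big_nat_recr//= [in 2 * _]big_nat_recr//= [in RHS]big_nat_recr//=.
  rewrite mulrDr mulrDr addrACA IH [in RHS]mulrDl opprD; apply: (f_equal2 +%R); first reflexivity.
  have e := bessel_coeffS n.+1.
  rewrite /pseries_diffs [in RHS]mulrAC -[RHS]mulNr -e.
  by rewrite (exprSr x n); ring.
have L : x * pseries (pseries_diffs (pseries_diffs bessel_coeff)) x n
    + 2 * pseries (pseries_diffs bessel_coeff) x n.+1 @[n --> \oo]
    --> x * besselB'' x + 2 * besselB' x.
  exact: (cvgD (cvgM (cvg_cst x) c2) (cvgM (cvg_cst (2:R)) c1)).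
have Rr : - (pseries bessel_coeff x n.+1 / 4) @[n --> \oo] -->
    - (besselB x / 4).
  exact: (cvgN (cvgM c0 (cvg_cst (4^-1 : R)))).
by rewrite (funext E) in L; have := cvg_unique (@Rhausdorff R) L Rr; apply.
Qed.

Lemma besselJ1E z : besselJ1 z = z / 2 * besselB (z ^+ 2).
Proof.
rewrite /besselJ1 /besselB /psum.
have -> : (fun k : nat => (-1) ^+ k / (k`!%:R * (k.+1)`!%:R) * (z / 2) ^+ (2 * k + 1)) =
    (fun k => z / 2 * (bessel_coeff k * (z ^+ 2) ^+ k)).
  apply/funext => k; rewrite /bessel_coeff addn1 exprS exprM.
  rewrite (_ : (z / 2) ^+ 2 = z ^+ 2 / 4); last by field.
  rewrite exprMn exprVn.
  move: (z ^+ 2 ^+ k) => w; field.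
  by rewrite !pnatr_eq0 /= -!lt0n !fact_gt0 expf_eq0 pnatr_eq0 andbF.
apply/cvg_lim; first exact: Rhausdorff.
have c := @exp_bounded_cvg _ (z ^+ 2) bessel_coeff_bounded.
have -> : series (fun k => z / 2 * (bessel_coeff k * (z ^+ 2) ^+ k)) =
   (fun n => z / 2 * pseries bessel_coeff (z ^+ 2) n).
  by apply/funext => n; rewrite /pseries /series /= -mulr_sumr.
by apply: cvgM; [exact: cvg_cst|exact: c].
Qed.

Lemma derive1_besselJ1 z : derive1 (@besselJ1 R) z =
  (besselB (z ^+ 2) + 2 * z ^+ 2 * besselB' (z ^+ 2)) / 2.
Proof.
have -> : @besselJ1 R = (fun z => z / 2 * besselB (z * z)).
  by apply/funext => y; rewrite besselJ1E expr2.
have d1 : is_derive z (1:R) (fun z => z * z) (2 * z).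
  have H := is_deriveM (is_derive_id z (1:R)) (is_derive_id z (1:R)).
  by apply: (is_derive_eq H); rewrite /GRing.scale /=; ring.
have d2 := @is_derive1_comp R besselB (fun z => z * z) z _ _ (is_derive_besselB (z * z)) d1.
have d3 : is_derive z (1:R) (fun z => z / 2) (2^-1).
  have H := is_deriveM (is_derive_id z (1:R)) (is_derive_cst (2^-1 : R) z (1:R)).
  by apply: (is_derive_eq H); rewrite /GRing.scale /=; ring.
have d4 := is_deriveM d3 d2.
rewrite derive1E (@derive_val _ _ _ _ _ _ _ d4) /GRing.scale /= !expr2; by field.
Qed.

End entire.

Section eigenfunction.
Variable R : realType.
Implicit Types (c : nat -> R) (m k : R) (x : R * R).

Lemma is_derive_quadratic m a t :
  is_derive t (1:R) (fun t : R => m * (t ^+ 2 + a)) (2 * m * t).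
Proof.
have -> : (fun t : R => m * (t ^+ 2 + a)) = (fun t : R => m * (t * t + a)).
  by apply/funext => u; rewrite expr2.
have H1 := is_deriveM (is_derive_id t (1:R)) (is_derive_id t (1:R)).
have H2 := is_deriveD H1 (is_derive_cst a t (1:R)).
have H3 := is_deriveM (is_derive_cst m t (1:R)) H2.
by apply: (is_derive_eq H3); rewrite /GRing.scale /=; ring.
Qed.

Lemma smooth_radial c m : exp_bounded c -> smooth (fun x => psum c (m * sqn x)).
Proof.
move=> bc n; apply: (@Ck_comp R n (psum c) (fun x => m * sqn x)).
  exact: Ck1_psum.
by apply: Ck_scale; exact: smooth_sqn.
Qed.

Lemma pd1_radial c m x : exp_bounded c ->
  pd1 (fun x => psum c (m * sqn x)) x = 2 * m * x.1 * psum (pseries_diffs c) (m * sqn x).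
Proof.
move=> bc; apply: pd1P => /=; rewrite /sqn /=.
have d := is_derive_quadratic m (x.2 ^+ 2) x.1.
have H := @is_derive1_comp R (psum c) _ x.1 _ _ (is_derive_psum (m * (x.1 ^+ 2 + x.2 ^+ 2)) bc) d.
by apply: (is_derive_eq H); rewrite mulrC.
Qed.

Lemma pd2_radial c m x : exp_bounded c ->
  pd2 (fun x => psum c (m * sqn x)) x = 2 * m * x.2 * psum (pseries_diffs c) (m * sqn x).
Proof.
move=> bc; apply: pd2P => /=; rewrite /sqn /=.
have -> : (fun t => psum c (m * (x.1 ^+ 2 + t ^+ 2))) = (fun t => psum c (m * (t ^+ 2 + x.1 ^+ 2))).
  by apply/funext => t; rewrite addrC.
have d := is_derive_quadratic m (x.1 ^+ 2) x.2.
have H := @is_derive1_comp R (psum c) _ x.2 _ _ (is_derive_psum (m * (x.2 ^+ 2 + x.1 ^+ 2)) bc) d.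
by apply: (is_derive_eq H); rewrite mulrC [x.2 ^+ 2 + _]addrC.
Qed.

(** Up to a factor, J_1(sqrt m r) cos phi in polar coordinates. *)
Definition eigfun m k x : R := k * (x.1 * besselB (m * sqn x)).

Let b0 := bessel_coeff_bounded R.
Let b1 := exp_bounded_diffs b0.

Lemma smooth_eigfun m k : smooth (eigfun m k).
Proof.
by apply: smooth_mul; [exact: smooth_cst|apply: smooth_mul; [exact: smooth_fst|exact: smooth_radial]].
Qed.

Lemma pd1_eigfun m k x : pd1 (eigfun m k) x =
  k * (besselB (m * sqn x) + 2 * m * x.1 ^+ 2 * besselB' (m * sqn x)).
Proof.
have sB := @smooth_radial _ m b0; have sf := @smooth_fst R.
rewrite /eigfun (pd1M (smooth_D1 (@smooth_cst R k)) (smooth_D1 (smooth_mul sf sB))).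
rewrite (pd1M (smooth_D1 sf) (smooth_D1 sB)) pd1_radial//.
have -> : pd1 (fun x : R * R => x.1) x = 1 by apply: pd1P; exact: is_derive_id.
have -> : pd1 (fun _ : R * R => k) x = 0 by apply: pd1P; exact: is_derive_cst.
rewrite /besselB' /besselB; ring.
Qed.

Lemma pd2_eigfun m k x : pd2 (eigfun m k) x =
  k * (2 * m * x.1 * x.2 * besselB' (m * sqn x)).
Proof.
have sB := @smooth_radial _ m b0; have sf := @smooth_fst R.
rewrite /eigfun (pd2M (smooth_D2 (@smooth_cst R k)) (smooth_D2 (smooth_mul sf sB))).
rewrite (pd2M (smooth_D2 sf) (smooth_D2 sB)) pd2_radial//.
have -> : pd2 (fun x : R * R => x.1) x = 0 by apply: pd2P; exact: is_derive_cst.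
have -> : pd2 (fun _ : R * R => k) x = 0 by apply: pd2P; exact: is_derive_cst.
rewrite /besselB' /besselB; ring.
Qed.

Lemma eigfun_helmholtz m k x :
  pd1 (pd1 (eigfun m k)) x + pd2 (pd2 (eigfun m k)) x = - (m * eigfun m k x).
Proof.
have sB := @smooth_radial _ m b0; have sB' := @smooth_radial _ m b1.
have sf := @smooth_fst R; have ss := @smooth_snd R.
have sc := @smooth_cst R.
have E1 : pd1 (eigfun m k) = fun x => k * (besselB (m * sqn x) +
    2 * m * (x.1 * x.1) * besselB' (m * sqn x)).
  by apply/funext => z; rewrite pd1_eigfun expr2.
have E2 : pd2 (eigfun m k) = fun x => k * (2 * m * (x.1 * x.2) * besselB' (m * sqn x)).
  by apply/funext => z; rewrite pd2_eigfun; ring.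
have sg1 : smooth (fun x : R * R => 2 * m * (x.1 * x.1)) by apply: smooth_mul => //; exact: smooth_mul.
have sg2 : smooth (fun x : R * R => 2 * m * (x.1 * x.2)) by apply: smooth_mul => //; exact: smooth_mul.
have p1f : pd1 (fun x : R * R => x.1) = cst 1 by apply/funext => z; apply: pd1P; exact: is_derive_id.
have p2f : pd2 (fun x : R * R => x.1) = cst 0 by apply/funext => z; apply: pd2P; exact: is_derive_cst.
have p2s : pd2 (fun x : R * R => x.2) = cst 1 by apply/funext => z; apply: pd2P; exact: is_derive_id.
have p1c a : pd1 (fun _ : R * R => a : R) = cst 0 by apply/funext => z; apply: pd1P; exact: is_derive_cst.
have p2c a : pd2 (fun _ : R * R => a : R) = cst 0 by apply/funext => z; apply: pd2P; exact: is_derive_cst.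
rewrite E1 E2.
rewrite (pd1M (smooth_D1 (sc k)) (smooth_D1 (smooth_add sB (smooth_mul sg1 sB')))).
rewrite (pd1D (smooth_D1 sB) (smooth_D1 (smooth_mul sg1 sB'))).
rewrite (pd1M (smooth_D1 sg1) (smooth_D1 sB')).
rewrite (pd1M (smooth_D1 (sc (2 * m))) (smooth_D1 (smooth_mul sf sf))).
rewrite (pd1M (smooth_D1 sf) (smooth_D1 sf)) p1f !p1c !pd1_radial//.
rewrite (pd2M (smooth_D2 (sc k)) (smooth_D2 (smooth_mul sg2 sB'))).
rewrite (pd2M (smooth_D2 sg2) (smooth_D2 sB')).
rewrite (pd2M (smooth_D2 (sc (2 * m))) (smooth_D2 (smooth_mul sf ss))).
rewrite (pd2M (smooth_D2 sf) (smooth_D2 ss)) p2f p2s !p2c !pd2_radial//.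
have := besselB_ode (m * sqn x); rewrite /eigfun /besselB /besselB' /besselB'' /=.
move: (psum (pseries_diffs (pseries_diffs (@bessel_coeff R))) _)
  (psum (pseries_diffs (@bessel_coeff R)) _) (psum (@bessel_coeff R) _).
move=> D2B DB B ode.
transitivity (4 * m * k * x.1 * (m * sqn x * D2B + 2 * DB)); first by rewrite /sqn; ring.
by rewrite ode; field.
Qed.

Lemma eigfun_radial_derivative m k x :
  x.1 * pd1 (eigfun m k) x + x.2 * pd2 (eigfun m k) x =
  k * x.1 * (besselB (m * sqn x) + 2 * (m * sqn x) * besselB' (m * sqn x)).
Proof. by rewrite pd1_eigfun pd2_eigfun /sqn; ring. Qed.

End eigenfunction.

(** * Extracting integral bounds from the Sobolev norm *)

Section Lp_norms.
Variables (R : realType) (rho : R).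
Hypothesis rho0 : 0 < rho.
Notation plane := (measurableTypeR R * measurableTypeR R)%type.
Notation Om := (disk rho).
Implicit Types (u w z : R * R -> R) (x : R * R) (p e : R).

Lemma Lp_norm_powE p w : p != 0 -> ((Lp_norm Om p w) `^ p)%E =
  (\int[leb2 R]_(x in Om) (`|w x| `^ p)%:E)%E.
Proof.
move=> p0; rewrite /Lp_norm (poweR_Lnorm _ _ p0) [RHS]integral_mkcond.
apply: eq_integral => x _; rewrite /= /patch; case: ifP => // _.
by rewrite normr0 powR0.
Qed.

Lemma Lp_norm_integrable p w : 0 < p -> measurable_fun (Om : set plane) w ->
  (Lp_norm Om p w < +oo)%E ->
  (leb2 R).-integrable Om (EFin \o (fun x => `|w x| `^ p)) /\
  \int[leb2 R]_(x in Om) (`|w x| `^ p) = fine (Lp_norm Om p w) `^ p.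
Proof.
move=> p0 mw Nfin; have E := @Lp_norm_powE p w (lt0r_neq0 p0).
have N0 : (0 <= Lp_norm Om p w)%E by exact: Lnorm_ge0.
have Nf : Lp_norm Om p w \is a fin_num by rewrite ge0_fin_numE.
have mpow : measurable_fun (Om : set plane) (fun x => `|w x| `^ p).
  apply: (@measurableT_comp _ _ _ _ _ _ (fun t : R => t `^ p)); first exact: measurable_powR.
  by apply: measurableT_comp => //; exact: normr_measurable.
split; last by rewrite /Rintegral -E -{1}(fineK Nf) poweR_EFin.
apply/integrableP; split; first exact/measurable_EFinP.
rewrite (_ : (\int[_]_(x in _) _)%E = (Lp_norm Om p w `^ p)%E); first exact: poweR_lty.
by rewrite E; apply: eq_integral => x _ /=; rewrite ger0_norm// powR_ge0.
Qed.

Lemma expr_le_powR (n : nat) p e t : n%:R <= p -> 0 < e -> 0 <= t ->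
  t ^+ n <= e ^+ n + e ^+ n * e^-1 `^ p * t `^ p.
Proof.
move=> np e0 t0; have K0 : 0 <= e ^+ n * e^-1 `^ p * t `^ p.
  by rewrite !mulr_ge0 ?powR_ge0// exprn_ge0// ltW.
have [te|et] := leP t e.
  by apply: (le_trans (lerXn2r n _ _ te)); rewrite ?nnegrE ?lerDl// ltW.
have te1 : 1 <= t / e by rewrite ler_pdivlMr// mul1r ltW.
have H : (t / e) ^+ n <= (t / e) `^ p.
  have te0 : 0 <= t / e by apply: le_trans te1.
  by rewrite -(powR_mulrn n te0); exact: ler_powR.
have -> : t ^+ n = e ^+ n * (t / e) ^+ n.
  by rewrite -exprMn mulrCA divff ?gt_eqF// mulr1.
apply: (@le_trans _ _ (e ^+ n * (t / e) `^ p)).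
  by rewrite ler_wpM2l// exprn_ge0// ltW.
have ei0 : 0 <= e^-1 by rewrite invr_ge0 ltW.
rewrite (powRM p t0 ei0) [t `^ p * _]mulrC mulrA.
by rewrite lerDr exprn_ge0// ltW.
Qed.

Lemma Lp_norm_expr_integrable (n : nat) p w : n%:R <= p -> 0 < p ->
  measurable_fun (Om : set plane) w -> (Lp_norm Om p w < +oo)%E ->
  (leb2 R).-integrable Om (EFin \o (fun x => `|w x| ^+ n)).
Proof.
move=> np p0 mw Nfin; have mO : measurable (Om : set plane) := measurable_disk rho0.
have [ip _] := Lp_norm_integrable p0 mw Nfin.
have i1 : (leb2 R).-integrable Om (EFin \o cst (1:R)).
  by apply: (@Rint_bounded _ _ _ _ _ _ 1) => //; [exact: disk_lty|move=> x _; rewrite normr1].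
apply: (Rint_le mO _ _ (RintD mO i1 ip)).
  by apply: measurable_funX; apply: measurableT_comp => //; exact: normr_measurable.
move=> x _; rewrite ger0_norm ?exprn_ge0//.
have := @expr_le_powR n p 1 `|w x| np ltr01 (normr_ge0 _).
by rewrite expr1n invr1 powR1 !mul1r.
Qed.

(** On a set of finite measure, smallness in L^p gives smallness of the
    integral of any lower power: values below a small level t contribute at most
    t^n times the measure, and the others are dominated by their p-th power. *)
Lemma Lp_norm_small (n : nat) p e : (0 < n)%N -> n%:R <= p -> 0 < e ->
  exists2 d, 0 < d & forall w, measurable_fun (Om : set plane) w ->
    (Lp_norm Om p w < d%:E)%E -> \int[leb2 R]_(x in Om) (`|w x| ^+ n) <= e.
Proof.
move=> n0 np e0; have mO : measurable (Om : set plane) := measurable_disk rho0.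
have p1 : 1 <= p by apply: le_trans np; rewrite ler1n.
have p0 : 0 < p by apply: lt_le_trans p1.
pose A := fine (leb2 R Om).
have A0 : 0 <= A by exact: fine_ge0.
have A1 : 0 < 2 * (A + 1) by rewrite mulr_gt0// ltr_wpDl.
pose t := Num.min 1 (e / (2 * (A + 1))).
have t0 : 0 < t by rewrite lt_min ltr01 divr_gt0.
have t1 : t <= 1 by rewrite ge_min lexx.
have tn : t ^+ n <= t by rewrite -[leRHS]expr1; apply: ler_wiXn2l => //; exact: ltW.
have tA : t * A <= e / 2.
  have : t <= e / (2 * (A + 1)) by rewrite ge_min lexx orbT.
  rewrite ler_pdivlMr// => h; rewrite ler_pdivlMr//.
  apply: le_trans h; rewrite -mulrA; apply: ler_wpM2l; first exact: ltW.
  by rewrite mulrC; apply: ler_wpM2l => //; rewrite lerDl.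
pose K := t ^+ n * t^-1 `^ p.
have K0 : 0 < K by rewrite mulr_gt0 ?exprn_gt0// powR_gt0// invr_gt0.
exists (Num.min 1 (e / (2 * K))); first by rewrite lt_min ltr01 divr_gt0// mulr_gt0.
move=> w mw Nd.
have Nfin : (Lp_norm Om p w < +oo)%E by apply: lt_trans Nd _; exact: ltry.
have N0 : (0 <= Lp_norm Om p w)%E by exact: Lnorm_ge0.
have Nf : Lp_norm Om p w \is a fin_num by rewrite ge0_fin_numE.
have [ip Ip] := Lp_norm_integrable p0 mw Nfin.
have i_n := Lp_norm_expr_integrable np p0 mw Nfin.
have it : (leb2 R).-integrable Om (EFin \o cst (t ^+ n)).
  by apply: (@Rint_bounded _ _ _ _ _ _ `|t ^+ n|) => //; exact: disk_lty.
have iK := RintZ K mO ip.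
apply: (@le_trans _ _ (\int[leb2 R]_(x in Om) (t ^+ n + K * `|w x| `^ p))).
  apply: le_Rintegral => //; first exact: RintD.
  by move=> x _; exact: expr_le_powR.
rewrite (RintegralD mO it iK) (RintegralZl K mO ip) Ip.
rewrite Rintegral_cst// -/A.
have Nd' : fine (Lp_norm Om p w) < Num.min 1 (e / (2 * K)) by rewrite -lte_fin fineK.
have F0 : 0 <= fine (Lp_norm Om p w) by exact: fine_ge0.
move: (fine (Lp_norm Om p w)) Nd' F0 => N; rewrite lt_min => /andP[N1 N2] F0.
have NpN : N `^ p <= N.
  have [->|Nn0] := eqVneq N 0; first by rewrite powR0// gt_eqF.
  by apply: ge1r_powR => //; rewrite lt_neqAle eq_sym Nn0 F0 ltW.
have KN : K * N `^ p <= e / 2.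
  apply: (le_trans (ler_wpM2l (ltW K0) NpN)).
  have K2 : 0 < 2 * K by rewrite mulr_gt0.
  move: N2; rewrite (ltr_pdivlMr _ _ K2) => h.
  by rewrite ler_pdivlMr// (_ : K * N * 2 = N * (2 * K)) ?ltW//; move: (K) => k; ring.
have tnA : t ^+ n * A <= e / 2 by apply: le_trans tA; exact: ler_wpM2r.
by rewrite [leRHS]splitr lerD.
Qed.

Lemma le_sume (I : finType) (P : pred I) (f : I -> \bar R) i : P i ->
  (forall k, (0 <= f k)%E) -> (f i <= \sum_(k | P k) f k)%E.
Proof. by move=> Pi f0; rewrite (bigD1 i)//= leeDl// sume_ge0. Qed.

Lemma Lp_norm_le_Wnorm m s p u a b : (a + b <= m)%N ->
  (Lp_norm Om p (wD Om a b u) <= Wnorm Om m s p u)%E.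
Proof.
move=> abm; have L0 c d : (0 <= Lp_norm Om p (wD Om c d u))%E by exact: Lnorm_ge0.
have am : (a < m.+1)%N by rewrite ltnS (leq_trans _ abm)// leq_addr.
have bm : (b < m.+1)%N by rewrite ltnS (leq_trans _ abm)// leq_addl.
rewrite /Wnorm; apply: (@le_trans _ _ (\sum_(a < m.+1) \sum_(b < m.+1 | (a + b <= m)%N)
    Lp_norm Om p (wD Om a b u))%E); last first.
  by apply: leeDl; apply: sume_ge0 => i _; exact: poweR_ge0.
have H := @le_sume _ (fun k : 'I_m.+1 => (Ordinal am + k <= m)%N)
  (fun k => Lp_norm Om p (wD Om (Ordinal am) k u)) (Ordinal bm) abm (fun=> L0 _ _).
apply: (le_trans H).
apply: (@le_sume _ xpredT (fun k : 'I_m.+1 => (\sum_(b < m.+1 | (k + b <= m)%N)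
    Lp_norm Om p (wD Om k b u))%E) (Ordinal am)) => // k.
by apply: sume_ge0.
Qed.

Lemma wD00_ae u : L1loc Om u -> ae_eq_on Om (wD Om 0 0 u) u.
Proof. by move=> lu; have w := is_wderiv0 lu; exact: (wderiv_ae_unique rho0 (wDP w) w). Qed.

End Lp_norms.

(** * The first Neumann mode *)

Section first_mode.
Variables (R : realType) (rho j : R).
Hypothesis rho0 : 0 < rho.
Hypothesis j0 : 0 < j.
Notation plane := (measurableTypeR R * measurableTypeR R)%type.
Notation Om := (disk rho).
Implicit Types (f : R * R -> R) (x : R * R).

Lemma open_measure_gt0 (V : set (R * R)) x : open V -> V x -> (0 < leb2 R V)%E.
Proof.
move=> oV Vx; have [[A B] /= [nA nB] AB] : nbhs x V by exact: open_nbhs_nbhs.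
have [a /= a0 hA] := (nbhs_ballP _ _).1 nA.
have [b /= b0 hB] := (nbhs_ballP _ _).1 nB.
have mA : measurable (ball x.1 a : set (measurableTypeR R)) by exact: measurable_ball.
have mB : measurable (ball x.2 b : set (measurableTypeR R)) by exact: measurable_ball.
have e := @product_measure1E _ _ _ _ R (@lebesgue_measure R) (@lebesgue_measure R) _ _ mA mB.
apply: (@lt_le_trans _ _ (leb2 R (ball x.1 a `*` ball x.2 b))).
  apply: (@eq_ind_r _ _ (fun z => (0 < z)%E) _ _ e); apply: mule_gt0.
    apply: (@eq_ind_r _ _ (fun z => (0 < z)%E) _ _ (lebesgue_measure_ball x.1 (ltW a0))).
    by rewrite lte_fin pmulrn_lgt0.
  apply: (@eq_ind_r _ _ (fun z => (0 < z)%E) _ _ (lebesgue_measure_ball x.2 (ltW b0))).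
  by rewrite lte_fin pmulrn_lgt0.
apply: le_measure; rewrite ?inE; first exact: measurableX.
- exact: measurable_open_plane.
- by move=> z [z1 z2]; apply: AB; split; [exact: hA|exact: hB].
Qed.

Lemma continuous_disk_integrable f : continuous f -> (leb2 R).-integrable Om (EFin \o f).
Proof.
move=> cf; have [C C0 h] := continuous_box_bounded rho cf.
apply: (@Rint_bounded _ _ _ _ _ _ C); first exact: measurable_disk.
- exact: disk_lty.
- by apply: measurable_funTS; exact: continuous_measurable_plane.
- by move=> x /(disk_box rho0); exact: h.
Qed.

Lemma Rintegral_continuous_gt0 f x : continuous f -> (forall z, 0 <= f z) ->
  Om x -> 0 < f x -> 0 < \int[leb2 R]_(z in Om) f z.
Proof.
move=> cf f0 Ox fx; have mO : measurable (Om : set plane) := measurable_disk rho0.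
have fi := continuous_disk_integrable cf.
rewrite lt_neqAle Rintegral_ge0// andbT eq_sym; apply/eqP => I0.
have H := Rintegral_ae0_le mO fi (fun z _ => f0 z) I0.
pose V := Om `&` f @^-1` `]0, +oo[%classic.
have oV : open V.
  by apply: openI; [exact: open_disk|move/continuousP : cf; apply; exact: interval_open].
have Vx : V x by split => //; rewrite /= in_itv /= fx.
suff : (leb2 R V = 0)%E by move=> V0; have := open_measure_gt0 oV Vx; rewrite V0 ltxx.
apply: measure_negligible; first exact: measurable_open_plane.
apply: negligibleS H => z [Oz]; rewrite /= in_itv /= andbT => fz /(_ Oz) /eqP.
by rewrite gt_eqF.
Qed.

(** The eigenvalue of the Neumann Laplacian that belongs to the mode [u1]. *)
Definition first_mode_rate : R := (j / rho) ^+ 2.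

Lemma u1star_eigfun : u1star rho j = eigfun first_mode_rate (j / (2 * rho)).
Proof.
apply/funext => x; rewrite /u1star besselJ1E /eigfun.
have rn : rho != 0 by rewrite gt_eqF.
have -> : (j * enorm x / rho) ^+ 2 = first_mode_rate * sqn x.
  have <- : enorm x ^+ 2 = sqn x by rewrite /enorm sqr_sqrtr// sqn_ge0.
  by rewrite /first_mode_rate; field.
move: (besselB _) => b.
have [e0|en0] := eqVneq (enorm x) 0; last by field; rewrite en0 rn.
have -> : x.1 = 0.
  apply/eqP; rewrite -sqrf_eq0 eq_le sqr_ge0 andbT.
  have : sqn x = 0 by rewrite -(sqr_sqrtr (sqn_ge0 x)) -/(enorm x) e0 expr0n.
  by rewrite /sqn => <-; rewrite lerDl sqr_ge0.
by rewrite mul0r !mulr0 mul0r mulr0.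
Qed.

Lemma pd1_eigfun0 m k : pd1 (eigfun m k) (0, 0) = k :> R.
Proof.
by rewrite pd1_eigfun /sqn /= expr0n /= addr0 mulr0 besselB0 mulr0 mul0r addr0 mulr1.
Qed.

Lemma disk0 : Om (0, 0).
Proof. by rewrite diskE// /sqn /= expr0n addr0 exprn_gt0. Qed.

(** Its gradient at the centre does not vanish. *)
Lemma eigfun_nonzero m k : k != 0 -> exists2 x, Om x & eigfun m k x != 0.
Proof.
move=> k0; have [//|H] := pselect (exists2 x, Om x & eigfun m k x != 0).
move: k0; rewrite -(pd1_eigfun0 m k) near0_pd1 ?eqxx//.
apply: filterS (open_nbhs_nbhs (conj (open_disk rho0) disk0)) => x Ox.
by apply: contrapT => /eqP Ex; apply: H; exists x.
Qed.

(** The normalizing factor is a finite nonzero number, since the mode is bounded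
    and does not vanish identically. *)
Lemma u1_eigfun : exists2 k : R, k != 0 & u1 rho j = eigfun first_mode_rate k.
Proof.
have mO : measurable (Om : set plane) := measurable_disk rho0.
set E := eigfun first_mode_rate (j / (2 * rho)).
have sE : smooth E by exact: smooth_eigfun.
have cE : continuous E by exact: smooth_cont.
have mE : measurable_fun (Om : set plane) E.
  by apply: measurable_funTS; exact: smooth_measurable.
have c2 : continuous (fun x => E x * E x) by move=> x; apply: cvgM; exact: cE.
have i2 := continuous_disk_integrable c2.
have sqrE x : `|E x| `^ 2 = E x * E x.
  by rewrite -[2]/(2%:R) powR_mulrn// -normrX expr2 ger0_norm// -expr2 sqr_ge0.
have two0 : (2 : R) != 0 by [].
have NE := @Lp_norm_powE R rho 2 E two0.
have Nlt : (Lp_norm Om 2 E < +oo)%E.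
  rewrite ltey; apply/eqP => Noo; move: NE; rewrite Noo poweRyr// => NE.
  have : (\int[leb2 R]_(x in Om) (E x * E x)%:E)%E \is a fin_num by exact: integrable_fin_num i2.
  by rewrite (_ : (\int[_]_(x in _) _)%E = +oo%E)// NE; apply: eq_integral => x _; rewrite sqrE.
have [_ NI] := Lp_norm_integrable (ltr0Sn R 1) mE Nlt.
have [x Ox Ex] : exists2 x, Om x & E x != 0.
  by apply: eigfun_nonzero; rewrite mulf_neq0// ?invr_neq0// ?mulf_neq0// gt_eqF.
have I0 : 0 < \int[leb2 R]_(x in Om) (E x * E x).
  apply: (@Rintegral_continuous_gt0 _ x) => // [z|]; rewrite -expr2 ?sqr_ge0//.
  by rewrite exprn_even_gt0.
have N0 : fine (Lp_norm Om 2 E) != 0.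
  apply/eqP => h; move: I0; rewrite (_ : \int[leb2 R]_(x in Om) (E x * E x) = 0) ?ltxx//.
  move: NI; rewrite h powR0// => NI; rewrite -[RHS]NI.
  by apply: eq_Rintegral => z _; rewrite sqrE.
exists (j / (2 * rho) / fine (Lp_norm Om 2 E)).
  by rewrite !mulf_neq0// ?invr_neq0// ?mulf_neq0// gt_eqF.
apply/funext => z; rewrite /u1 u1star_eigfun -/E.
by rewrite [in LHS]/E /eigfun mulrAC.
Qed.

Lemma is_derive_psum_scale (c : nat -> R) m s : exp_bounded c ->
  is_derive s (1:R) (fun s => psum c (m * s)) (m * psum (pseries_diffs c) (m * s)).
Proof.
move=> bc; have d0 := is_deriveM (is_derive_cst m s (1:R)) (is_derive_id s (1:R)).
have d : is_derive s (1:R) (fun s => m * s) m.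
  by apply: (is_derive_eq d0); rewrite /GRing.scale /=; ring.
have H := @is_derive1_comp R (psum c) _ s _ _ (is_derive_psum (m * s) bc) d.
by apply: (is_derive_eq H); rewrite mulrC.
Qed.

Lemma continuous_psum_scale (c : nat -> R) m : exp_bounded c ->
  continuous (fun s : R => psum c (m * s)).
Proof.
move=> bc s; apply/differentiable_continuous/derivable1_diffP.
by have [] := is_derive_psum_scale m s bc.
Qed.

(** The Neumann condition for the eigenfunction, in quantitative form: the
    radial derivative vanishes on the circle because J_1' vanishes at [j], hence
    to first order in the distance to the circle. *)
Lemma eigfun_neumann k : derive1 (@besselJ1 R) j = 0 ->
  exists B, forall x, Om x ->
    `|x.1 * pd1 (eigfun first_mode_rate k) x + x.2 * pd2 (eigfun first_mode_rate k) x|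
    <= B * (rho ^+ 2 - sqn x).
Proof.
move=> hj; set m := first_mode_rate.
pose b0 := bessel_coeff_bounded R; pose b1 := exp_bounded_diffs b0.
pose b2 := exp_bounded_diffs b1.
pose P s := besselB (m * s) + (2 * m * s) * besselB' (m * s).
pose dP s := 3 * m * besselB' (m * s) + 2 * m ^+ 2 * s * besselB'' (m * s).
have dPP s : is_derive s (1:R) P (dP s).
  have d1 := is_derive_psum_scale m s b0; have d2 := is_derive_psum_scale m s b1.
  have d3 := is_deriveM (is_derive_cst (2 * m) s (1:R)) (is_derive_id s (1:R)).
  have d4 := is_deriveD d1 (is_deriveM d3 d2).
  apply: (is_derive_eq d4); rewrite /GRing.scale /= /dP /besselB' /besselB''.
  by change ((cst (2 * m) * id) s) with (2 * m * s); ring.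
have cdP : continuous dP.
  move=> s; apply: cvgD; apply: cvgM; try exact: cvg_cst.
  - exact: continuous_psum_scale.
  - by apply: cvgM; [exact: cvg_cst|exact: cvg_id].
  - exact: continuous_psum_scale.
have cdP2 : continuous (fun x : R * R => dP x.1).
  by move=> x; apply: (@continuous_comp _ _ _ fst dP); [exact: cvg_fst|exact: cdP].
have [C C0 hC] := continuous_box_bounded (rho ^+ 2) cdP2.
have P0 : P (rho ^+ 2) = 0.
  have rn : rho != 0 by rewrite gt_eqF.
  have E : m * rho ^+ 2 = j ^+ 2 by rewrite /m /first_mode_rate; field.
  rewrite /P -[2 * m * _]mulrA E; move: hj; rewrite derive1_besselJ1 => /eqP.
  by rewrite mulf_eq0 invr_eq0 pnatr_eq0 /= orbF => /eqP.
exists (`|k| * rho * C) => x Ox; rewrite eigfun_radial_derivative.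
have sx : sqn x < rho ^+ 2 by move: Ox; rewrite diskE.
have cP : continuous P.
  by move=> s; apply/differentiable_continuous/derivable1_diffP; have [] := dPP s.
have [c cI hc] := @MVT_segment R P dP (sqn x) (rho ^+ 2) (ltW sx) (fun s _ => dPP s)
  (continuous_subspaceT cP).
have -> : besselB (m * sqn x) + 2 * (m * sqn x) * besselB' (m * sqn x) = P (sqn x).
  by rewrite /P !mulrA.
have -> : P (sqn x) = - (dP c * (rho ^+ 2 - sqn x)) by rewrite -hc P0 sub0r opprK.
rewrite mulrN normrN !normrM [`|rho ^+ 2 - sqn x|]gtr0_norm ?subr_gt0//.
have [x1 _] := (boxP _ _).1 (disk_box rho0 Ox).
rewrite mulrA; apply: ler_wpM2r; first by rewrite subr_ge0 ltW.
apply: ler_pM => //; first by rewrite ler_wpM2l.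
apply: (hC (c, 0)); apply/boxP => /=; rewrite normr0 exprn_ge0 ?(ltW rho0)//; split => //.
move: cI; rewrite in_itv /= => /andP[c1 c2].
by rewrite ger0_norm//; apply: le_trans c1; exact: sqn_ge0.
Qed.

End first_mode.

(** * The bifurcation identity and its cubic term *)

Section cubic_density.
Variable R : realType.
Implicit Types (s a b c d u v M : R).

(** The density of the cubic correction of the flux at the gradient
    [s (a, b)], tested against [(c, d)]. *)
Definition cubic_density s a b c d : R :=
  (a ^+ 2 + b ^+ 2) * (a * c + b * d) /
  (slope (s * a, s * b) * (slope (s * a, s * b) + 1)).

Lemma flux_cubic s a b c d :
  (s * a * c + s * b * d) - (flux (s * a, s * b) * c + flux (s * b, s * a) * d) =
  s ^+ 3 * cubic_density s a b c d.
Proof.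
rewrite /flux /= [slope (s * b, s * a)]slopeC /cubic_density.
have := slope2 (s * a, s * b); rewrite /=; have := slope_gt0 (s * a, s * b).
move: (slope _) => w w0 w2; have wn : w != 0 by rewrite gt_eqF.
have w1 : w + 1 != 0 by rewrite gt_eqF// addr_gt0.
apply: (mulIf (mulf_neq0 wn w1)).
have -> : s ^+ 3 * ((a ^+ 2 + b ^+ 2) * (a * c + b * d) / (w * (w + 1))) * (w * (w + 1)) =
  s * (a * c + b * d) * ((s * a) ^+ 2 + (s * b) ^+ 2) by field; rewrite wn w1.
have -> : (s * a) ^+ 2 + (s * b) ^+ 2 = w ^+ 2 - 1 by rewrite w2; ring.
by field.
Qed.

Lemma cubic_density_den s a b : `|s| <= 1 ->
  2 <= slope (s * a, s * b) * (slope (s * a, s * b) + 1) <= 2 * (1 + (a ^+ 2 + b ^+ 2)).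
Proof.
move=> s1; have := slope2 (s * a, s * b); rewrite /=.
have := slope_ge1 (s * a, s * b); move: (slope _) => w w1 w2.
have s2 : s ^+ 2 <= 1 by rewrite -real_normK ?num_real// exprn_ile1.
apply/andP; split; first nra.
have : w ^+ 2 <= 1 + (a ^+ 2 + b ^+ 2).
  rewrite w2 lerD2l !exprMn -mulrDr ler_piMl//.
  by rewrite addr_ge0// sqr_ge0.
nra.
Qed.

Lemma cubic_density_upper s c d u v : `|s| <= 1 ->
  `|cubic_density s (c + u) (d + v) c d| <=
  3 * (c ^+ 2 + d ^+ 2) ^+ 2 + 3 * (u ^+ 2 + v ^+ 2) ^+ 2.
Proof.
move=> s1; have /andP[W2 _] := cubic_density_den (c + u) (d + v) s1.
rewrite /cubic_density; move: (slope _ * _) W2 => W W2.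
have W0 : 0 < W by apply: lt_le_trans W2.
rewrite normrM normfV (gtr0_norm W0) ler_pdivrMr// normrM.
set E := c ^+ 2 + d ^+ 2; set Z := u ^+ 2 + v ^+ 2.
set X := (c + u) ^+ 2 + (d + v) ^+ 2; set I := (c + u) * c + (d + v) * d.
have E0 : 0 <= E by rewrite addr_ge0// sqr_ge0.
have Z0 : 0 <= Z by rewrite addr_ge0// sqr_ge0.
have X0 : 0 <= X by rewrite addr_ge0// sqr_ge0.
have XE : X <= 2 * E + 2 * Z.
  rewrite /X /E /Z; have h1 := sqr_ge0 (c - u); have h2 := sqr_ge0 (d - v); nra.
have IE : `|I| <= (X + E) / 2.
  rewrite ler_norml /I /X /E; apply/andP; split.
    have h1 := sqr_ge0 (c + u + c); have h2 := sqr_ge0 (d + v + d); nra.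
  have h1 := sqr_ge0 u; have h2 := sqr_ge0 v; nra.
rewrite (ger0_norm X0).
have XI : X * `|I| <= (2 * E + 2 * Z) * ((3 * E + 2 * Z) / 2).
  by apply: ler_pM => //; apply: (le_trans IE); lra.
apply: (le_trans XI); apply: (@le_trans _ _ ((3 * E ^+ 2 + 3 * Z ^+ 2) * 2)).
  have h := sqr_ge0 (E - Z); nra.
by apply: ler_wpM2l => //; rewrite addr_ge0// mulr_ge0// sqr_ge0.
Qed.

(** Where [(u, v)] is at most half as long as [(c, d)] the density is comparable
    to its unperturbed value; elsewhere [(u, v)] controls everything. *)
Lemma cubic_density_lower s c d u v M : `|s| <= 1 -> c ^+ 2 + d ^+ 2 <= M ->
  (8 * (2 + 5 * M))^-1 * (c ^+ 2 + d ^+ 2) ^+ 2 - 100 * (u ^+ 2 + v ^+ 2) ^+ 2 <=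
  cubic_density s (c + u) (d + v) c d.
Proof.
move=> s1 EM; have U := cubic_density_upper c d u v s1.
have /andP[W2 WX] := cubic_density_den (c + u) (d + v) s1.
move: U W2 WX; rewrite /cubic_density; move: (slope _ * _) => W.
set E := c ^+ 2 + d ^+ 2 in EM *; set Z := u ^+ 2 + v ^+ 2.
set X := (c + u) ^+ 2 + (d + v) ^+ 2; set I := (c + u) * c + (d + v) * d.
move=> U W2 WX; have W0 : 0 < W by apply: lt_le_trans W2.
have E0 : 0 <= E by rewrite addr_ge0// sqr_ge0.
have Z0 : 0 <= Z by rewrite addr_ge0// sqr_ge0.
have X0 : 0 <= X by rewrite addr_ge0// sqr_ge0.
have D0 : 0 < 2 + 5 * M by lra.
have XE : X <= 2 * E + 2 * Z.
  rewrite /X /E /Z; have h1 := sqr_ge0 (c - u); have h2 := sqr_ge0 (d - v); nra.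
have [ZE|EZ] := leP (4 * Z) E.
  have IE : E / 2 <= I.
    have : 3 / 4 * E - Z <= I.
      rewrite /I /E /Z; have h1 := sqr_ge0 (c / 2 + u); have h2 := sqr_ge0 (d / 2 + v); nra.
    lra.
  have XE4 : E / 4 <= X.
    have : E / 2 - Z <= X.
      rewrite /X /E /Z; have h1 := sqr_ge0 (c + 2 * u); have h2 := sqr_ge0 (d + 2 * v); nra.
    lra.
  apply: (@le_trans _ _ ((8 * (2 + 5 * M))^-1 * E ^+ 2)).
    by rewrite gerBl mulr_ge0// sqr_ge0.
  rewrite ler_pdivlMr// mulrAC -mulrA mulrC -ler_pdivlMr ?invr_gt0 ?mulr_gt0// invrK.
  have WM : W <= 2 + 5 * M by lra.
  have XI : (E / 4) * (E / 2) <= X * I by apply: ler_pM => //; rewrite divr_ge0.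
  have H : W * E ^+ 2 <= (2 + 5 * M) * E ^+ 2 by apply: ler_wpM2r => //; exact: sqr_ge0.
  have H' : (E / 4) * (E / 2) * (8 * (2 + 5 * M)) <= X * I * (8 * (2 + 5 * M)).
    by apply: ler_wpM2r => //; rewrite mulr_ge0// ltW.
  rewrite mulrC; nra.
have E16 : E ^+ 2 <= 16 * Z ^+ 2 by nra.
have c1 : (8 * (2 + 5 * M))^-1 <= 1 by rewrite invf_le1; lra.
have cE : (8 * (2 + 5 * M))^-1 * E ^+ 2 <= E ^+ 2 by apply: ler_piMl => //; exact: sqr_ge0.
move: U; rewrite ler_norml => /andP[U _]; apply: le_trans U.
have := sqr_ge0 Z; lra.
Qed.

End cubic_density.

Section energy.
Variables (R : realType) (rho : R).
Hypothesis rho0 : 0 < rho.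
Notation plane := (measurableTypeR R * measurableTypeR R)%type.
Notation Om := (disk rho).
Implicit Types (h z p q U : R * R -> R) (x : R * R).

Definition cubic_term s U p q x : R :=
  cubic_density s (pd1 U x + p x) (pd2 U x + q x) (pd1 U x) (pd2 U x).

Let mO : measurable (Om : set plane) := measurable_disk rho0.

Lemma smooth_disk_integrable f : smooth f -> (leb2 R).-integrable Om (EFin \o f).
Proof. by move=> sf; apply: continuous_disk_integrable => //; exact: smooth_cont. Qed.

Lemma measurable_fun_flux p q : measurable_fun (Om : set plane) p ->
  measurable_fun (Om : set plane) q -> measurable_fun (Om : set plane) (fun x => flux (p x, q x)).
Proof. by move=> mp mq; exact: (measurable_on_comp2 rho0 (@continuous_flux R) mp mq). Qed.

Lemma flux_mul_integrable p q U : measurable_fun (Om : set plane) p ->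
  measurable_fun (Om : set plane) q -> smooth U ->
  (leb2 R).-integrable Om (EFin \o (fun x => flux (p x, q x) * U x)).
Proof.
move=> mp mq sU; have mf := measurable_fun_flux mp mq.
apply: smooth_mul_integrable => //; apply: (@Rint_bounded _ _ _ _ _ _ 1) => //.
  exact: disk_lty.
by move=> x _; exact: flux_le1.
Qed.

(** The equation for h and the linear equation for U, each tested with the other
    function, have the same left side up to the cubic part of the flux; dividing
    by [s] compares [al] with the eigenvalue [m]. *)
Lemma bifurcation_identity m B s al h z p q U : s != 0 ->
  (forall a b, (a + b <= 2)%N -> is_wderiv Om a b h (wD Om a b h)) ->
  ae_eq_on Om (Fop rho al h) (cst 0) -> neumann rho h ->
  is_wderiv Om 1 0 z p -> is_wderiv Om 0 1 z q ->
  (leb2 R).-integrable Om (EFin \o z) -> (leb2 R).-integrable Om (EFin \o p) ->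
  (leb2 R).-integrable Om (EFin \o q) -> smooth U ->
  (forall x, pd1 (pd1 U) x + pd2 (pd2 U) x = - (m * U x)) ->
  (forall x, Om x -> `|x.1 * pd1 U x + x.2 * pd2 U x| <= B * (rho ^+ 2 - sqn x)) ->
  ae_eq_on Om h (fun x => s * (U x + z x)) ->
  (leb2 R).-integrable Om (EFin \o cubic_term s U p q) /\
  (m - al) * \int[leb2 R]_(x in Om) ((U x + z x) * U x) =
  s ^+ 2 * \int[leb2 R]_(x in Om) cubic_term s U p q x.
Proof.
move=> s0 Wh Fh Nh Wp Wq zi pi qi sU helm bU hE.
have s1 := smooth_pd1 sU; have s2 := smooth_pd2 sU.
have lh : L1loc Om h by have [] := Wh 0%N 0%N isT.
have mh : measurable_fun (Om : set plane) h by have [] := lh.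
have Ui := smooth_disk_integrable sU.
have Uzi := RintD mO Ui zi.
have hi : (leb2 R).-integrable Om (EFin \o h).
  apply: (Rint_ae_eq mO mh _ (RintZ s mO Uzi)).
  by apply: ae_mono hE => x H Ox; rewrite H.
have EUz : (fun x => s * U x + s * z x) = (fun x => s * (U x + z x)).
  by apply/funext => x; rewrite mulrDr.
have hE' : ae_eq_on Om (fun x => s * U x + s * z x) h.
  by rewrite EUz; apply: ae_mono hE => x H Ox; rewrite H.
pose P x := s * pd1 U x + s * p x; pose Q x := s * pd2 U x + s * q x.
have WP : is_wderiv Om 1 0 h P.
  exact: (is_wderiv_mono rho0 (is_wderiv_lin rho0 s s (is_wderiv_smooth1 rho0 sU) Wp) lh hE').
have WQ : is_wderiv Om 0 1 h Q.
  exact: (is_wderiv_mono rho0 (is_wderiv_lin rho0 s s (is_wderiv_smooth2 rho0 sU) Wq) lh hE').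
have Pi : (leb2 R).-integrable Om (EFin \o P).
  by apply: (RintD mO (RintZ s mO _) (RintZ s mO pi)); exact: smooth_disk_integrable.
have Qi : (leb2 R).-integrable Om (EFin \o Q).
  by apply: (RintD mO (RintZ s mO _) (RintZ s mO qi)); exact: smooth_disk_integrable.
have G := green_helmholtz rho0 WP WQ hi Pi Qi sU helm bU.
have F := flux_weak_boundary rho0 Wh Fh Nh hi sU.
have aeP := wderiv_ae_unique rho0 (wDP WP) WP.
have aeQ := wderiv_ae_unique rho0 (wDP WQ) WQ.
have mP := Rint_measurable Pi; have mQ := Rint_measurable Qi.
have [_ [mdP _] _] := wDP WP; have [_ [mdQ _] _] := wDP WQ.
have iF := RintD mO (flux_mul_integrable mP mQ s1) (flux_mul_integrable mQ mP s2).
have iD := RintD mO (flux_mul_integrable mdP mdQ s1) (flux_mul_integrable mdQ mdP s2).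
have EF : \int[leb2 R]_(x in Om) (flux (P x, Q x) * pd1 U x + flux (Q x, P x) * pd2 U x) =
    al * \int[leb2 R]_(x in Om) (h x * U x).
  refine (etrans _ F); apply: ae_eq_Rintegral => //; [exact: Rint_measurable iF|exact: Rint_measurable iD|].
  by apply: ae_mono2 aeP aeQ => x H1 H2 Ox; rewrite (H1 Ox) (H2 Ox).
have iG := RintD mO (smooth_mul_integrable rho0 Pi s1) (smooth_mul_integrable rho0 Qi s2).
have TE x : cubic_term s U p q x = s ^- 3 * ((P x * pd1 U x + Q x * pd2 U x) -
    (flux (P x, Q x) * pd1 U x + flux (Q x, P x) * pd2 U x)).
  have := flux_cubic s (pd1 U x + p x) (pd2 U x + q x) (pd1 U x) (pd2 U x).
  rewrite ![s * (_ + _)]mulrDr -/(P x) -/(Q x) => ->.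
  by rewrite mulrA mulVf ?expf_neq0// mul1r.
have iT : (leb2 R).-integrable Om (EFin \o cubic_term s U p q).
  by rewrite (funext TE); exact: (RintZ _ mO (RintB mO iG iF)).
split => //.
have IT : \int[leb2 R]_(x in Om) cubic_term s U p q x =
    s ^- 3 * ((m - al) * \int[leb2 R]_(x in Om) (h x * U x)).
  rewrite (funext TE) (RintegralZl _ mO (RintB mO iG iF)) (RintegralB mO iG iF).
  by rewrite mulrBl -EF -G.
have Ih : \int[leb2 R]_(x in Om) (h x * U x) = s * \int[leb2 R]_(x in Om) ((U x + z x) * U x).
  have iUzU := smooth_mul_integrable rho0 Uzi sU.
  rewrite -(RintegralZl s mO iUzU); apply: ae_eq_Rintegral => //.
  - exact: Rint_measurable (smooth_mul_integrable rho0 hi sU).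
  - exact: Rint_measurable (RintZ s mO iUzU).
  - by apply: ae_mono hE => x H Ox; rewrite (H Ox) mulrA.
rewrite IT Ih; move: (\int[_]_(x in _) _) => y; field; exact: s0.
Qed.

Lemma mul_smooth_integral_le f U C : (leb2 R).-integrable Om (EFin \o f) -> smooth U ->
  (forall x, Om x -> `|U x| <= C) ->
  `|\int[leb2 R]_(x in Om) (f x * U x)| <= C * \int[leb2 R]_(x in Om) `|f x|.
Proof.
move=> fi sU UC; have nf := Rint_norm fi.
rewrite -(RintegralZl C mO nf); apply: Rintegral_le_norm => //.
- exact: smooth_mul_integrable.
- exact: RintZ.
- by move=> x Ox; rewrite normrM mulrC; apply: ler_wpM2r => //; exact: UC.
Qed.

(** The fourth power of the L^4 norm of the gradient, whose positivity makes the
    bifurcation subcritical. *)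
Definition grad4 U : R := \int[leb2 R]_(x in Om) (pd1 U x ^+ 2 + pd2 U x ^+ 2) ^+ 2.

Lemma grad4_integrable U : smooth U ->
  (leb2 R).-integrable Om (EFin \o (fun x => (pd1 U x ^+ 2 + pd2 U x ^+ 2) ^+ 2)).
Proof.
move=> sU; have s1 := smooth_pd1 sU; have s2 := smooth_pd2 sU.
have -> : (fun x => (pd1 U x ^+ 2 + pd2 U x ^+ 2) ^+ 2) =
  (fun x => (pd1 U x * pd1 U x + pd2 U x * pd2 U x) * (pd1 U x * pd1 U x + pd2 U x * pd2 U x)).
  by apply/funext => x; ring.
by apply: smooth_disk_integrable; apply: smooth_mul; apply: smooth_add; exact: smooth_mul.
Qed.

Lemma grad4_gt0 U : smooth U -> pd1 U (0, 0) != 0 -> 0 < grad4 U.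
Proof.
move=> sU U0; have s1 := smooth_pd1 sU; have s2 := smooth_pd2 sU.
apply: (@Rintegral_continuous_gt0 R rho rho0 _ (0, 0)).
- have -> : (fun x => (pd1 U x ^+ 2 + pd2 U x ^+ 2) ^+ 2) =
    (fun x => (pd1 U x * pd1 U x + pd2 U x * pd2 U x) * (pd1 U x * pd1 U x + pd2 U x * pd2 U x)).
    by apply/funext => x; ring.
  by apply: smooth_cont; apply: smooth_mul; apply: smooth_add; exact: smooth_mul.
- by move=> x; exact: sqr_ge0.
- exact: disk0.
- by rewrite exprn_even_gt0//= paddr_eq0 ?sqr_ge0// !sqrf_eq0 (negbTE U0).
Qed.

(** The pointwise bounds are integrated with |(p, q)|^4 <= 2 (p^4 + q^4), which
    leaves only the integrals that [Lp_norm_small] makes small. *)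
Lemma cubic_term_bounds s U p q M : `|s| <= 1 -> smooth U ->
  (forall x, Om x -> pd1 U x ^+ 2 + pd2 U x ^+ 2 <= M) ->
  (leb2 R).-integrable Om (EFin \o cubic_term s U p q) ->
  (leb2 R).-integrable Om (EFin \o (fun x => `|p x| ^+ 4)) ->
  (leb2 R).-integrable Om (EFin \o (fun x => `|q x| ^+ 4)) ->
  let Z := \int[leb2 R]_(x in Om) (`|p x| ^+ 4) + \int[leb2 R]_(x in Om) (`|q x| ^+ 4) in
  (8 * (2 + 5 * M))^-1 * grad4 U - 200 * Z <=
    \int[leb2 R]_(x in Om) cubic_term s U p q x <= 3 * grad4 U + 6 * Z.
Proof.
move=> s1 sU UM iT ip iq; have iE := grad4_integrable sU; have iZ := RintD mO ip iq.
rewrite /= /grad4 -(RintegralD mO ip iq).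
have sq4 x : (p x ^+ 2 + q x ^+ 2) ^+ 2 <= 2 * (`|p x| ^+ 4 + `|q x| ^+ 4).
  rewrite -[p x ^+ 2]real_normK ?num_real// -[q x ^+ 2]real_normK ?num_real//.
  move: `|p x| `|q x| => a b; have := sqr_ge0 (a ^+ 2 - b ^+ 2).
  by rewrite -subr_ge0 => h; rewrite -subr_ge0; apply: le_trans h _; rewrite le_eqVlt; apply/orP; left; apply/eqP; ring.
apply/andP; split.
  rewrite -(RintegralZl _ mO iE) -(RintegralZl _ mO iZ).
  rewrite -(RintegralB mO (RintZ _ mO iE) (RintZ _ mO iZ)).
  apply: le_Rintegral => //; first exact: (RintB mO (RintZ _ mO iE) (RintZ _ mO iZ)).
  move=> x Ox; apply: le_trans (cubic_density_lower (p x) (q x) s1 (UM x Ox)).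
  by rewrite lerD2l lerN2; have := sq4 x; lra.
rewrite -(RintegralZl _ mO iE) -(RintegralZl _ mO iZ).
rewrite -(RintegralD mO (RintZ _ mO iE) (RintZ _ mO iZ)).
apply: le_Rintegral => //; first exact: (RintD mO (RintZ _ mO iE) (RintZ _ mO iZ)).
move=> x Ox; apply: (le_trans (ler_norm _)).
apply: (le_trans (cubic_density_upper (pd1 U x) (pd2 U x) (p x) (q x) s1)).
by rewrite lerD2l; have := sq4 x; lra.
Qed.

End energy.

(** * The sign of the derivative along the branch *)

Section branch_calculus.
Variable R : realType.
Implicit Types (f : R -> R) (m c C d eta s t : R).

Lemma dnbhs0P (P : R -> Prop) : (\forall t \near (0:R)^', P t) ->
  exists2 d, 0 < d & forall t, 0 < `|t| < d -> P t.
Proof.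
rewrite /dnbhs /within => /nbhs_ballP [d /= d0 H]; exists d => // t /andP[t0 td].
by apply: H; [rewrite /ball /= sub0r normrN|rewrite -normr_gt0].
Qed.

Lemma cvg_punctured f l : f t @[t --> (0:R)] --> (l:R) -> f t @[t --> (0:R)^'] --> l.
Proof.
move=> h P /h nP; change (nbhs (0:R) (f @^-1` P)) in nP.
change (nbhs (0:R) [set t | t != 0 -> (f @^-1` P) t]).
by apply: filterS nP => t Pt _.
Qed.

Lemma cvg_derive0 f : derivable f 0 1 ->
  t^-1 * (f t - f 0) @[t --> (0:R)^'] --> derive1 f 0.
Proof.
move=> df; rewrite derive1E.
have H : (fun t : R => t^-1 *: (f (t *: (1:R) + 0) - f 0)) @ (0:R)^' --> 'D_1 f 0 := df.
have E : (fun t : R => t^-1 * (f t - f 0)) = (fun t : R => t^-1 *: (f (t *: (1:R) + 0) - f 0)).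
  by apply/funext => t; rewrite /GRing.scale /= mulr1 addr0.
by rewrite E.
Qed.

(** A quadratic upper bound only says that f has a strict maximum at 0; the
    mean value theorem then forces f'(t)/t below -c along some points tending
    to 0, so that f''(0) is negative, and this gives the sign of f' nearby. *)
Lemma derive1_sign_of_quadratic_max f m c C d eta : 0 < c -> 0 < d -> 0 < eta ->
  (forall s, `|s| < eta -> derivable f s 1) -> derivable (derive1 f) 0 1 ->
  (forall s, 0 < `|s| < d -> m - C * s ^+ 2 <= f s <= m - c * s ^+ 2) ->
  exists2 delta, 0 < delta <= eta &
    forall s, 0 < `|s| < delta -> s * derive1 f s < 0.
Proof.
move=> c0 d0 eta0 df ddf bnd.
have f0 : f 0 = m.
  have cf : f t @[t --> (0:R)^'] --> f 0.
    apply: cvg_punctured.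
    by apply/differentiable_continuous/derivable1_diffP; apply: df; rewrite normr0.
  have q k : m - k * t ^+ 2 @[t --> (0:R)^'] --> m.
    rewrite -[X in _ --> X]subr0; apply: cvgB; first exact: cvg_cst.
    rewrite -[X in _ --> X](mulr0 k); apply: cvgM; first exact: cvg_cst.
    have c2 : (t * t : R) @[t --> (0:R)] --> (0 * 0 : R) by apply: cvgM; exact: cvg_id.
    apply: cvg_punctured; rewrite mulr0 in c2.
    by rewrite (_ : (fun t : R => t ^+ 2) = (fun t => t * t)); [exact: c2|apply/funext => t; rewrite expr2].
  apply: (cvg_unique (@Rhausdorff R) cf).
  apply: (squeeze_cvgr _ (q C) (q c)).
  rewrite /dnbhs /within; apply/nbhs_ballP; exists d => // t; rewrite /ball /= sub0r normrN => td t0.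
  by apply: bnd; rewrite normr_gt0 t0.
pose e := Num.min d eta; have e0 : 0 < e by rewrite lt_min d0.
have ed : e <= d by rewrite ge_min lexx.
have eeta : e <= eta by rewrite ge_min lexx orbT.
have f'0 : derive1 f 0 = 0.
  have I0 : (0:R) \in `]- e, e[ by rewrite in_itv /= oppr_lt0 e0.
  have Ie t : t \in `]- e, e[ -> `|t| < e by rewrite in_itv /= ltr_norml.
  have H : is_derive (0:R) (1:R) f 0.
    apply: (derive1_at_max _ _ I0); first by rewrite ge0_cp// ltW.
    - by move=> t /Ie te; apply: df; exact: lt_le_trans eeta.
    - move=> t /Ie te; have [->//|tn] := eqVneq t 0.
      have td : 0 < `|t| < d by rewrite normr_gt0 tn (lt_le_trans te).
      have /andP[_ h] := bnd t td; rewrite f0; apply: (le_trans h).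
      by rewrite gerBl mulr_ge0 ?sqr_ge0// ltW.
  by rewrite derive1E; have [_] := H.
have L := cvg_derive0 ddf; rewrite f'0 in L.
have Lc : derive1 (derive1 f) 0 <= - c.
  rewrite leNgt; apply/negP => h.
  have [r r0 Hr] := dnbhs0P (cvgr_gt _ L _ h).
  pose t := Num.min r e / 2.
  have re0 : 0 < Num.min r e by rewrite lt_min r0.
  have t0 : 0 < t by rewrite divr_gt0.
  have tre : t < Num.min r e by rewrite ltr_pdivrMr// ltr_pMr// ltr1n.
  have tr : t < r by apply: (lt_le_trans tre); rewrite ge_min lexx.
  have te : t < e by apply: (lt_le_trans tre); rewrite ge_min lexx orbT.
  have dI s : s \in `[0, t] -> derivable f s 1.
    rewrite in_itv /= => /andP[s0 st]; apply: df; rewrite ger0_norm//.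
    by apply: le_lt_trans st _; exact: lt_le_trans eeta.
  have D s : s \in `]0, t[ -> is_derive s (1:R) f (derive1 f s).
    move=> hs; rewrite derive1E; apply: derivableP; apply: dI.
    by move: hs; rewrite !in_itv /= => /andP[/ltW -> /ltW ->].
  have [xi xiI E] := MVT t0 D (derivable_within_continuous dI).
  move: xiI; rewrite in_itv /= => /andP[xi0 xit].
  have td : 0 < `|t| < d by rewrite gtr0_norm// t0 (lt_le_trans te).
  have /andP[_ ft] := bnd t td.
  have := Hr xi; rewrite gtr0_norm// xi0 (lt_trans xit tr) subr0 => /(_ isT) hx.
  have hx' : - c * xi < derive1 f xi by rewrite mulrC -ltr_pdivlMl.
  move: ft; rewrite -f0 -lerBlDl E; rewrite subr0 => ft.
  have : derive1 f xi * t > - c * xi * t by rewrite ltr_pM2r.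
  have : c * xi * t < c * t * t by rewrite ltr_pM2r// ltr_pM2l.
  by move: ft; rewrite expr2; lra.
have Lneg : derive1 (derive1 f) 0 < 0 by apply: (le_lt_trans Lc); rewrite oppr_lt0.
have [r r0 Hr] := dnbhs0P (cvgr_lt _ L _ Lneg).
exists (Num.min r eta); first by rewrite lt_min r0 eta0 ge_min lexx orbT.
move=> s; rewrite lt_min => /and3P[s0 sr _].
have sn : s != 0 by rewrite -normr_gt0.
have := Hr s; rewrite s0 sr subr0 => /(_ isT) h.
have s2 : 0 < s ^+ 2 by rewrite exprn_even_gt0.
have -> : s * derive1 f s = s ^+ 2 * (s^-1 * derive1 f s) by field.
by rewrite pmulr_rlt0.
Qed.

End branch_calculus.

(** * The branch *)

Section solve.
Variable R : realFieldType.
Implicit Types (m al s c E U D T Z : R).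

Lemma quadratic_bounds_of_identity m al s c E U D T Z (Z' : R) :
  0 < c -> c <= 1 -> 0 < E -> 0 < U -> `|D| <= U / 2 ->
  Z <= c * E / 800 -> Z' <= c * E / 800 ->
  (m - al) * (U + D) = s ^+ 2 * T ->
  c * E - 200 * (Z + Z') <= T -> T <= 3 * E + 6 * (Z + Z') ->
  m - 8 * E / U * s ^+ 2 <= al <= m - c * E / (3 * U) * s ^+ 2.
Proof.
move=> c0 c1 E0 U0; rewrite ler_norml => /andP[D1 D2] Ze Z'e id T1 T2.
have cE : c * E <= E by rewrite ler_piMl// ltW.
have cE0 : 0 < c * E by rewrite mulr_gt0.
have UD : 0 < U + D by lra.
have T1' : c * E / 2 <= T by lra.
have T2' : T <= 4 * E by lra.
have -> : al = m - s ^+ 2 * T / (U + D) by rewrite -id mulfK ?gt_eqF//; ring.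
have Un : U != 0 by rewrite gt_eqF.
have upper : T / (U + D) <= 8 * E / U.
  rewrite ler_pdivrMr//; apply: (le_trans T2').
  have -> : 4 * E = 8 * E / U * (U / 2) by field.
  by apply: ler_wpM2l; [rewrite divr_ge0// ?mulr_ge0// ltW|lra].
have lower : c * E / (3 * U) <= T / (U + D).
  rewrite ler_pdivlMr//; apply: le_trans T1'.
  have -> : c * E / 2 = c * E / (3 * U) * (3 * U / 2) by field.
  by apply: ler_wpM2l; [rewrite divr_ge0// ?mulr_ge0// ltW|lra].
rewrite -[s ^+ 2 * T / _]mulrA [s ^+ 2 * _]mulrC; apply/andP; split; rewrite lerD2l lerN2.
- by apply: ler_wpM2r upper; exact: sqr_ge0.
- by apply: ler_wpM2r lower; exact: sqr_ge0.
Qed.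

Lemma mul_ratio_le (M U : R) : 0 <= M -> 0 <= U -> M * (U / (2 * (M + 1))) <= U / 2.
Proof.
move=> M0 U0; have M1 : 0 < 2 * (M + 1) by lra.
by rewrite mulrA ler_pdivrMr//; nra.
Qed.

End solve.

Section branch.
Variables (R : realType) (p rho j eta : R) (alpha : R -> R) (y : R -> R * R -> R).
Hypothesis p5 : 5 < p.
Hypothesis rho0 : 0 < rho.
Hypothesis j0 : 0 < j.
Hypothesis hj : derive1 (@besselJ1 R) j = 0.
Hypothesis eta0 : 0 < eta.
Notation plane := (measurableTypeR R * measurableTypeR R)%type.
Notation Om := (disk rho).
Notation h s := (fun x => s * u1 rho j x + y s x).
Hypothesis Yy : forall s, `|s| < eta -> Yspace rho p (y s).
Hypothesis y0 : ae_eq_on Om (y 0) (cst 0).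
Hypothesis y'0 : curve_deriv (Ynorm rho p) y 0 (cst 0).
Hypothesis Yh : forall s, `|s| < eta -> Yspace rho p (h s).
Hypothesis Fh : forall s, `|s| < eta -> ae_eq_on Om (Fop rho (alpha s) (h s)) (cst 0).

Let mO : measurable (Om : set plane) := measurable_disk rho0.

(** Written as the remainder in [curve_deriv], so that its norm tends to 0 by
    hypothesis. *)
Let z s x : R := s^-1 * (y (0 + s) x - y 0 x) - (cst 0 : R * R -> R) x.

Let wderiv_z s a b : `|s| < eta -> (a + b <= 2)%N -> is_wderiv Om a b (z s) (wD Om a b (z s)).
Proof.
move=> se ab; have [[Ws _] _ _] := Yy se.
have [[W0 _] _ _] : Yspace rho p (y 0) by apply: Yy; rewrite normr0.
have := is_wderiv_lin rho0 (s^-1) (- s^-1) (Ws a b ab) (W0 a b ab).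
rewrite (_ : (fun x => s^-1 * y s x + - s^-1 * y 0 x) = z s); first exact: wDP.
by apply/funext => x; rewrite /z add0r subr0 mulrBr mulNr.
Qed.

Let h_expansion s U : s != 0 -> u1 rho j = U ->
  ae_eq_on Om (h s) (fun x => s * (U x + z s x)).
Proof.
move=> s0 <-; apply: ae_mono y0 => x H Ox.
by rewrite /z add0r (H Ox) /= !subr0 mulrDr mulVKf.
Qed.

Let z_small e : 0 < e -> exists2 d, 0 < d & forall s, 0 < `|s| < d ->
  (Ynorm rho p (z s) < e%:E)%E.
Proof.
move=> e0; apply: dnbhs0P.
have N : nbhs (0%E : \bar R) [set x : \bar R | (x < e%:E)%E].
  by apply: open_nbhs_nbhs; split; [exact: open_ereal_lt_ereal|rewrite /= lte_fin].
exact: y'0 _ N.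
Qed.

(** As z s tends to 0 in the Sobolev norm, its gradient is negligible in L^4 and
    z s itself in L^1; in the bifurcation identity the factor of [m - al] then
    stays near the square integral of U, and the cubic term stays between two
    positive multiples of [grad4 U]. *)
Lemma branch_quadratic_bounds : exists m c C d : R, [/\ 0 < c, 0 < d &
  forall s, 0 < `|s| < d -> m - C * s ^+ 2 <= alpha s <= m - c * s ^+ 2].
Proof.
have [k k0 uE] := u1_eigfun rho0 j0; set m := first_mode_rate rho j in uE.
set U := eigfun m k in uE.
have sU : smooth U by exact: smooth_eigfun.
have s1 := smooth_pd1 sU; have s2 := smooth_pd2 sU.
have helm : forall x, pd1 (pd1 U) x + pd2 (pd2 U) x = - (m * U x) by exact: eigfun_helmholtz.
have [B bU] := eigfun_neumann rho0 k hj.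
have [M1 M10 hM1] := smooth_disk_bounded rho0 sU.
have [M M0 hM] : exists2 M, 0 <= M & forall x, Om x -> pd1 U x ^+ 2 + pd2 U x ^+ 2 <= M.
  have [M M0 hM] := smooth_disk_bounded rho0 (smooth_add (smooth_mul s1 s1) (smooth_mul s2 s2)).
  by exists M => // x /hM; rewrite -!expr2 => /(le_trans (ler_norm _)).
have E4 : 0 < grad4 rho U.
  by apply: grad4_gt0 => //; rewrite pd1_eigfun0.
have U2 : 0 < \int[leb2 R]_(x in Om) (U x * U x).
  have [x Ox Ux] := eigfun_nonzero rho0 m k0.
  have cUU := smooth_cont (smooth_mul sU sU).
  apply: (Rintegral_continuous_gt0 rho0 cUU _ Ox) => [w|]; rewrite -expr2 ?sqr_ge0//.
  by rewrite exprn_even_gt0.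
pose c1 := (8 * (2 + 5 * M))^-1.
have c10 : 0 < c1 by rewrite invr_gt0; lra.
have c11 : c1 <= 1 by rewrite invf_le1; lra.
set E4v := grad4 rho U in E4; set U2v := \int[leb2 R]_(x in Om) (U x * U x) in U2.
pose e1 := U2v / (2 * (M1 + 1)); pose e4 := c1 * E4v / 800.
have M1p : 0 < 2 * (M1 + 1) by rewrite mulr_gt0// ltr_wpDl.
have e10 : 0 < e1 by rewrite divr_gt0.
have k8 : 0 < 800 :> R by rewrite ltr0n.
have e40 : 0 < e4 := divr_gt0 (mulr_gt0 c10 E4) k8.
have p1 : 1%:R <= p by apply: ltW; apply: lt_trans p5; rewrite ltr_nat.
have p4 : 4%:R <= p by apply: ltW; apply: lt_trans p5; rewrite ltr_nat.
have p0 : 0 < p by apply: lt_le_trans p1.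
have [d1 d10 H1] := Lp_norm_small rho0 (ltn0Sn 0) p1 e10.
have [d4 d40 H4] := Lp_norm_small rho0 (ltn0Sn 3) p4 e40.
have dd0 : 0 < Num.min d1 d4 by rewrite lt_min d10.
have [d d0 Hd] := z_small dd0.
exists m, (c1 * E4v / (3 * U2v)), (8 * E4v / U2v), (Num.min d (Num.min eta 1)); split.
- by rewrite divr_gt0 ?mulr_gt0.
- by rewrite !lt_min d0 eta0 ltr01.
move=> s; rewrite !lt_min => /and4P[sp sd se s1'].
have sn : s != 0 by rewrite -normr_gt0.
have sle1 : `|s| <= 1 := ltW s1'.
have W a b : (a + b <= 2)%N -> is_wderiv Om a b (z s) (wD Om a b (z s)) by exact: wderiv_z.
have Ns a b : (a + b <= 2)%N -> (Lp_norm Om p (wD Om a b (z s)) < (Num.min d1 d4)%:E)%E.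
  move=> ab; apply: (le_lt_trans (Lp_norm_le_Wnorm _ _ _ _ ab)); apply: Hd.
  by rewrite sp sd.
have Nfin a b (ab : (a + b <= 2)%N) : (Lp_norm Om p (wD Om a b (z s)) < +oo)%E.
  by apply: (lt_trans (Ns _ _ ab)); exact: ltry.
have mw a b (ab : (a + b <= 2)%N) : measurable_fun (Om : set plane) (wD Om a b (z s)).
  by have [_ []] := W _ _ ab.
have iw a b (ab : (a + b <= 2)%N) : (leb2 R).-integrable Om (EFin \o wD Om a b (z s)).
  apply: (Rint_le mO (mw _ _ ab) _ (Lp_norm_expr_integrable rho0 p1 p0 (mw _ _ ab) (Nfin _ _ ab))).
  by move=> x _; rewrite expr1.
have N1 a b (ab : (a + b <= 2)%N) : (Lp_norm Om p (wD Om a b (z s)) < d1%:E)%E.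
  by apply: (lt_le_trans (Ns _ _ ab)); rewrite lee_fin ge_min lexx.
have N4 a b (ab : (a + b <= 2)%N) : (Lp_norm Om p (wD Om a b (z s)) < d4%:E)%E.
  by apply: (lt_le_trans (Ns _ _ ab)); rewrite lee_fin ge_min lexx orbT.
have lz : L1loc Om (z s) by have [] := W 0%N 0%N isT.
have mz : measurable_fun (Om : set plane) (z s) by have [] := lz.
have zae := wD00_ae rho0 lz.
have iz : (leb2 R).-integrable Om (EFin \o z s) := Rint_ae_eq mO mz zae (iw 0%N 0%N isT).
have Iz : \int[leb2 R]_(x in Om) `|z s x| <= e1.
  apply: le_trans (H1 _ (mw 0%N 0%N isT) (N1 0%N 0%N isT)); rewrite le_eqVlt; apply/orP; left; apply/eqP.
  apply: ae_eq_Rintegral => //.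
  - by apply: measurableT_comp => //; exact: normr_measurable.
  - by apply: measurable_funX; apply: measurableT_comp; [exact: normr_measurable|exact: mw].
  - by apply: ae_mono zae => x H Ox; rewrite (H Ox) expr1.
have [[Wh _] _ Nh] := Yh se.
have [iT id] := bifurcation_identity rho0 sn Wh (Fh se) Nh (W 1%N 0%N isT) (W 0%N 1%N isT)
  iz (iw 1%N 0%N isT) (iw 0%N 1%N isT) sU helm bU (h_expansion sn uE).
have i4 a b (ab : (a + b <= 2)%N) := Lp_norm_expr_integrable rho0 p4 p0 (mw _ _ ab) (Nfin _ _ ab).
have := cubic_term_bounds rho0 sle1 sU hM iT (i4 1%N 0%N isT) (i4 0%N 1%N isT).
have Z1 := H4 _ (mw 1%N 0%N isT) (N4 1%N 0%N isT).
have Z2 := H4 _ (mw 0%N 1%N isT) (N4 0%N 1%N isT).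
rewrite /= -/c1 -/E4v.
have Ui := smooth_disk_integrable rho0 (smooth_mul sU sU).
have zUi := smooth_mul_integrable rho0 iz sU.
have DE : \int[leb2 R]_(x in Om) ((U x + z s x) * U x) =
    U2v + \int[leb2 R]_(x in Om) (z s x * U x).
  rewrite /U2v -(RintegralD mO Ui zUi); apply: eq_Rintegral => x _.
  by rewrite mulrDl.
have zU : `|\int[leb2 R]_(x in Om) (z s x * U x)| <= U2v / 2.
  apply: (le_trans (mul_smooth_integral_le rho0 iz sU hM1)).
  apply: (le_trans (ler_wpM2l M10 Iz)); exact: (mul_ratio_le M10 (ltW U2)).
rewrite DE in id => /andP[T1 T2].
exact: (quadratic_bounds_of_identity c10 c11 E4 U2 zU Z1 Z2 id T1 T2).
Qed.

End branch.

Unset Implicit Arguments.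

Theorem corollary5p2 (R : realType) (p rho lambda1 j eta : R)
    (alpha : R -> R) (y : R -> R * R -> R) (U : set (R * (R * R -> R)))
    (hp : 5 < p) (hrho : 0 < rho)
    (hlambda1_gt0 : 0 < lambda1)
    (hlambda1 : first_neumann_eigenvalue rho p lambda1)
    (hj : first_zero_besselJ1' j)
    (heta : 0 < eta)
    (halpha : smooth_on [set s | `|s| < eta] alpha)
    (halpha0 : alpha 0 = lambda1)
    (hy : smooth_curve (Arange rho p lambda1 `&` Yspace rho p) (Ynorm rho p)
            [set s | `|s| < eta] y)
    (hy0 : ae_eq_on (disk rho) (y 0) (cst 0))
    (hy'0 : curve_deriv (Ynorm rho p) y 0 (cst 0))
    (hU : nbhd_bif rho p lambda1 U)
    (hcurve : forall s, `|s| < eta ->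
       let h := fun x => s * u1 rho j x + y s x in
       U (alpha s, h) /\ ae_eq_on (disk rho) (Fop rho (alpha s) h) (cst 0))
    (hall : forall a h, U (a, h) ->
       ae_eq_on (disk rho) (Fop rho a h) (cst 0) ->
       ae_eq_on (disk rho) h (cst 0) \/
       (exists (s : R) (O : 'M[R]_2),
          [/\ `|s| < eta, orthogonal2 O, a = alpha s &
              ae_eq_on (disk rho) h
                (fun x => s * u1 rho j (mxapp O x) + y s (mxapp O x))])) :
  exists2 delta : R, 0 < delta <= eta &
    forall s, 0 < `|s| < delta -> s * derive1 alpha s < 0.
Proof.
have [j0 j'0 _] := hj.
have [d [d0 Hd]] := hy.
have Yy s : `|s| < eta -> Yspace rho p (y s).
  by move=> se; have [[_ Ys] _] := Hd 0%N s se; rewrite d0 in Ys.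
have Yh s : `|s| < eta -> Yspace rho p (fun x => s * u1 rho j x + y s x).
  by move=> se; have [Us _] := hcurve s se; have [_ Yh] := hU.1 _ _ Us.
have Fh s (se : `|s| < eta) := (hcurve s se).2.
have [m [c [C [r [c0 r0 bnd]]]]] :=
  @branch_quadratic_bounds R p rho j eta alpha y hp hrho j0 j'0 heta Yy hy0 hy'0 Yh Fh.
apply: (@derive1_sign_of_quadratic_max R alpha m c C r eta) => //.
- by move=> s se; exact: (halpha 0%N s se).
- by apply: (halpha 1%N 0); rewrite /= normr0.
Qed.
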